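(* For $\rho\in\Pi_d$ and $\lambda\ge0$ define on $\mathcal F^d_{bm}(\mathbf I)$ $$S_\rho(\lambda)=\frac{1}{\sqrt{\mathtt v(\rho)}}\sum_{\xi\in[0,\rho]_{\mathbf I}}(A^+_\xi+A^-_\xi)+\lambda\sum_{\xi\in[0,\rho]_{\mathbf I}}A^\circ_\xi,$$ and let $\varphi(X)=\langle X\Omega,\Omega\rangle$. Then for every integer $p\ge2$: (i) for every $\pi\in\mathcal{NC}^{1,i}_2(p)$ the limit $\lim_{\rho\to\infty}|\mathrm{BMO}(\pi,\rho)|/\mathtt v(\rho)^{b(\tilde\pi)}$ exists and equals $V(\tilde\pi)$; (ii) the limit $m_p(\lambda):=\lim_{\rho\to\infty}\varphi\big((S_\rho(\lambda))^p\big)$ exists and $$m_p(\lambda)=\sum_{\pi\in\mathcal{NC}^{1,i}_2(p)}\lambda^{s(\pi)}V(\tilde\pi).$$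
   Context: Cones and index sets: fix $d\in\mathbb N$ and one of: (a) $\Pi_d=\mathbb R_+^d\subset\mathbb R^d$ with coordinatewise order, $\mathbf I=\mathbb N^d$; (b) the Lorentz cone $\Pi_d=\{(t;x)\in\mathbb R\times\mathbb R^d:t\ge\|x\|\}$ with $(s;y)\preceq(t;x)$ iff $t-s\ge\|x-y\|$, $\mathbf I=\mathbb N\times\mathbb Z^d$; (c) $\Pi_d$ the positive semidefinite real symmetric $d\times d$ matrices, $\rho\preceq\xi$ iff $\xi-\rho$ positive semidefinite, $\mathbf I$ the positive semidefinite symmetric integer matrices. $\xi\prec\rho$ means $\xi\preceq\rho$, $\xi\ne\rho$. For $\rho\in\Pi_d$: $[0,\rho]=\{\xi:0\preceq\xi\preceq\rho\}$, $[0,\rho]_{\mathbf I}=[0,\rho]\cap\mathbf I$, and $\mathtt v(\rho)$ is the Lebesgue volume of $[0,\rho]$ in the minimal Euclidean space containing $\Pi_d$. Volume characteristic: for each such cone there is a sequence $(\gamma_m)_{m\ge1}$ with $\gamma_m=\mathtt v(\xi)^{-m}\int_{[0,\xi]}\mathtt v(\eta)^{m-1}\,d\eta$ for all $\xi$ in the interior of $\Pi_d$ (independent of $\xi$). Limit: $\lim_{\rho\to\infty}f(\rho)=\alpha$ means for every $\epsilon>0$ there is $\mu\in\Pi_d$ such that $|f(\rho)-\alpha|<\epsilon$ for all $\rho\in\Pi_d$ with $\mu\preceq\rho$. Fock space: for each $\xi\in\mathbf I$, $\mathcal H_\xi$ is a Hilbert space with orthonormal basis $\{e^m_\xi:m\ge0\}$,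 $\Omega:=e^0_\xi$ common to all $\xi$. $\mathcal F^d_{bm}(\mathbf I)$ is spanned by $\Omega$ and tensors $h_{\rho_n}\otimes\cdots\otimes h_{\rho_1}$ with $\rho_n\succ\cdots\succ\rho_1$ in $\mathbf I$, $h_{\rho_i}\in\mathcal H_{\rho_i}$, $h_{\rho_i}\perp\Omega$; tensors with different lengths or index sequences are orthogonal, $\Omega\perp$ all tensors, $\langle h_{\rho_n}\otimes\cdots\otimes h_{\rho_1},f_{\rho_n}\otimes\cdots\otimes f_{\rho_1}\rangle=\prod_i\langle h_{\rho_i},f_{\rho_i}\rangle$. Fix unit $g_\xi\in\mathcal H_\xi$, $g_\xi\perp\Omega$. $A^+_\xi\Omega=g_\xi$, $A^+_\xi(h_{\rho_n}\otimes\cdots\otimes h_{\rho_1})=g_\xi\otimes h_{\rho_n}\otimes\cdots\otimes h_{\rho_1}$ if $\xi\succ\rho_n$, else $0$; $A^-_\xi\Omega=0$, $A^-_\xi(h_{\rho_n}\otimes\cdots\otimes h_{\rho_1})=\langle g_\xi,h_{\rho_n}\rangle h_{\rho_{n-1}}\otimes\cdots\otimes h_{\rho_1}$ if $\xi=\rho_n$ (giving $\langle g_\xi,h_{\rho_1}\rangle\Omega$ if $n=1$), else $0$; $A^\circ_\xi\Omega=0$, $A^\circ_\xi(h_{\rho_n}\otimes\cdots\otimes h_{\rho_1})=\langle g_\xi,h_{\rho_n}\rangle h_{\rho_n}\otimes\cdots\otimes h_{\rho_1}$ if $\xi=\rho_n$, else $0$. Partitions: $\mathcal{NC}^1_2(p)$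 is the set of noncrossing partitions of $\{1,\dots,p\}$ all of whose blocks have 1 or 2 elements. For blocks $B_i\ne B_j$, write $B_i\prec_\pi B_j$ if $\min B_i<\min B_j\le\max B_j<\max B_i$ ($B_j$ nested inside $B_i$). A block is inner if it is nested inside some other block, outer otherwise. $B_j$ is a direct successor of $B_i$ if $B_i\prec_\pi B_j$ and there is no block $B_l$ with $B_i\prec_\pi B_l\prec_\pi B_j$. $\mathcal{NC}^{1,i}_2(p)$ is the set of $\pi\in\mathcal{NC}^1_2(p)$ in which every singleton is an inner block. $s(\pi)$ = number of singletons, $b(\cdot)$ = number of blocks, and $\tilde\pi$ (reduced partition) = the pair partition obtained from $\pi$ by deleting all singletons (and relabelling the remaining points in order), so $b(\tilde\pi)=(p-s(\pi))/2$. bm-ordered labellings: for $\pi\in\mathcal{NC}^{1}_2(p)$ and $\rho\in\Pi_d$, $\mathrm{BMO}(\pi,\rho)$ is the set of label functions $L:\pi\to[0,\rho]_{\mathbf I}$ (one label per block) such that: (1) if $B_j$ is a pair block and $B_i\prec_\pi B_j$ then $L(B_i)\preceq L(B_j)$; (2) if $B_j$ is a singleton which is a direct successor of $B_i$ then $L(B_i)=L(B_j)$. The function $V$ on noncrossing pair partitions is defined recursively: $V(\emptyset)=1$; $V(\sigma)=1$ if $\sigma$ has one block; if $\sigma$ has exactly one outer block, which contains the pair partition $\sigma'$ (the rest of $\sigma$) inside it, then $V(\sigma)=\gamma_{b(\sigma)}\,V(\sigma')$; if $\sigma$ is the concatenation $\sigma_1\cup\cdots\cup\sigma_k$ ($k\ge2$)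 of consecutive sub-partitions each having exactly one outer block, then $V(\sigma)=\prod_{i=1}^kV(\sigma_i)$.
   Formalization: The formula A°(h_n⊗…)=⟨g,h_n⟩h_n⊗… is not linear; it is read as ⟨g,h_n⟩g⊗…, which agrees on all vectors reached from Ω. For PSD matrices v is Lebesgue volume in the entries (i,j), i≤j, since Frobenius volume would change the limit by a constant. d≥1. *)

(* Defs.v *)
From HB Require Import structures.
From mathcomp Require Import all_boot all_order all_algebra finmap.
From mathcomp Require Import all_classical all_reals all_analysis.
From mathcomp Require Import complex.
Unset Printing Implicit Defensive.
Import Order.TTheory GRing.Theory Num.Theory numFieldNormedType.Exports.
Local Open Scope ring_scope.
Local Open Scope classical_set_scope.

Inductive cone_kind := Orthant | Lorentz | PSD.

(* Coordinate index set of the minimal Euclidean space containing Pi_d: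
   (a) R^d; (b) R x R^d, None = time coordinate t; (c) symmetric d x d
   matrices, coordinates = entries (i,j) with i <= j. *)
Definition coord (k : cone_kind) (d : nat) : finType :=
  match k with
  | Orthant => 'I_d
  | Lorentz => option 'I_d
  | PSD => {q : 'I_d * 'I_d | (q.1 <= q.2)%N}
  end.

Lemma sidx_proof {d} (i j : 'I_d) :
  ((if (i <= j)%N then (i, j) else (j, i)).1 <= (if (i <= j)%N then (i, j) else (j, i)).2)%N.
Proof. by case: ifP => //= /negbT; rewrite -ltnNge => /ltnW. Qed.

(* coordinate carrying the (i,j) = (j,i) entry of a symmetric matrix *)
Definition sidx {d} (i j : 'I_d) : {q : 'I_d * 'I_d | (q.1 <= q.2)%N} :=
  exist (fun q : 'I_d * 'I_d => (q.1 <= q.2)%N) _ (sidx_proof i j).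

Section Cones.
Variable R : realType.

Definition pt k d := coord k d -> R.

Definition cle {k : cone_kind} {d : nat} : pt k d -> pt k d -> Prop :=
  match k as k0 return pt k0 d -> pt k0 d -> Prop with
  | Orthant => fun a b => forall j : 'I_d, a j <= b j
  | Lorentz => fun a b =>
      Num.sqrt (\sum_(i < d) (b (Some i) - a (Some i)) ^+ 2) <= b None - a None
  | PSD => fun a b => forall v : 'I_d -> R,
      0 <= \sum_(i < d) \sum_(j < d) v i * (b (sidx i j) - a (sidx i j)) * v j
  end.

Definition zero_pt k d : pt k d := fun _ => 0.

Definition in_cone {k d} (x : pt k d) : Prop := cle (zero_pt k d) x.

Definition ival {k d} (rho : pt k d) : set (pt k d) :=
  [set x | cle (zero_pt k d) x /\ cle x rho].

(* iterated one-dimensional Lebesgue integration over the coordinates in s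
   (for nonnegative measurable integrands this is the Lebesgue integral
   on R^(coordinates), by Tonelli) *)
Fixpoint iint {T : eqType} (s : seq T) (f : (T -> R) -> \bar R) (x : T -> R)
  : \bar R :=
  match s with
  | [::] => f x
  | j :: s' => (\int[@lebesgue_measure R]_t
                   iint s' f (fun i => if i == j then t else x i))%E
  end.

Definition amb_int {k d} (f : pt k d -> \bar R) : \bar R :=
  iint (enum (coord k d)) f (zero_pt k d).

Definition vol {k d} (rho : pt k d) : R :=
  fine (amb_int (fun x => (\1_(ival rho) x)%:E)).

Definition xi0 (k : cone_kind) (d : nat) : pt k d :=
  match k as k0 return pt k0 d with
  | Orthant => fun _ => 1
  | Lorentz => fun j => if j is None then 1 else 0
  | PSD => fun q => if (val q).1 == (val q).2 then 1 else 0
  end.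

(* volume characteristic gamma_m (computed at the interior point xi0) *)
Definition gamma k d (m : nat) : R :=
  (vol (xi0 k d)) ^- m *
  fine (amb_int (fun eta => (\1_(ival (xi0 k d)) eta * vol eta ^+ m.-1)%:E)).

Definition lat k d := {ffun coord k d -> int}.

Definition lpt {k d} (z : lat k d) : pt k d := fun j => (z j)%:~R.

Definition inI {k : cone_kind} {d : nat} : lat k d -> Prop :=
  match k as k0 return lat k0 d -> Prop with
  | Orthant => fun z => forall j, (0 <= z j)%R
  | Lorentz => fun z => (0 <= z None)%R
  | PSD => fun z => in_cone (lpt z)
  end.

Definition ibox {k d} (rho : pt k d) : set (lat k d) :=
  [set z | inI z /\ ival rho (lpt z)].

Definition clt {k d} (z w : lat k d) : Prop := cle (lpt z) (lpt w) /\ z <> w.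

Definition cone_limR {k d} (f : pt k d -> R) (a : R) : Prop :=
  forall eps : R, 0 < eps -> exists mu : pt k d, in_cone mu /\
    forall rho : pt k d, in_cone rho -> cle mu rho -> `|f rho - a| < eps.

Definition cabs (z : R[i]) : R := let: Complex a b := z in Num.sqrt (a ^+ 2 + b ^+ 2).

Definition cone_limC {k d} (f : pt k d -> R[i]) (a : R[i]) : Prop :=
  forall eps : R, 0 < eps -> exists mu : pt k d, in_cone mu /\
    forall rho : pt k d, in_cone rho -> cle mu rho -> cabs (f rho - a) < eps.

End Cones.

Arguments cle {R k d}.
Arguments in_cone {R k d}.
Arguments ival {R k d}.
Arguments iint {R T}.
Arguments amb_int {R k d}.
Arguments vol {R k d}.
Arguments ibox {R k d}.
Arguments clt {R k d}.
Arguments cone_limR {R k d}.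
Arguments cone_limC {R k d}.
Arguments cabs {R}.

Section Partitions.
Local Close Scope classical_set_scope.
Variable p : nat.
Implicit Types (P : {set {set 'I_p}}) (B : {set 'I_p}).

Definition bmin (B : {set 'I_p}) : nat := \big[minn/p]_(i in B) (i : nat).
Definition bmax B : nat := \max_(i in B) (i : nat).

Definition nested B1 B2 : bool :=
  [&& B1 != B2, (bmin B1 < bmin B2)%N, (bmin B2 <= bmax B2)%N & (bmax B2 < bmax B1)%N].

Definition noncrossing P : bool :=
  [forall B1 in P, forall B2 in P, (B1 != B2) ==>
     ~~ [exists a : 'I_p, exists b : 'I_p, exists c : 'I_p, exists e : 'I_p,
          [&& (a < b)%N, (b < c)%N, (c < e)%N, a \in B1, c \in B1,
              b \in B2 & e \in B2]]].

Definition inner_block P B : bool := [exists B' in P, nested B' B].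

Definition direct_succ P B1 B2 : bool :=
  nested B1 B2 && ~~ [exists B3 in P, nested B1 B3 && nested B3 B2].

Definition NC12 P : bool :=
  [&& finset.partition P [set: 'I_p]%SET,
      [forall B in P, (#|B| == 1%N) || (#|B| == 2%N)] & noncrossing P].

Definition NC12i P : bool :=
  NC12 P && [forall B in P, (#|B| == 1%N) ==> inner_block P B].

Definition nsing P : nat := #|[set B in P | #|B| == 1%N]|.

(* b(tilde pi) : number of pair blocks = number of blocks of tilde pi *)
Definition npairs P : nat := #|[set B in P | #|B| == 2%N]|.

(* The reduced pair partition tilde pi (singletons deleted, points relabelled
   in order), encoded as its Dyck word: one letter per remaining point, in
   increasing order, true = opener (smaller element of its pair),
   false = closer.  A noncrossing pair partition is determined by it. *)
Definition reduced_word P : seq bool :=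
  [seq (nat_of_ord x == bmin (finset.pblock P x))
     | x <- [seq y <- enum 'I_p | #|finset.pblock P y| == 2%N]].

End Partitions.

Arguments bmin {p}.
Arguments bmax {p}.
Arguments nested {p}.
Arguments noncrossing {p}.
Arguments inner_block {p}.
Arguments direct_succ {p}.
Arguments NC12 {p}.
Arguments NC12i {p}.
Arguments nsing {p}.
Arguments npairs {p}.
Arguments reduced_word {p}.

Section Vfun.
Variable R : realType.
Variable g : nat -> R.

(* length of the first component (with exactly one outer block) *)
Definition first_return (w : seq bool) : nat :=
  find (fun n => (0 < n)%N && (count id (take n w) == count negb (take n w)))
       (iota 0 (size w).+1).

Fixpoint Vw (fuel : nat) (w : seq bool) : R :=
  match fuel with
  | 0 => 1
  | f.+1 =>
    if w is [::] then 1
    else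
      let n := first_return w in
      if drop n w is [::] then
        (* exactly one outer block, containing sigma' *)
        if size w == 2%N then 1
        else g (size w %/ 2) * Vw f (behead (take (size w).-1 w))
      else
        Vw f (take n w) * Vw f (drop n w)
  end.

Definition Vpp (w : seq bool) : R := Vw (size w) w.
End Vfun.
Arguments Vw {R}.
Arguments Vpp {R}.

Section BMO.
Variable R : realType.
Variables (k : cone_kind) (d p : nat).

Definition blk (P : {set {set 'I_p}}) := {B : {set 'I_p} | B \in P}.

Definition BMO (P : {set {set 'I_p}}) (rho : pt R k d)
  : set {ffun blk P -> lat k d} :=
  [set L | (forall B, ibox rho (L B)) /\
     (forall Bi Bj : blk P, #|val Bj| == 2%N -> nested (val Bi) (val Bj) ->
          cle (lpt R (L Bi)) (lpt R (L Bj))) /\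
     (forall Bi Bj : blk P, #|val Bj| == 1%N -> direct_succ P (val Bi) (val Bj) ->
          L Bi = L Bj)].

Definition card_BMO (P : {set {set 'I_p}}) (rho : pt R k d) : nat :=
  #|` fset_set (BMO P rho)|%fset.
End BMO.
Arguments BMO {R k d p}.
Arguments card_BMO {R k d p}.

(* Each H_xi has orthonormal basis (e^m_xi)_{m>=0}, e^0_xi = Omega.
   The Fock space has orthonormal basis Omega (the empty sequence) and
   e^{m_n}_{rho_n} (x) ... (x) e^{m_1}_{rho_1}, rho_n > ... > rho_1 in I,
   m_i >= 1, encoded as the sequence [:: (rho_n,m_n); ...; (rho_1,m_1)].
   A vector is given by its coordinates in this basis.
   g_xi = sum_m c xi m e^m_xi. *)
Section Fock.
Variable R : realType.
Variables (k : cone_kind) (d : nat).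
Local Notation C := R[i].
Local Notation L := (lat k d).
Local Open Scope complex_scope.

Definition fvec := seq (L * nat) -> C.

Definition Omega : fvec := fun s => if s is [::] then 1 else 0.

Definition csum (u : nat -> C) : C :=
  Complex (limn (series (fun m => let: Complex a _ := u m in a)))
          (limn (series (fun m => let: Complex _ b := u m in b))).

Variable c : L -> nat -> C.

Definition above (xi : L) (s : seq (L * nat)) : Prop :=
  if s is (eta, _) :: _ then clt (R:=R) eta xi else True.

Definition Aplus (xi : L) (v : fvec) : fvec := fun s =>
  match s with
  | (eta, m) :: s' => if `[< eta = xi /\ above xi s' >] then c xi m * v s' else 0
  | [::] => 0
  end.

(* annihilation A^-_xi : first factor h paired as <g_xi, h> *)
Definition Aminus (xi : L) (v : fvec) : fvec := fun s =>
  csum (fun m => (c xi m)^* * v ((xi, m) :: s)).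

(* conservation A^o_xi : first factor h mapped to <g_xi, h> g_xi *)
Definition Acons (xi : L) (v : fvec) : fvec := fun s =>
  match s with
  | (eta, m) :: s' =>
      if `[< eta = xi >] then c xi m * csum (fun j => (c xi j)^* * v ((xi, j) :: s'))
      else 0
  | [::] => 0
  end.

Definition Sop (rho : pt R k d) (lam : R) (v : fvec) : fvec := fun s =>
  ((Num.sqrt (vol rho))^-1)%:C *
     (\sum_(xi \in ibox rho) (Aplus xi v s + Aminus xi v s))%R
  + lam%:C * (\sum_(xi \in ibox rho) Acons xi v s)%R.

(* phi(X) = <X Omega, Omega> = Omega-coordinate of X Omega *)
Definition moment (rho : pt R k d) (lam : R) (n : nat) : C :=
  iter n (Sop rho lam) Omega [::].
End Fock.
Arguments moment {R k d}.

(* Main.v *)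
Require Import Defs.
From HB Require Import structures.
From mathcomp Require Import all_boot all_order all_algebra finmap.
From mathcomp Require Import all_classical all_reals all_analysis.
From mathcomp Require Import measurable_realfun.
From mathcomp Require Import complex ring lra zify.
Import Order.TTheory GRing.Theory Num.Theory numFieldNormedType.Exports.
Local Open Scope ring_scope.
Local Open Scope classical_set_scope.


(** Expanding the power of the operator and reading its factors from the last one
applied, every nonzero term is a Motzkin word together with labels: an annihilator
opens a pair, the matching creator closes it, and a conservation operator repeats
the label of the innermost open pair. Words correspond to the partitions of the
theorem, and for a fixed word the labellings are those counted by [BMO], except
that the operators force strict inequalities.

Both the weak and the strict counts of a nested family of pairs with [b] blocks are
squeezed between [c * v(rho - l e) ^ b] and [c * v(rho + l e) ^ b], with [e] a fixed
interior point and [c] the product of volume characteristics given by [V]. This is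
proved by induction on the nesting: the sum over the outermost label is a Riemann
sum of [v(rho - xi) ^ (m - 1)], compared cell by cell with its integral, and that
integral equals [gamma_m * v(rho) ^ m] because linear automorphisms of the cone act
transitively on its interior and scale Lebesgue measure by a constant factor
(uniqueness of Haar measure, obtained here from Tonelli's theorem). *)

(** * Iterated Lebesgue integrals *)

(** The labels nested inside a pair labelled $\xi$ lie in $[\xi, \rho]$, a translate of
    $[0, \rho - \xi]$. A subforest count therefore depends on $\xi$, asymptotically, through $v(\rho
    - \xi)$ alone, and the reflection $\xi \mapsto \rho - \xi$ turns the sum over $\xi$ into the
    integral defining $\gamma_m$. The errors, from lattice cells at the boundary and from coinciding
    labels, are never estimated one by one: all are moved into the shift $l e$. Since [e] is
    interior, a fixed multiple of it dominates every vector of a unit cell, and a label exceeding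
    another by such a multiple differs from it. The shift survives the induction because volume is
    monotone, and it disappears in the limit by homogeneity: as soon as $(l / \delta) e \preceq
    \rho$, the volumes $v(\rho \pm l e)$ lie between $(1 - \delta)^n v(\rho)$ and $(1 + \delta)^n
    v(\rho)$, where $n$ is the dimension. A limit along the cone order supplies exactly this
    condition. The scaling factor of an automorphism is likewise never computed as a determinant; it
    is the quotient of the volumes of two order intervals. *)

Section Lebesgue1.
Context {R : realType}.
Local Notation mu := (@lebesgue_measure R).
Local Open Scope ereal_scope.

Lemma affine_measurable (c a : R) :
  measurable_fun [set: measurableTypeR R] ((fun t => c * t + a)%R : _ -> measurableTypeR R).
Proof. by apply: measurable_funD => //; exact: measurable_funM. Qed.

Lemma preimage_affine_itv (c a u v : R) : (0 < c)%R ->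
  (fun t : R => c * t + a)%R @^-1` `]u, v]%classic = `](u - a) / c, (v - a) / c]%classic%R.
Proof.
by move=> c0; apply/seteqP; split => x; rewrite /= !in_itv/= ltr_pdivrMr// ler_pdivlMr//
    ltrBlDr lerBrDr (mulrC x).
Qed.

(** The pushforward of Lebesgue measure, rescaled by [c], agrees with Lebesgue measure on half-open
    intervals, hence on all Borel sets. *)
Lemma integral_affine (c a : R) (f : R -> \bar R) : (0 < c)%R ->
  measurable_fun setT f -> (forall t, 0 <= f t) ->
  \int[mu]_t f t = c%:E * \int[mu]_t f (c * t + a)%R.
Proof.
move=> c0 mf f0; pose c' := NngNum (ltW c0).
have mg := affine_measurable c a.
pose p0 : {measure set (measurableTypeR R) -> \bar R} :=
  pushforward mu ((fun t => c * t + a)%R : _ -> measurableTypeR R).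
pose p := p0 mg.
have : \int[mscale c' p]_t f t = c%:E * \int[mu]_t f (c * t + a)%R.
  rewrite ge0_integral_mscale//; congr (_ * _).
  by rewrite ge0_integral_pushforward.
move=> <-; apply: eq_measure_integral => A mA _.
rewrite -(@lebesgue_measure_unique R (mscale c' p)) => //= _ [[u v]] _ <-.
rewrite /mscale /pushforward/=.
transitivity (c%:E * mu `]((u - a) / c)%R, ((v - a) / c)%R]%classic); last first.
  by congr (_ * mu _); apply: esym; exact: (preimage_affine_itv c a u v c0).
rewrite !lebesgue_measure_itv/= !lte_fin ltr_pM2r ?invr_gt0// ltrD2r.
case: ifPn => _; last by rewrite mule0.
rewrite -!EFinB -EFinM; congr (_%:E).
by rewrite -mulrBl opprB addrA subrK mulrCA divff ?gt_eqF// mulr1.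
Qed.
End Lebesgue1.

Section IteratedIntegral.
Context {R : realType} {T : eqType}.
Local Notation mu := (@lebesgue_measure R).
Implicit Types (s : seq T) (x y : T -> R).

Definition upd x (j : T) (t : R) : T -> R := fun i => if i == j then t else x i.

(* Measurability for the product sigma-algebra, tested on all coordinatewise
   measurable maps into [T -> R]. *)
Definition cmeas {d'} {U : sigmaRingType d'} (f : (T -> R) -> U) : Prop :=
  forall d (Z : measurableType d) (phi : Z -> T -> R),
    (forall j, measurable_fun setT (fun z => phi z j)) ->
    measurable_fun setT (fun z => f (phi z)).

Definition cmeas2 {d'} {U : sigmaRingType d'} (f : (T -> R) -> (T -> R) -> U) : Prop :=
  forall d (Z : measurableType d) (phi psi : Z -> T -> R),
    (forall j, measurable_fun setT (fun z => phi z j)) ->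
    (forall j, measurable_fun setT (fun z => psi z j)) ->
    measurable_fun setT (fun z => f (phi z) (psi z)).

Lemma measurable_upd d (Z : measurableType d) (phi : Z -> T -> R) (tau : Z -> R) j :
  (forall i, measurable_fun setT (fun z => phi z i)) -> measurable_fun setT tau ->
  forall i, measurable_fun setT (fun z => upd (phi z) j (tau z) i).
Proof. by move=> mphi mtau i; rewrite /upd; case: eqP. Qed.

Lemma measurable_updT x j i : measurable_fun setT (fun t : R => upd x j t i).
Proof. exact: measurable_upd. Qed.

Lemma cmeas_upd d' (U : sigmaRingType d') (f : (T -> R) -> U) x j :
  cmeas f -> measurable_fun setT (fun t : R => f (upd x j t)).
Proof. by move=> mf; apply: mf; exact: measurable_updT. Qed.

Local Open Scope ereal_scope.

Lemma iint_ge0 s (f : (T -> R) -> \bar R) x : (forall y, 0 <= f y) -> 0 <= iint s f x.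
Proof. by move=> f0; elim: s x => //= j s IH x; apply: integral_ge0. Qed.

Lemma cmeas_iint s (f : (T -> R) -> \bar R) :
  cmeas f -> (forall y, 0 <= f y) -> cmeas (iint s f).
Proof.
move=> mf f0; elim: s => //= j s IH d Z phi mphi.
apply: (@measurable_fun_fubini_tonelli_F _ _ Z (measurableTypeR R) R mu
  (fun zt : Z * R => iint s f (upd (phi zt.1) j zt.2))) => [|x]; last exact: iint_ge0.
apply: IH => i; apply: measurable_upd => // k.
exact: (measurableT_comp (mphi k)).
Qed.

Lemma le_iint s (f g : (T -> R) -> \bar R) x : cmeas f -> cmeas g ->
  (forall y, 0 <= f y) -> (forall y, f y <= g y) -> iint s f x <= iint s g x.
Proof.
move=> mf mg f0 fg; have g0 y : 0 <= g y by exact: le_trans (fg y).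
elim: s x => //= j s IH x.
apply: ge0_le_integral => //.
- by move=> t _; exact: iint_ge0.
- by apply: (cmeas_upd _ _ (iint s f)); exact: cmeas_iint.
- by apply: (cmeas_upd _ _ (iint s g)); exact: cmeas_iint.
Qed.

Lemma iint_sum s (I : Type) (r : seq I) (f : I -> (T -> R) -> \bar R) x :
  (forall i, cmeas (f i)) -> (forall i y, 0 <= f i y) ->
  iint s (fun y => \sum_(i <- r) f i y) x = \sum_(i <- r) iint s (f i) x.
Proof.
move=> mf f0; elim: s x => //= j s IH x.
under eq_integral do rewrite IH.
rewrite ge0_integral_sum//; last by move=> *; exact: iint_ge0.
by move=> i; apply: (cmeas_upd _ _ (iint s (f i))); exact: cmeas_iint.
Qed.

Lemma iintZl s (c : \bar R) (f : (T -> R) -> \bar R) x : 0 <= c ->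
  cmeas f -> (forall y, 0 <= f y) ->
  iint s (fun y => c * f y) x = c * iint s f x.
Proof.
move=> c0 mf f0; elim: s x => //= j s IH x.
under eq_integral do rewrite IH.
rewrite ge0_integralZl// => [|t _]; last exact: iint_ge0.
by apply: (cmeas_upd _ _ (iint s f)); exact: cmeas_iint.
Qed.

Lemma iint_shift s (f : (T -> R) -> \bar R) a x : cmeas f -> (forall y, 0 <= f y) ->
  iint s (fun y => f (fun i => y i + a i)%R) x = iint s f (fun i => x i + a i)%R.
Proof.
move=> mf f0; elim: s x => //= j s IH x.
rewrite [RHS](integral_affine 1 (a j))//; last 2 first.
- by apply: (cmeas_upd _ _ (iint s f)); exact: cmeas_iint.
- by move=> t; exact: iint_ge0.
rewrite mul1e; apply: eq_integral => t _; rewrite IH; congr iint.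
by apply/funext => i; case: eqP => // ->; rewrite mul1r.
Qed.

Lemma iint_scale s (f : (T -> R) -> \bar R) (c : R) x : (0 < c)%R ->
  cmeas f -> (forall y, 0 <= f y) ->
  iint s f (fun i => c * x i)%R = (c ^+ size s)%:E * iint s (fun y => f (fun i => c * y i)%R) x.
Proof.
move=> c0 mf f0; elim: s x => [|j s IH] x /=; first by rewrite mul1e.
rewrite (integral_affine c 0)//; last 2 first.
- by apply: (cmeas_upd _ _ (iint s f)); exact: cmeas_iint.
- by move=> t; exact: iint_ge0.
rewrite exprS EFinM -muleA; congr (_ * _).
rewrite -ge0_integralZl_EFin//; last 3 first.
- by move=> t _; exact: iint_ge0.
- apply: (cmeas_upd _ _ (iint s (fun y => f (fun i => c * y i)%R))); apply: cmeas_iint => //.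
  by move=> d Z phi mphi; apply: mf => k; exact: measurable_funM.
- by rewrite exprn_ge0// ltW.
apply: eq_integral => t _; rewrite -IH; congr iint.
by apply/funext => i; case: eqP => // _; rewrite addr0.
Qed.

Lemma eq_iint s (f g : (T -> R) -> \bar R) x :
  (forall y, (forall i, i \notin s -> y i = x i) -> f y = g y) ->
  iint s f x = iint s g x.
Proof.
elim: s x => /= [|j s IH] x fg; first exact: fg.
apply: eq_integral => t _; apply: IH => y yx; apply: fg => i.
by rewrite inE negb_or => /andP[/negbTE ij /yx ->]; rewrite ij.
Qed.

Lemma iint_base s (f : (T -> R) -> \bar R) x y :
  (forall i, i \notin s -> x i = y i) -> iint s f x = iint s f y.
Proof.
elim: s x y => /= [|j s IH] x y xy; first by congr f; apply/funext => i; exact: xy.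
apply: eq_integral => t _; apply: IH => i si; case: eqVneq => // ij.
by apply: xy; rewrite inE negb_or ij.
Qed.

(** Stated along arbitrary measurable [tau] and [phi] so that the induction may replace [Z] by
    [Z * R], whose second factor holds the next integration variable. *)
Lemma measurable_iint_param dP (P : measurableType dP) s (f : P -> (T -> R) -> \bar R) :
  (forall d (Z : measurableType d) (tau : Z -> P) (phi : Z -> T -> R),
    measurable_fun setT tau -> (forall j, measurable_fun setT (fun z => phi z j)) ->
    measurable_fun setT (fun z => f (tau z) (phi z))) ->
  (forall t y, 0 <= f t y) ->
  forall d (Z : measurableType d) (tau : Z -> P) (phi : Z -> T -> R),
    measurable_fun setT tau -> (forall j, measurable_fun setT (fun z => phi z j)) ->
    measurable_fun setT (fun z => iint s (f (tau z)) (phi z)).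
Proof.
move=> mf f0; elim: s => [|i s IHs] d Z tau phi mtau mphi /=; first exact: mf.
apply: (@measurable_fun_fubini_tonelli_F _ _ Z (measurableTypeR R) R mu
  (fun zt : Z * R => iint s (f (tau zt.1)) (upd (phi zt.1) i zt.2))) => [|y].
  apply: IHs => [|k]; first exact: measurableT_comp.
  by apply: measurable_upd => // l; exact: (measurableT_comp (mphi l)).
exact: iint_ge0.
Qed.

Lemma integral_iint_swap s (f : R -> (T -> R) -> \bar R) x :
  (forall d (Z : measurableType d) (tau : Z -> R) (phi : Z -> T -> R),
    measurable_fun setT tau -> (forall j, measurable_fun setT (fun z => phi z j)) ->
    measurable_fun setT (fun z => f (tau z) (phi z))) ->
  (forall t y, 0 <= f t y) ->
  \int[mu]_t iint s (f t) x = iint s (fun y => \int[mu]_t f t y) x.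
Proof.
move=> mf f0; elim: s x => //= j s IH x.
under [RHS]eq_integral do rewrite -IH.
apply: (@fubini_tonelli _ _ (measurableTypeR R) (measurableTypeR R) R mu mu (fun tr : R * R => iint s (f tr.1) (upd x j tr.2))) => [|z]; last first.
  exact: iint_ge0.
apply: measurable_iint_param => //; exact: measurable_upd.
Qed.

Lemma iint_swap s s' (f : (T -> R) -> (T -> R) -> \bar R) x y :
  cmeas2 f -> (forall x y, 0 <= f x y) ->
  iint s' (fun y => iint s (f y) x) y = iint s (fun x => iint s' (f ^~ x) y) x.
Proof.
move=> mf f0; elim: s' y => //= j s' IH y.
under eq_integral do rewrite IH.
apply: (integral_iint_swap s (fun t x => iint s' (f^~ x) (upd y j t))); last first.
  by move=> *; exact: iint_ge0.
move=> d Z tau phi mtau mphi.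
apply: (measurable_iint_param _ Z s' (fun z y => f y (phi z)) _ _ d Z id) => //; last first.
  exact: measurable_upd.
move=> d' Z' tau' phi' mtau' mphi'; apply: mf => // k.
exact: (measurableT_comp (mphi k)).
Qed.
End IteratedIntegral.

Section FullIntegral.
Context {R : realType} {T : finType}.
Local Notation mu := (@lebesgue_measure R).
Local Notation V := (T -> R).
Local Open Scope ereal_scope.

Definition amb (f : V -> \bar R) : \bar R := iint (enum T) f (fun _ => 0%R).

Lemma ambE (f : V -> \bar R) x : iint (enum T) f x = amb f.
Proof. by apply: iint_base => i; rewrite mem_enum. Qed.

Lemma amb_ge0 (f : V -> \bar R) : (forall y, 0 <= f y) -> 0 <= amb f.
Proof. exact: iint_ge0. Qed.

Lemma le_amb (f g : V -> \bar R) : cmeas f -> cmeas g ->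
  (forall y, 0 <= f y) -> (forall y, f y <= g y) -> amb f <= amb g.
Proof. exact: le_iint. Qed.

Lemma ambZl (c : \bar R) (f : V -> \bar R) : 0 <= c -> cmeas f ->
  (forall y, 0 <= f y) -> amb (fun y => c * f y) = c * amb f.
Proof. exact: iintZl. Qed.

Lemma amb_sum (I : Type) (r : seq I) (f : I -> V -> \bar R) :
  (forall i, cmeas (f i)) -> (forall i y, 0 <= f i y) ->
  amb (fun y => \sum_(i <- r) f i y) = \sum_(i <- r) amb (f i).
Proof. exact: iint_sum. Qed.

Lemma amb_shift a (f : V -> \bar R) : cmeas f -> (forall y, 0 <= f y) ->
  amb (fun y => f (fun i => y i + a i)%R) = amb f.
Proof. by move=> mf f0; rewrite /amb iint_shift// ambE. Qed.

Lemma amb_scale (c : R) (f : V -> \bar R) : (0 < c)%R -> cmeas f -> (forall y, 0 <= f y) ->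
  amb f = (c ^+ #|T|)%:E * amb (fun y => f (fun i => c * y i)%R).
Proof.
by move=> c0 mf f0; rewrite -(ambE f (fun i => c * 0)%R) (iint_scale _ _ c)// cardE.
Qed.

Lemma amb_swap (f : V -> V -> \bar R) : cmeas2 f -> (forall x y, 0 <= f x y) ->
  amb (fun y => amb (f y)) = amb (fun x => amb (f^~ x)).
Proof. exact: iint_swap. Qed.

Lemma cmeas_amb (f : V -> V -> \bar R) : cmeas2 f -> (forall x y, 0 <= f x y) ->
  cmeas (fun y => amb (f y)).
Proof.
move=> mf f0 d Z phi mphi.
apply: (measurable_iint_param _ Z _ (fun z => f (phi z)) _ _ d Z id (fun _ _ => 0%R)) => //.
by move=> d' Z' tau psi mtau mpsi; apply: mf => // j; exact: (measurableT_comp (mphi j)).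
Qed.

(** Half-open, so that integer translates tile the space: it normalises the measure and also marks
    the lattice cell of a point. *)
Definition cube01 (x : V) : R := \prod_(i : T) \1_(`[0%R, 1%R[%classic) (x i).

Lemma cube01E x : cube01 x = ([forall i, (0 <= x i < 1)%R])%:R.
Proof.
rewrite /cube01; case: forallP => [xP|xP].
  apply: big1 => i _; rewrite indicE (_ : _ \in _ = true)//.
  by apply/mem_set; rewrite /= in_itv/=; exact: xP.
have [i xi] : exists i, ~ (0 <= x i < 1)%R by exact/existsNP.
rewrite (bigD1 i)//= indicE memNset ?mul0r//.
Qed.

Lemma cube01_ge0 x : (0 <= cube01 x)%R.
Proof. by rewrite cube01E. Qed.

Lemma cmeas_cube01 : cmeas cube01.
Proof.
move=> d Z phi mphi; rewrite /cube01; apply: measurable_prod => i _; apply: (@measurableT_comp _ _ _ _ _ _ (\1_(`[0%R, 1%R[%classic) : R -> R)) => //.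
Qed.

Lemma amb_cube01 : amb (fun x => (cube01 x)%:E) = 1.
Proof.
have mI : measurable_fun setT (\1_(`[0%R, 1%R[%classic) : R -> R).
  exact: measurable_indic.
rewrite /amb /cube01.
(* The product is restricted to the coordinates still to be integrated, so that each integration
   splits off one factor. *)
suff H (s : seq T) x : uniq s ->
    iint s (fun y : V => (\prod_(i <- s) \1_(`[0%R, 1%R[%classic) (y i))%R%:E) x = 1 :> \bar R.
  rewrite -[RHS](H (enum T) (fun=> 0%R) (enum_uniq T)).
  by congr iint; apply/funext => y; rewrite big_enum.
elim: s x => [|j s IH] x /=; first by rewrite big_nil.
move=> /andP[js us].
under eq_integral => t _.
  rewrite (eq_iint _ _ (fun y => (\1_(`[0%R, 1%R[%classic) t)%:E *
    (\prod_(i <- s) \1_(`[0%R, 1%R[%classic) (y i))%R%:E)); last first.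
    by move=> y yt; rewrite big_cons EFinM (yt _ js) eqxx.
  rewrite iintZl// ?IH// ?mule1; last 2 first.
  - move=> d Z phi mphi; apply/measurable_EFinP.
    apply: measurable_prod => i _.
    exact: measurableT_comp.
  - by move=> y; rewrite lee_fin; apply: prodr_ge0.
  over.
rewrite integral_indic// setIT; transitivity (mu `[0%R, 1%R[%classic) => //.
by rewrite lebesgue_measure_itv/= lte_fin ltr01 oppr0 adde0.
Qed.

(* Uniqueness of Haar measure: both sides are the value of the double integral
   of [cube01 y * f (g x + y)]. *)
Lemma amb_additive_comp (g g' : V -> V) (f : V -> \bar R) :
  (forall x y, g (fun i => x i + y i)%R = (fun i => g x i + g y i)%R) ->
  cancel g' g -> (forall j, cmeas (g^~ j)) -> cmeas f -> (forall y, 0 <= f y) ->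
  amb (fun x => f (g x)) = amb f * amb (fun x => (cube01 (fun i => - g x i)%R)%:E).
Proof.
move=> gD gg' mg mf f0.
have mQ : cmeas (fun x => (cube01 x)%:E : \bar R).
  by move=> d Z phi mphi; apply/measurable_EFinP; exact: cmeas_cube01.
have Q0 x : 0 <= (cube01 x)%:E by rewrite lee_fin cube01_ge0.
have mfg : cmeas (fun x => f (g x)).
  by move=> d Z phi mphi; apply: mf => j; exact: mg.
pose F y x := (cube01 y)%:E * f (fun i => g x i + y i)%R.
have F0 y x : 0 <= F y x by rewrite mule_ge0.
have mF : cmeas2 F.
  move=> d Z phi psi mphi mpsi; apply: emeasurable_funM; first exact: mQ.
  by apply: mf => j; apply: measurable_funD => //; exact: mg.
pose G y x := (cube01 (fun i => y i - g x i)%R)%:E * f y.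
have G0 y x : 0 <= G y x by rewrite mule_ge0.
have mG : cmeas2 G.
  move=> d Z phi psi mphi mpsi; apply: emeasurable_funM; last exact: mf.
  by apply: mQ => j; apply: measurable_funB => //; exact: mg.
transitivity (amb (fun y => amb (F y))).
  rewrite -[LHS]mule1 -amb_cube01 -ambZl//; last exact: amb_ge0.
  congr amb; apply/funext => y; rewrite muleC /F ambZl//; last first.
    by move=> d Z phi mphi; apply: mf => j; apply: measurable_funD => //; exact: mg.
  (* Translating [x] by [g' y] adds [y] inside [f], because [g] is additive and [g (g' y) = y]. *)
  congr (_ * _); rewrite -[LHS](amb_shift (g' y))//; congr amb; apply/funext => x.
  by rewrite gD gg'.
rewrite amb_swap//.
transitivity (amb (fun y => amb (G y))).
  rewrite [RHS]amb_swap//; congr amb; apply/funext => x.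
  (* Translating [y] by [- g x] frees the argument of [f] from [x], which then occurs only in the
     cube. *)
  rewrite -(amb_shift (fun i => - g x i)%R); last 2 first.
  - move=> d Z phi mphi; apply: mF => //.
  - by move=> y.
  congr amb; apply/funext => y; rewrite /F /G; congr (_ * f _).
  by apply/funext => i; rewrite addrC subrK.
rewrite muleC -ambZl//; last exact: amb_ge0.
congr amb; apply/funext => y; rewrite /G; under [in LHS]eq_fun do rewrite muleC.
rewrite ambZl//; last first.
  by move=> d Z phi mphi; apply: mQ => j; apply: measurable_funB => //; exact: mg.
rewrite muleC; congr (_ * _).
rewrite -(amb_shift (g' y)); last 2 first.
- by move=> d Z phi mphi; apply: mQ => j; apply: measurable_funB => //; exact: mg.
- by move=> x.
congr amb; apply/funext => x; congr (cube01 _)%:E; apply/funext => i.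
by rewrite gD gg' opprD addrCA subrr addr0.
Qed.
End FullIntegral.

(** * Volume of order intervals in a solid homogeneous cone *)

Section Cone.
Context {R : realType} {T : finType}.
Local Notation V := (T -> R).

Definition scl (c : R) (x : V) : V := fun i => c * x i.

(* [cone_hom]: linear automorphisms of the cone move [e] to any interior point. *)
Record cone_ax (C : V -> Prop) (e : V) : Prop := ConeAx {
  cone0 : C 0;
  coneD : forall x y, C x -> C y -> C (x + y);
  coneZ : forall a x, 0 <= a -> C x -> C (scl a x);
  cone_meas : cmeas (fun x => `[< C x >]);
  cone_unit : exists2 K, 0 < K & forall u : V, (forall j, `|u j| <= 1) -> C (scl K e + u);
  cone_bnd : forall r, exists B, forall x : V, C x -> C (r - x) -> forall j, `|x j| <= B;
  cone_hom : forall r (c : R), 0 < c -> C (r - scl c e) -> exists g g' : V -> V,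
    [/\ {morph g : x y / x + y}, cancel g' g, (forall j, cmeas (g^~ j)),
        (forall x, C (g x) <-> C x) & g e = r] }.

Variables (C : V -> Prop) (e : V).
Hypothesis CA : cone_ax C e.

Lemma scl_comp a b x : scl a (scl b x) = scl (a * b) x.
Proof. by apply/funext => i; rewrite /scl mulrA. Qed.

Lemma scl1 x : scl 1 x = x.
Proof. by apply/funext => i; rewrite /scl mul1r. Qed.

Lemma sclDl a b x : scl (a + b) x = scl a x + scl b x.
Proof. by apply/funext => i; rewrite /scl /= mulrDl. Qed.

Lemma sclDr a x y : scl a (x + y) = scl a x + scl a y.
Proof. by apply/funext => i; rewrite /scl /= mulrDr. Qed.

Lemma sclBl a b x : scl (a - b) x = scl a x - scl b x.
Proof. by apply/funext => i; rewrite /scl /= mulrBl. Qed.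

Lemma sclBr a x y : scl a (x - y) = scl a x - scl a y.
Proof. by apply/funext => i; rewrite /scl /= mulrBr. Qed.

Lemma coneZE a x : 0 < a -> C (scl a x) <-> C x.
Proof.
move=> a0; split=> [|Cx]; last by apply: (coneZ _ _ CA) => //; exact: ltW.
move=> /(coneZ _ _ CA a^-1); rewrite scl_comp mulVf ?gt_eqF// scl1; apply.
by rewrite invr_ge0 ltW.
Qed.

Lemma cone_e : C e.
Proof.
have [K K0 KP] := cone_unit _ _ CA.
rewrite -(coneZE K)// -[scl K e]addr0; apply: KP => j /=.
by rewrite normr0.
Qed.

Lemma cone_trans x y z : C (y - x) -> C (z - y) -> C (z - x).
Proof. by move=> xy yz; rewrite -(subrK y z) -addrA; exact: (coneD _ _ CA). Qed.

Lemma cone_measP d (Z : measurableType d) (phi : Z -> V) :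
  (forall j, measurable_fun setT (fun z => phi z j)) ->
  measurable_fun setT (fun z => `[< C (phi z) >]).
Proof. exact: (cone_meas _ _ CA). Qed.

Definition civ (r x : V) : R := (`[< C x >] && `[< C (r - x) >])%:R.

Lemma cmeas2_civ : cmeas2 civ.
Proof.
move=> d Z phi psi mphi mpsi; rewrite /civ.
apply: (@measurableT_comp _ _ _ _ _ _ (fun b : bool => b%:R : R)) => //.
apply: measurable_and; apply: cone_measP => // j.
exact: measurable_funB.
Qed.

Lemma cmeas_civ r : cmeas (civ r).
Proof. by move=> d Z phi mphi; apply: cmeas2_civ. Qed.

Definition cvole (r : V) : \bar R := amb (fun x => (civ r x)%:E).
Definition cvol (r : V) : R := fine (cvole r).

Lemma cvole_ge0 r : (0 <= cvole r)%E.
Proof. by apply: amb_ge0 => x; rewrite lee_fin. Qed.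

Lemma cvole_fin r : cvole r \is a fin_num.
Proof.
rewrite ge0_fin_numE ?cvole_ge0//.
have [B BP] := cone_bnd _ _ CA r.
(* The interval lies in a cube of half-side [b], brought to [cube01] by an affine map; the added 1
   makes the bound strict, as the missing upper faces require. *)
pose b := `|B| + 1.
have b0 : 0 < b by rewrite ltr_pwDr.
pose f : V -> \bar R := fun x => (cube01 (fun i => (2 * b)^-1 * (x i + b)))%:E.
have mf : cmeas f.
  move=> d Z phi mphi; apply/measurable_EFinP; apply: cmeas_cube01 => j.
  by apply: measurable_funM => //; apply: measurable_funD.
have f0 x : (0 <= f x)%E by rewrite lee_fin cube01_ge0.
have Q0 (x : V) : (0 <= (cube01 x)%:E :> \bar R)%E by rewrite lee_fin cube01_ge0.
have mQ : cmeas (fun x : V => (cube01 x)%:E : \bar R).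
  by move=> d Z phi mphi; apply/measurable_EFinP; exact: cmeas_cube01.
apply: (@le_lt_trans _ _ (amb f)).
  apply: le_amb => //; first by move=> d Z phi mphi; apply/measurable_EFinP; exact: cmeas_civ.
  by move=> x; rewrite lee_fin.
  move=> x; rewrite /f lee_fin /civ cube01E; case: asboolP => //= Cx; case: asboolP => //= Crx.
  rewrite ler_nat; set q := [forall i, _]; suff -> : q by [].
  apply/forallP => i; have := BP _ Cx Crx i; rewrite ler_norml => /andP[l u].
  have Bb : B < b by rewrite /b; have := ler_norm B; lra.
  rewrite mulrC divr_ge0 ?ltr_pdivrMr; [|lra..].
  by rewrite andTb; lra.
pose f1 (x : V) : \bar R := (cube01 (fun i => (2 * b)^-1 * x i))%:E.
have mf1 : cmeas f1.
  by move=> d Z phi mphi; apply: mQ => j; exact: measurable_funM.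
have f10 x : (0 <= f1 x)%E by exact: Q0.
rewrite -[amb f]/(amb (fun x => f1 (fun i => x i + b))) (amb_shift (fun=> b) f1)//.
rewrite (amb_scale (2 * b))//; last lra.
rewrite [X in amb X](_ : _ = (fun y : V => (cube01 y)%:E)); last first.
  by apply/funext => y; congr (cube01 _)%:E; apply/funext => i; rewrite mulrA mulVf ?mul1r//; lra.
by rewrite amb_cube01 mule1 ltry.
Qed.

Lemma cvoleE r : cvole r = (cvol r)%:E.
Proof. by rewrite fineK// cvole_fin. Qed.

Lemma cvol_ge0 r : 0 <= cvol r.
Proof. by rewrite fine_ge0// cvole_ge0. Qed.

Lemma cmeas_cvol : cmeas cvol.
Proof.
have mv : cmeas cvole.
  apply: cmeas_amb => [|x y]; last by rewrite lee_fin.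
  by move=> d Z phi psi mphi mpsi; apply/measurable_EFinP; exact: cmeas2_civ.
move=> d Z phi mphi; apply/measurable_EFinP.
by have := mv _ _ _ mphi; under eq_fun do rewrite cvoleE.
Qed.

Lemma le_cvol r r' : C (r' - r) -> cvol r <= cvol r'.
Proof.
move=> rr'; rewrite -lee_fin -!cvoleE; apply: le_amb.
- by move=> d Z phi mphi; apply/measurable_EFinP; exact: cmeas_civ.
- by move=> d Z phi mphi; apply/measurable_EFinP; exact: cmeas_civ.
- by move=> x; rewrite lee_fin.
move=> x; rewrite lee_fin ler_nat /civ; case: asboolP => //= Cx; case: asboolP => //= Crx.
by case: asboolP => // -[]; exact: cone_trans Crx rr'.
Qed.

Lemma cvol_scl c r : 0 < c -> cvol (scl c r) = c ^+ #|T| * cvol r.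
Proof.
move=> c0; apply: EFin_inj; rewrite EFinM -!cvoleE /cvole (amb_scale c)//; last 2 first.
- by move=> d Z phi mphi; apply/measurable_EFinP; exact: cmeas_civ.
- by move=> x; rewrite lee_fin.
congr (_ * amb _)%E; apply/funext => x; congr (_%:E); rewrite /civ -/(scl c x).
by congr (_ && _)%:R; apply: asbool_equiv_eq; rewrite -?sclBr coneZE.
Qed.
End Cone.

Section ConeVolume.
Context {R : realType} {T : finType}.
Local Notation V := (T -> R).
Variables (C : V -> Prop) (e : V).
Hypothesis CA : cone_ax C e.
Local Notation vol := (cvol C).

Definition lat_pt (z : {ffun T -> int}) : V := fun i => (z i)%:~R.

Lemma lat_ptN z : lat_pt (- z) = - lat_pt z.
Proof. by apply/funext => i; rewrite /lat_pt /= ffunE mulrNz. Qed.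

Definition lat_floor (x : V) : {ffun T -> int} := [ffun i => Num.floor (x i)].

Lemma lat_floorE x i : lat_floor x i = Num.floor (x i).
Proof. by rewrite ffunE. Qed.

Lemma lat_floorP (x : V) i : 0 <= x i - lat_pt (lat_floor x) i < 1.
Proof. by rewrite /lat_pt lat_floorE subr_ge0 ltrBlDr addrC -intrD1 floor_itv. Qed.

Lemma cube01_lat x z : cube01 (x - lat_pt z) = (z == lat_floor x)%:R :> R.
Proof.
rewrite cube01E; congr (nat_of_bool _)%:R; apply/forallP/eqP => [H|-> i].
  apply/ffunP => i; rewrite lat_floorE; apply/esym/floor_def.
  by have := H i; rewrite /= /lat_pt subr_ge0 ltrBlDr addrC -intrD1.
exact: lat_floorP.
Qed.

(** Each lattice point is spread over its unit cell, which has measure one; a sum can then be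
    compared with an integral pointwise. *)
Lemma sum_lat_amb (s : seq {ffun T -> int}) (F : {ffun T -> int} -> R) : uniq s ->
  (forall z, 0 <= F z) ->
  (\sum_(z <- s) F z)%:E =
  amb (fun x => (if lat_floor x \in s then F (lat_floor x) else 0)%:E).
Proof.
move=> us F0.
have mq z : cmeas (fun x : V => (cube01 (x - lat_pt z))%:E).
  move=> d Z phi mphi; apply/measurable_EFinP; apply: cmeas_cube01 => j.
  by apply: measurable_funB.
have q0 z (x : V) : (0 <= (cube01 (x - lat_pt z))%:E)%E by rewrite lee_fin cube01_ge0.
transitivity (amb (fun x => \sum_(z <- s) ((F z)%:E * (cube01 (x - lat_pt z))%:E)%E)).
  rewrite amb_sum; last 2 first.
  - move=> z d Z phi mphi; apply: emeasurable_funM => //; exact: mq.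
  - by move=> z y; rewrite mule_ge0// lee_fin.
  rewrite -sumEFin; apply: eq_bigr => z _; rewrite ambZl//; last by rewrite lee_fin.
  rewrite (amb_shift (- lat_pt z) (fun x => (cube01 x)%:E : \bar R)).
  - by rewrite amb_cube01 mule1.
  - by move=> d Z phi mphi; apply/measurable_EFinP; apply: cmeas_cube01.
  - by move=> y; rewrite lee_fin cube01_ge0.
congr amb; apply/funext => x.
under eq_bigr do rewrite -EFinM cube01_lat.
rewrite sumEFin; congr (_%:E); case: ifPn => [xs|xs].
  rewrite (bigD1_seq (lat_floor x))//= eqxx mulr1 big1 ?addr0// => z /negbTE ->.
  by rewrite mulr0.
rewrite big1_seq// => z /andP[_ zs]; case: eqVneq => [zx|]; last by rewrite mulr0.
by rewrite -zx zs in xs.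
Qed.

Lemma cmeas_lat_floor (s : seq {ffun T -> int}) (F : {ffun T -> int} -> R) :
  uniq s -> cmeas (fun x : V => (if lat_floor x \in s then F (lat_floor x) else 0)%:E).
Proof.
move=> us.
rewrite (_ : (fun _ => _) = fun x : V => (\sum_(z <- s) F z * cube01 (x - lat_pt z))%:E).
  move=> d Z phi mphi; apply/measurable_EFinP; apply: measurable_sum => z.
  apply: measurable_funM => //; apply: cmeas_cube01 => j.
  by apply: measurable_funB.
apply/funext => x; congr (_%:E); case: ifPn => [xs|xs].
  rewrite (bigD1_seq (lat_floor x))//= cube01_lat eqxx mulr1 big1 ?addr0// => z /negbTE zx.
  by rewrite cube01_lat zx mulr0.
rewrite big1_seq// => z /andP[_ zs]; rewrite cube01_lat.
case: eqVneq => [zx|]; last by rewrite mulr0.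
by rewrite -zx zs in xs.
Qed.

(** The interval $[0, 2 K e]$ contains the unit cube translated by $K e$, and homogeneity brings the
    estimate back to [e]. *)
Lemma cvol_e_gt0 : 0 < vol e.
Proof.
have [K K0 KP] := cone_unit _ _ CA.
suff : 0 < vol (scl (K + K) e).
  by rewrite (cvol_scl _ _ CA) ?addr_gt0// pmulr_rgt0// exprn_gt0// addr_gt0.
apply: (@lt_le_trans _ _ 1) => //; rewrite -lee_fin -(cvoleE _ _ CA) /cvole.
rewrite -(@amb_cube01 R T).
rewrite -(amb_shift (scl K e) (fun x => (civ C _ x)%:E)); last 2 first.
- by move=> d Z phi mphi; apply/measurable_EFinP; exact: (cmeas_civ _ _ CA).
- by move=> x; rewrite lee_fin.
apply: le_amb.
- by move=> d Z phi mphi; apply/measurable_EFinP; exact: cmeas_cube01.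
- move=> d Z phi mphi; apply/measurable_EFinP; apply: (cmeas_civ _ _ CA) => j.
  exact: measurable_funD.
- by move=> x; rewrite lee_fin cube01_ge0.
move=> x; rewrite lee_fin cube01E /civ ler_nat; case: forallP => //= xP.
have u j : `|x j| <= 1.
  by have /andP[x0 /ltW x1] := xP j; rewrite ger0_norm.
rewrite asboolT/=; last by have := KP x u; rewrite addrC.
rewrite asboolT//; have -> : scl (K + K) e - (fun i => x i + scl K e i) = scl K e + (- x).
  rewrite sclDl; apply/funext => i; rewrite !fctE; ring.
by apply: KP => j; rewrite /= normrN.
Qed.

Lemma cvol_gt0 r (c : R) : 0 < c -> C (r - scl c e) -> 0 < vol r.
Proof.
move=> c0 /(le_cvol _ _ CA); apply: lt_le_trans.
by rewrite (cvol_scl _ _ CA)// mulr_gt0 ?exprn_gt0// cvol_e_gt0.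
Qed.

Definition powint (b : nat) (r : V) : \bar R :=
  amb (fun x => (civ C r x * vol x ^+ b)%:E).

(** Indexed by the exponent in the integrand: [gam b] is $\gamma_{b+1}$. *)
Definition gam (b : nat) : R := vol e ^- b.+1 * fine (powint b e).

Lemma cmeas_powint b r : cmeas (fun x => (civ C r x * vol x ^+ b)%:E).
Proof.
move=> d Z phi mphi; apply/measurable_EFinP; apply: measurable_funM.
  exact: (cmeas_civ _ _ CA).
by apply: measurable_funX; exact: (cmeas_cvol _ _ CA).
Qed.

Lemma powint_ge0 b r x : (0 <= (civ C r x * vol x ^+ b)%:E)%E.
Proof. by rewrite lee_fin mulr_ge0 ?exprn_ge0 ?cvol_ge0. Qed.

Lemma powint_fin b r : powint b r \is a fin_num.
Proof.
rewrite ge0_fin_numE; last by apply: amb_ge0 => x; exact: powint_ge0.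
apply: (@le_lt_trans _ _ ((vol r ^+ b)%:E * cvole C r)%E); last first.
  by rewrite (cvoleE _ _ CA) -EFinM ltry.
rewrite -ambZl.
- apply: le_amb => [||x|x].
  + exact: cmeas_powint.
  + move=> d Z phi mphi; apply: emeasurable_funM => //.
    by apply/measurable_EFinP; exact: (cmeas_civ _ _ CA).
  + exact: powint_ge0.
  rewrite lee_fin mulrC /civ; case: asboolP => [Cx|_] /=; last by rewrite !mulr0.
  case: asboolP => [Crx|_] /=; last by rewrite !mulr0.
  by rewrite ler_pM2r// lerXn2r ?nnegrE ?cvol_ge0//; exact: (le_cvol _ _ CA).
- by rewrite lee_fin exprn_ge0// cvol_ge0.
- by move=> d Z phi mphi; apply/measurable_EFinP; exact: (cmeas_civ _ _ CA).
- by move=> x; rewrite lee_fin.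
Qed.

Lemma gam_ge0 b : 0 <= gam b.
Proof.
rewrite mulr_ge0// ?invr_ge0 ?exprn_ge0 ?cvol_ge0//.
by apply/fine_ge0/amb_ge0 => x; exact: powint_ge0.
Qed.

Lemma gam0 : gam 0 = 1.
Proof.
rewrite /gam /powint; under eq_fun do rewrite expr0 mulr1.
by rewrite expr1 -/(vol e) mulVf// gt_eqF// cvol_e_gt0.
Qed.

(** The hypothesis on [r] says that it is interior. An automorphism [g] with [g e = r] maps order
    intervals onto order intervals, so one constant [J] rescales both the measure and the function
    [vol]; comparing the volumes of [e] and [r] determines [J]. *)
Lemma powintE b r (c : R) : 0 < c -> C (r - scl c e) ->
  powint b r = (gam b * vol r ^+ b.+1)%:E.
Proof.
move=> c0 cr; have r0 := cvol_gt0 _ _ c0 cr; have ev0 := cvol_e_gt0.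
have [g [g' [gD gg' mg gC ge]]] := cone_hom _ _ CA _ _ c0 cr.
have gB x y : g (x - y) = g x - g y.
  by apply: (addIr (g y)); rewrite subrK -gD subrK.
have civg s x : civ C (g s) (g x) = civ C s x.
  by rewrite /civ; congr (_ && _)%:R; apply: asbool_equiv_eq; rewrite -?gB gC.
pose J := amb (fun x => (cube01 (fun i => - g x i))%:E).
have volg s : cvole C s = (cvole C (g s) * J)%E.
  rewrite /cvole /J -(amb_additive_comp g g' (fun x => (civ C (g s) x)%:E))//.
  - by congr amb; apply/funext => x; rewrite civg.
  - by move=> d Z phi mphi; apply/measurable_EFinP; exact: (cmeas_civ _ _ CA).
  - by move=> x; rewrite lee_fin.
have JE : J = (vol e / vol r)%:E.
  have := volg e; rewrite ge !(cvoleE _ _ CA).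
  (* [J] could a priori be infinite: its sign excludes one infinity, and the other would make the
     volume of [e] infinite. *)
  have : (0 <= J)%E by apply: amb_ge0 => x; rewrite lee_fin cube01_ge0.
  case: (J) => [j||] _ //.
  - by rewrite -EFinM => -[->]; rewrite mulrAC divff ?mul1r// gt_eqF.
  - by rewrite mulry gtr0_sg// mul1e.
have volg' s : vol s = vol (g s) * (vol e / vol r).
  by apply: EFin_inj; rewrite EFinM -JE -!(cvoleE _ _ CA).
have : powint b e = (((vol e / vol r) ^+ b)%:E * (powint b r * J))%E.
  rewrite /powint /J -(amb_additive_comp g g' (fun x => (civ C r x * vol x ^+ b)%:E))//.
  - rewrite -ambZl.
    + congr amb; apply/funext => x; rewrite -EFinM -(civg e) ge; congr (_%:E).
      by rewrite (volg' x) exprMn; ring.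
    + by rewrite lee_fin exprn_ge0// divr_ge0 ?cvol_ge0.
    + by move=> d Z phi mphi; apply: cmeas_powint => j; exact: mg.
    + by move=> y; exact: powint_ge0.
  - exact: cmeas_powint.
  - by move=> y; exact: powint_ge0.
rewrite JE /gam -[in powint b r](fineK (powint_fin b r)) -!EFinM => -> /=.
rewrite -(fineK (powint_fin b r)); congr (_%:E).
rewrite !exprMn exprVn !exprS; field.
by rewrite !gt_eqF// ?exprn_gt0.
Qed.

(** * Lattice sums of powers of the volume against their integrals *)

Section RiemannSums.
Variable K : R.
Hypotheses (K0 : 0 < K) (KP : forall u : V, (forall j, `|u j| <= 1) -> C (scl K e + u)).

(* The lattice point [y] is compared with the unit cell of those [x] for which
   [lat_floor x = - y], so that [r + a + scl K e + x] dominates [r - y + a]. *)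
Lemma riemann_upper b (s : seq {ffun T -> int}) (r q a : V) : C a -> uniq s ->
  (forall y, y \in s -> C (lat_pt y - q) /\ C (r - lat_pt y)) ->
  \sum_(y <- s) vol (r - lat_pt y + a) ^+ b <=
  gam b * vol (r - q + a + scl (K + K) e) ^+ b.+1.
Proof.
move=> Ca us sP; set S := r - q + a + _.
(* A point of [s] lies between [q] and [r], which makes [S] interior as [powintE] demands; the empty
   sum is bounded directly. *)
case: s us sP => [|y0 s0] us sP.
  by rewrite big_nil mulr_ge0 ?gam_ge0// exprn_ge0// cvol_ge0.
set s := _ :: _ in us sP *.
have CS : C (S - scl (K + K) e).
  rewrite /S addrK; apply: (coneD _ _ CA) => //.
  have [h1 h2] := sP y0 (mem_head _ _); exact: (cone_trans _ _ CA) h1 h2.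
rewrite -lee_fin -(powintE b S _ _ CS) ?addr_gt0//.
pose be := r + a + scl K e.
pose F (z : {ffun T -> int}) := vol (r + lat_pt z + a) ^+ b.
have -> : \sum_(y <- s) vol (r - lat_pt y + a) ^+ b = \sum_(z <- map -%R s) F z.
  by rewrite big_map; apply: eq_bigr => y _; rewrite /F lat_ptN.
have us' : uniq (map -%R s) by rewrite map_inj_uniq//; exact: oppr_inj.
rewrite sum_lat_amb//; last by move=> z; rewrite exprn_ge0// cvol_ge0.
rewrite /powint -(amb_shift be (fun x => (civ C S x * vol x ^+ b)%:E)); last 2 first.
- exact: cmeas_powint.
- by move=> y; exact: powint_ge0.
apply: le_amb.
- exact: cmeas_lat_floor.
- by move=> d Z phi mphi; apply: cmeas_powint => j; exact: measurable_funD.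
- by move=> x; rewrite lee_fin; case: ifP => // _; rewrite exprn_ge0// cvol_ge0.
move=> x; case: ifPn => [|_]; last exact: powint_ge0.
move=> /mapP[y ys fx]; have [h1 h2] := sP y ys; rewrite fx lee_fin.
pose u := x - lat_pt (lat_floor x).
have u1 j : `|u j| <= 1.
  by have /andP[l /ltW ?] := lat_floorP x j; rewrite /u ger0_norm.
have xE : (fun i => x i + be i) = (r + lat_pt (- y) + a) + (scl K e + u).
  by rewrite /u /be fx; apply/funext => i; rewrite !fctE; ring.
have Cy : C (r + lat_pt (- y) + a).
  by rewrite lat_ptN; apply: (coneD _ _ CA).
(* One multiple [scl K e] absorbs the fractional part [u] from below and the other from above; hence
   [K + K] in the bound. *)
rewrite /civ xE asboolT ?asboolT/=; last 2 first.
- have -> : S - (r + lat_pt (- y) + a + (scl K e + u)) = (lat_pt y - q) + (scl K e + (- u)).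
    by rewrite /S lat_ptN sclDl; apply/funext => i; rewrite !fctE; ring.
  by apply: (coneD _ _ CA) => //; apply: KP => j; rewrite /= normrN.
- by apply: (coneD _ _ CA) => //; exact: KP.
rewrite mul1r /F lerXn2r ?nnegrE ?cvol_ge0//.
by apply: (le_cvol _ _ CA); rewrite addrC addKr; exact: KP.
Qed.

(** Of the four multiples of [K], two absorb the fractional part of a point of the cell, one on
    either side; one leaves the gap [scl K e] between [q] and [y], from which strict inequality of
    labels is drawn later; and one keeps [S] interior for [powintE]. The filter retains the [y] to
    which an inductive lower bound with shift [a] applies. *)
Lemma riemann_lower b (s : seq {ffun T -> int}) (r q a : V) : uniq s ->
  (forall y, C (lat_pt y - q - scl K e) -> C (r - a - lat_pt y) -> y \in s) ->
  C (r - q - a - scl (4 * K) e) ->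
  gam b * vol (r - q - a - scl (4 * K) e) ^+ b.+1 <=
  \sum_(y <- s | `[< C (r - a - lat_pt y) >]) vol (r - lat_pt y - a) ^+ b.
Proof.
move=> us sP Crq; pose S := r - q - a - scl (3 * K) e.
have K4 : scl (4 * K) e = scl (3 * K) e + scl K e by rewrite -sclDl; congr scl; ring.
have SE : S - scl K e = r - q - a - scl (4 * K) e by rewrite K4 opprD addrA.
have CS : C (S - scl K e) by rewrite SE.
apply: (@le_trans _ _ (gam b * vol S ^+ b.+1)).
  rewrite ler_wpM2l ?gam_ge0// lerXn2r ?nnegrE ?cvol_ge0// (le_cvol _ _ CA)//.
  by rewrite -SE opprB addrC subrK; apply: (coneZ _ _ CA); [exact: ltW|exact: cone_e].
rewrite -lee_fin -(powintE b S _ K0 CS).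
pose be := r - a - scl K e.
pose F (z : {ffun T -> int}) := vol (r + lat_pt z - a) ^+ b.
rewrite -big_filter; set s1 := [seq _ <- _ | _].
have -> : \sum_(y <- s1) vol (r - lat_pt y - a) ^+ b = \sum_(z <- map -%R s1) F z.
  by rewrite big_map; apply: eq_bigr => y _; rewrite /F lat_ptN.
have us' : uniq (map -%R s1) by rewrite map_inj_uniq ?filter_uniq//; exact: oppr_inj.
rewrite sum_lat_amb//; last by move=> z; rewrite exprn_ge0// cvol_ge0.
rewrite /powint -(amb_shift be (fun x => (civ C S x * vol x ^+ b)%:E)); last 2 first.
- exact: cmeas_powint.
- by move=> y; exact: powint_ge0.
apply: le_amb.
- by move=> d Z phi mphi; apply: cmeas_powint => j; exact: measurable_funD.
- exact: cmeas_lat_floor.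
- by move=> x; exact: powint_ge0.
move=> x; rewrite lee_fin; set X := (fun i => _).
have F0 z : 0 <= F z by rewrite exprn_ge0// cvol_ge0.
rewrite /civ; case: asboolP => [CX|_] /=; last by rewrite mul0r; case: ifP.
case: asboolP => [CSX|_] /=; last by rewrite mul0r; case: ifP.
pose u := x - lat_pt (lat_floor x).
have u1 j : `|u j| <= 1.
  by have /andP[l /ltW ?] := lat_floorP x j; rewrite /u ger0_norm.
pose y := - lat_floor x.
have h1 : r - a - lat_pt y = X + (scl K e + (- u)).
  by rewrite /X /y lat_ptN /u /be; apply/funext => i; rewrite !fctE; ring.
have CKu : C (scl K e + (- u)) by apply: KP => j; rewrite /= normrN.
have Ch1 : C (r - a - lat_pt y) by rewrite h1; exact: (coneD _ _ CA).
rewrite mul1r ifT; last first.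
  apply/mapP; exists y; last by rewrite opprK.
  rewrite mem_filter asboolT//=; apply: sP => //.
  have -> : lat_pt y - q - scl K e = (S - X) + (scl K e + u).
    have -> : scl K e = scl (3 * K) e - scl K e - scl K e.
      by rewrite -!sclBl; congr scl; ring.
    rewrite /S /X /u /be /y lat_ptN; apply/funext => i; rewrite !fctE /scl; ring.
  by apply: (coneD _ _ CA) => //; exact: KP.
rewrite /F lerXn2r ?nnegrE ?cvol_ge0// (le_cvol _ _ CA)//.
have -> : r + lat_pt (lat_floor x) - a = r - a - lat_pt y.
  by rewrite /y lat_ptN opprK; apply/funext => i; rewrite !fctE; ring.
by rewrite h1 addrC addKr.
Qed.
End RiemannSums.
End ConeVolume.

(** * The three cones *)

Section Common.
Context {R : realType}.

Lemma asbool_measurable_countable {d} {Z : measurableType d} (I : countType)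
    (P : I -> Z -> bool) :
  (forall i, measurable_fun setT (P i)) ->
  measurable_fun setT (fun z => `[< forall i, P i z >]).
Proof.
move=> mP; apply: (measurable_fun_bool true); rewrite setTI.
rewrite (_ : _ @^-1` _ = \bigcap_n (fun z => if choice.unpickle n is Some i then P i z else true) @^-1` [set true]).
  apply: bigcapT_measurable => n; rewrite -[X in measurable X]setTI.
  case: (choice.unpickle n) => [i|]; last exact: measurable_cst.
  exact: mP.
apply/seteqP; split=> z /=.
  by move=> /asboolP Pz n _ /=; case: choice.unpickle => //.
move=> Pz; apply/asboolP => i; have := Pz (choice.pickle i) Logic.I.
by rewrite /= choice.pickleK.
Qed.

(** Lagrange's identity: twice the defect is a sum of squares. *)
Lemma cauchy_schwarz n (x y : 'I_n -> R) :
  (\sum_i x i * y i) ^+ 2 <= (\sum_i x i ^+ 2) * (\sum_i y i ^+ 2).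
Proof.
have : 0 <= \sum_i \sum_j (x i * y j - x j * y i) ^+ 2.
  by apply: sumr_ge0 => i _; apply: sumr_ge0 => j _; rewrite sqr_ge0.
have -> : \sum_i \sum_j (x i * y j - x j * y i) ^+ 2 =
    2 * ((\sum_i x i ^+ 2) * (\sum_i y i ^+ 2) - (\sum_i x i * y i) ^+ 2).
  transitivity (\sum_i \sum_j (x i ^+ 2 * y j ^+ 2 + y i ^+ 2 * x j ^+ 2 +
      (- 2 * (x i * y i)) * (x j * y j))).
    by apply: eq_bigr => i _; apply: eq_bigr => j _; ring.
  under eq_bigr do rewrite !big_split/= -!mulr_sumr.
  rewrite !big_split/= -!mulr_suml -mulr_sumr; ring.
by rewrite pmulr_rge0// subr_ge0.
Qed.
End Common.

Section Orthant.
Context {R : realType} (d : nat).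
Local Notation C := (@in_cone R Orthant d).

Lemma orthant_cone_ax : cone_ax C (xi0 R Orthant d).
Proof.
split.
- by [].
- by move=> x y Cx Cy j; apply: addr_ge0; [exact: Cx|exact: Cy].
- by move=> a x a0 Cx j; apply: mulr_ge0 => //; exact: Cx.
- move=> dZ Z phi mphi.
  rewrite (_ : (fun z => _) = fun z => `[< forall j : 'I_d, 0 <= phi z j >])//.
  by apply: asbool_measurable_countable => j; exact: measurable_fun_ler.
- exists 1 => // u u1 j; have := u1 j; rewrite ler_norml => /andP[l _].
  by rewrite !fctE /scl /= /zero_pt; lra.
- move=> r; exists (\sum_i `|r i|) => x Cx Crx j.
  have := Crx j; have := Cx j; rewrite !fctE /zero_pt subr_ge0 => x0 xr.
  rewrite ger0_norm// (le_trans xr)// (le_trans (ler_norm _))//.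
  by rewrite (bigD1 j)//= lerDl sumr_ge0.
- move=> r c c0 Cr.
  have r0 j : 0 < r j by have := Cr j; rewrite !fctE /scl /zero_pt /=; lra.
  exists (fun x j => r j * x j), (fun x j => (r j)^-1 * x j); split.
  + by move=> x y; apply/funext => j; rewrite !fctE mulrDr.
  + by move=> x; apply/funext => j; rewrite mulrA divff ?mul1r// gt_eqF.
  + by move=> j dZ Z phi mphi; exact: measurable_funM.
  + move=> x; split=> Cx j; have := Cx j; rewrite /zero_pt pmulr_rge0//.
  + by apply/funext => j; rewrite /= mulr1.
Qed.
End Orthant.

Section Lorentz.
Context {R : realType} (d : nat).
Local Notation C := (@in_cone R Lorentz d).
Local Notation V := (option 'I_d -> R).
Implicit Types x y r w : V.

Lemma in_lorentzE x : C x <-> 0 <= x None /\ \sum_i x (Some i) ^+ 2 <= x None ^+ 2.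
Proof.
rewrite /in_cone /= /zero_pt; under eq_bigr do rewrite subr0; rewrite subr0.
have s0 : 0 <= \sum_i x (Some i) ^+ 2 by apply: sumr_ge0 => i _; rewrite sqr_ge0.
split=> [H|[x0 H]].
  have x0 : 0 <= x None by apply: le_trans H; rewrite sqrtr_ge0.
  by split=> //; rewrite -(sqr_sqrtr s0) lerXn2r// nnegrE sqrtr_ge0.
by rewrite -(ger0_norm x0) -sqrtr_sqr ler_wsqrtr.
Qed.

Definition mink x y : R := x None * y None - \sum_i x (Some i) * y (Some i).

Lemma minkC x y : mink x y = mink y x.
Proof. by rewrite /mink mulrC; congr (_ - _); apply: eq_bigr => i _; rewrite mulrC. Qed.

Lemma minkDl x y w : mink (x + y) w = mink x w + mink y w.
Proof.
rewrite /mink !fctE mulrDl; under eq_bigr do rewrite mulrDl.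
by rewrite big_split /=; ring.
Qed.

Lemma minkZl a x w : mink (scl a x) w = a * mink x w.
Proof.
rewrite /mink /scl -mulrA; under eq_bigr do rewrite -mulrA.
by rewrite -mulr_sumr; ring.
Qed.

Lemma minkxx x : mink x x = x None ^+ 2 - \sum_i x (Some i) ^+ 2.
Proof. by rewrite /mink -expr2; congr (_ - _); apply: eq_bigr => i _; rewrite -expr2. Qed.

Lemma mink_lorentz x : C x <-> 0 <= x None /\ 0 <= mink x x.
Proof. by rewrite in_lorentzE minkxx subr_ge0. Qed.

Lemma mink_ge0 x y : C x -> C y -> 0 <= mink x y.
Proof.
rewrite !in_lorentzE => -[x0 xx] [y0 yy]; rewrite subr_ge0.
apply: le_trans (ler_norm _) _; rewrite -(ger0_norm (mulr_ge0 x0 y0)) -!sqrtr_sqr.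
apply: ler_wsqrtr; apply: le_trans (cauchy_schwarz _ _ _) _.
by rewrite exprMn ler_pM//; apply: sumr_ge0 => i _; rewrite sqr_ge0.
Qed.

(* For [w = n e - r] with [mink r r = n ^+ 2] this reflection exchanges [n e] and [r]. *)
Definition mink_refl w x : V := x + scl (- (2 * mink x w / mink w w)) w.

Lemma mink_reflD w x y : mink_refl w (x + y) = mink_refl w x + mink_refl w y.
Proof.
rewrite /mink_refl minkDl; apply/funext => i; rewrite !fctE /scl; ring.
Qed.

Lemma mink_reflK w : mink w w != 0 -> involutive (mink_refl w).
Proof.
move=> w0 x; rewrite {1}/mink_refl minkDl minkZl; apply/funext => i.
rewrite /mink_refl !fctE /scl; field.
by [].
Qed.

Lemma mink_refl_form w x : mink w w != 0 -> mink (mink_refl w x) (mink_refl w x) = mink x x.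
Proof.
move=> w0; rewrite /mink_refl minkDl minkZl (minkC x (x + _)) (minkC w (x + _)).
by rewrite !minkDl !minkZl (minkC w x); field.
Qed.

Lemma cmeas_mink w : cmeas (mink^~ w).
Proof.
move=> dZ Z phi mphi; apply: measurable_funB; first exact: measurable_funM.
by apply: measurable_sum => i; exact: measurable_funM.
Qed.

Lemma lorentz_cone_ax : cone_ax C (xi0 R Lorentz d).
Proof.
split.
- by rewrite in_lorentzE; split=> //; rewrite big1 ?sqr_ge0// => i _; exact: expr0n.
- move=> x y Cx Cy; have xy := mink_ge0 _ _ Cx Cy; move: Cx Cy; rewrite !mink_lorentz.
  move=> [x0 xx] [y0 yy]; rewrite !fctE addr_ge0//; split=> //.
  rewrite minkDl (minkC x (x + y)) (minkC y (x + y)) !minkDl (minkC y x); lra.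
- move=> a x a0; rewrite !mink_lorentz => -[x0 xx]; split; first exact: mulr_ge0.
  by rewrite minkZl minkC minkZl !mulr_ge0.
- move=> dZ Z phi mphi.
  rewrite (_ : (fun z => _) = fun z => (0 <= phi z None) && (0 <= mink (phi z) (phi z))).
    apply: measurable_and; first exact: measurable_fun_ler.
    apply: measurable_fun_ler => //; apply: measurable_funB; first exact: measurable_funM.
    by apply: measurable_sum => i; exact: measurable_funM.
  apply/funext => z; apply/asboolP/andP; rewrite mink_lorentz => -[]//.
(* After adding [u], the time coordinate is at least $d + 1$ and the space part has squared norm at
   most $d \le (d + 1)^2$. *)
- exists d.+2%:R => // u u1; rewrite in_lorentzE !fctE /scl /= mulr1.
  have u0 : -1 <= u None by have := u1 None; rewrite ler_norml => /andP[].
  have dE : d.+2%:R = d%:R + 2 :> R by rewrite -addn2 natrD.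
  have d0 : 0 <= d%:R :> R by [].
  split; first by rewrite dE; lra.
  apply: (@le_trans _ _ (d%:R)); last by rewrite dE; nra.
  apply: (@le_trans _ _ (\sum_(i < d) 1)); last by rewrite sumr_const card_ord.
  apply: ler_sum => i _; rewrite mulr0 add0r -real_normK ?num_real//.
  by rewrite expr_le1.
- move=> r; exists (r None) => x; rewrite !in_lorentzE !fctE => -[x0 xx] [].
  rewrite subr_ge0 => xr _ [j|]; last by rewrite ger0_norm.
  apply: le_trans xr; rewrite -(ger0_norm x0) -!sqrtr_sqr; apply: ler_wsqrtr.
  apply: le_trans xx; rewrite (bigD1 j)//= lerDl.
  by apply: sumr_ge0 => i _; rewrite sqr_ge0.
- move=> r c c0; rewrite in_lorentzE !fctE /scl /= mulr1 subr_ge0 => -[cr].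
  under eq_bigr do rewrite mulr0 subr0.
  move=> rr; have r0 : 0 < r None by lra.
  pose N := mink r r; have N0 : 0 < N.
    rewrite /N minkxx subr_gt0.
    apply: le_lt_trans rr _; nra.
  have Cr : C r by rewrite mink_lorentz; split; exact: ltW.
  pose n := Num.sqrt N; have n0 : 0 < n by rewrite sqrtr_gt0.
  have nN : n ^+ 2 = N by rewrite sqr_sqrtr// ltW.
  pose E : V := xi0 R Lorentz d.
  have minkE x : mink x E = x None.
    by rewrite /mink /E /= mulr1 big1 ?subr0// => i _; rewrite mulr0.
  pose w := scl n E - r.
  have wE : w = scl n E + scl (-1) r by apply/funext => i; rewrite /w !fctE /scl; ring.
  have xw x : mink x w = n * x None - mink x r.
    by rewrite minkC wE minkDl !minkZl minkC minkE minkC; ring.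
  have ww : mink w w = 2 * n * (n - r None).
    rewrite xw minkC xw -/N /w !fctE /scl /E /=; move: nN; rewrite expr2 => <-; ring.
  have Cn x : C (scl n x) <-> C x.
    rewrite !mink_lorentz minkZl minkC minkZl /scl pmulr_rge0//.
    by rewrite mulrA pmulr_rge0// mulr_gt0.
  (* Equality occurs when [r] is the multiple [scl n E]; then [w] is zero, no reflection is defined
     by it, and the dilation alone carries [e] to [r]. *)
  have [nr|nr] := eqVneq n (r None).
    have s0 : \sum_i r (Some i) ^+ 2 = 0.
      by move: nN; rewrite nr /N minkxx; lra.
    have rE : r = scl n E.
      apply/funext => -[i|]; rewrite /scl /= ?mulr1// ?mulr0.
      apply/eqP; rewrite -sqrf_eq0; move/eqP: s0; rewrite psumr_eq0; last first.
        by move=> j _; rewrite sqr_ge0.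
      by move=> /allP/(_ i (mem_index_enum _)).
    exists (scl n), (scl n^-1); split.
    + by move=> x y; exact: sclDr.
    + by move=> x; rewrite scl_comp divff ?gt_eqF// scl1.
    + by move=> j dZ Z phi mphi; exact: measurable_funM.
    + exact: Cn.
    + exact/esym.
  have w0 : mink w w != 0.
    by rewrite ww !mulf_neq0// ?subr_eq0// ?gt_eqF.
  (* The reflection preserves the form. That it also keeps time nonnegative on the cone is read off
     the new time coordinate [mink y r / n]. *)
  have Crefl y : C y -> C (mink_refl w y).
    move=> Cy; have yr := mink_ge0 _ _ Cy Cr; move: Cy; rewrite !mink_lorentz => -[y0 yy].
    split; last by rewrite mink_refl_form.
    suff -> : mink_refl w y None = mink y r / n by rewrite divr_ge0// ltW.
    rewrite /mink_refl !fctE /scl ww xw /w !fctE /scl /E /=; field.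
    by rewrite subr_eq0 nr gt_eqF.
  exists (fun x => mink_refl w (scl n x)), (fun y => scl n^-1 (mink_refl w y)); split.
  + by move=> x y; rewrite sclDr mink_reflD.
  + by move=> x; rewrite scl_comp divff ?gt_eqF// scl1 mink_reflK.
  + move=> j dZ Z phi mphi; apply: measurable_funD; first exact: measurable_funM.
    apply: measurable_funM => //; apply: measurableT_comp => //.
    apply: measurable_funM => //; apply: measurable_funM => //.
    by apply: cmeas_mink => i; exact: measurable_funM.
  + move=> x; split=> [/Crefl|Cx]; first by rewrite mink_reflK// Cn.
    by apply: Crefl; rewrite Cn.
  + rewrite /mink_refl minkZl (minkC _ w) minkE ww; apply/funext => i.
    have nr' : n - r None != 0 by rewrite subr_eq0.
    by rewrite /w !fctE /scl /E /=; case: i => [i|]; field; rewrite nr' gt_eqF.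
Qed.
End Lorentz.

Section Cholesky.
Context {R : rcfType}.

(** Block elimination: the Schur complement [D'] of the corner entry is again positive definite, and
    its factor completes a block triangular [A]. *)
Lemma cholesky n (M : 'M[R]_n) : M^T = M ->
  (forall v : 'cV_n, v != 0 -> 0 < (v^T *m M *m v) 0 0) ->
  exists2 A : 'M[R]_n, A \in unitmx & M = A *m A^T.
Proof.
elim: n M => [|n IH] M Msym Mpos.
  by exists 1%:M; [exact: unitmx1|apply/matrixP => -[]].
move: M Msym Mpos; rewrite -[n.+1]/(1 + n)%N => M Msym Mpos.
pose a := M 0 0; pose b := dlsubmx M; pose D := drsubmx M.
have MB : M = block_mx a%:M b^T b D.
  rewrite -[LHS]submxK; congr block_mx.
    by rewrite [LHS]mx11_scalar !mxE lshift0.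
  by rewrite /b trmx_dlsub Msym.
have a0 : 0 < a.
  have := Mpos (col_mx 1%:M 0); rewrite MB tr_col_mx mul_row_block mul_row_col.
  rewrite !(mulmx0, trmx0, mul0mx, addr0, mulmx1, trmx1, mul1mx) mxE eqxx mulr1n; apply.
  by apply/eqP => /matrixP/(_ 0 0)/eqP; rewrite !mxE; case: splitP => // i _; rewrite !mxE ord1 oner_eq0.
pose D' := D - a^-1 *: (b *m b^T).
have Dsym : D^T = D by rewrite /D trmx_drsub Msym.
have D'sym : D'^T = D' by rewrite /D' linearB /= linearZ /= trmx_mul trmxK Dsym.
have [v v0|A' A'u D'E] := IH D' D'sym.
  (* This [c] minimises the form of [M] over the first coordinate; the minimum is the form of [D']
     at [v]. *)
  pose x := (v^T *m b) 0 0; pose c := - a^-1 * x.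
  have vb : v^T *m b = x%:M by rewrite [LHS]mx11_scalar.
  have bv : b^T *m v = x%:M by rewrite -[b^T *m v]trmxK trmx_mul trmxK vb tr_scalar_mx.
  have := Mpos (col_mx c%:M v).
  have -> : col_mx c%:M v != 0 by apply: contra v0; rewrite col_mx_eq0 => /andP[].
  move=> /(_ isT); rewrite MB tr_col_mx mul_row_block mul_row_col tr_scalar_mx vb.
  rewrite !mulmxDl -(mulmxA _ b^T v) bv -!scalar_mxM.
  rewrite /D' mulmxBr mulmxBl -scalemxAr -scalemxAl mulmxA vb -(mulmxA _ b^T v) bv -scalar_mxM.
  rewrite !mxE eqxx !mulr1n; set Y := \sum_i _; congr (_ < _); rewrite /c; field.
  by rewrite gt_eqF.
pose s := Num.sqrt a; have s0 : 0 < s by rewrite sqrtr_gt0.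
have sa : s * s = a by rewrite -expr2 sqr_sqrtr// ltW.
exists (block_mx s%:M 0 (s^-1 *: b) A').
  by rewrite unitmxE det_lblock det_scalar1 unitrM unitfE gt_eqF//= -unitmxE.
rewrite MB tr_block_mx mulmx_block !trmx0 !(mulmx0, mul0mx, addr0, tr_scalar_mx).
congr block_mx.
- by rewrite -scalar_mxM sa.
- by rewrite linearZ /= mul_scalar_mx scalerA divff ?gt_eqF// scale1r.
- by rewrite mul_mx_scalar scalerA divff ?gt_eqF// scale1r.
- rewrite -D'E linearZ /= -scalemxAl -scalemxAr scalerA -invfM sa /D'.
  by rewrite addrC subrK.
Qed.
End Cholesky.

Section PSDCone.
Context {R : realType} (d : nat).
Local Notation C := (@in_cone R PSD d).
Local Notation V := (Defs.coord PSD d -> R).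
Implicit Types x y r w : V.
Implicit Types v : 'I_d -> R.

Lemma sidxC (i j : 'I_d) : sidx i j = sidx j i.
Proof. by apply: val_inj; rewrite /=; case: ltngtP => // /val_inj ->. Qed.

Lemma sidxK (q : Defs.coord PSD d) : sidx (val q).1 (val q).2 = q.
Proof. by apply: val_inj; rewrite /= (valP q) -surjective_pairing. Qed.

Definition qform x v : R := \sum_(i < d) \sum_(j < d) v i * x (sidx i j) * v j.

Lemma in_psdE x : C x <-> forall v, 0 <= qform x v.
Proof.
rewrite /in_cone /=; split=> H v; have := H v; congr (_ <= _).
  by apply: eq_bigr => i _; apply: eq_bigr => j _; rewrite subr0.
by apply: eq_bigr => i _; apply: eq_bigr => j _; rewrite subr0.
Qed.

Lemma qformD x y v : qform (x + y) v = qform x v + qform y v.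
Proof.
rewrite /qform -big_split; apply: eq_bigr => i _ /=; rewrite -big_split.
by apply: eq_bigr => j _ /=; rewrite fctE; ring.
Qed.

Lemma qformZ a x v : qform (scl a x) v = a * qform x v.
Proof.
rewrite /qform mulr_sumr; apply: eq_bigr => i _; rewrite mulr_sumr.
by apply: eq_bigr => j _; rewrite /scl; ring.
Qed.

Lemma qformN x v : qform (- x) v = - qform x v.
Proof. by rewrite -[RHS]mulN1r -qformZ; congr qform; apply/funext => q; rewrite fctE /scl mulN1r. Qed.

(* Membership becomes a countable conjunction, hence measurable. *)
Lemma in_psd_int x : C x <-> forall z : {ffun 'I_d -> int}, 0 <= qform x (fun i => (z i)%:~R).
Proof.
rewrite in_psdE; split=> [H z|H v]; first exact: H.
rewrite leNgt; apply/negP => q0.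
(* Rounding [n * v] down to integers changes the form by at most [n * m1 + m2], linear in [n], while
   the negative value at [v] is multiplied by the square of [n]. *)
pose m1 := \sum_(i < d) \sum_(j < d) `|x (sidx i j)| * (`|v i| + `|v j|).
pose m2 := \sum_(i < d) \sum_(j < d) `|x (sidx i j)|.
have m10 : 0 <= m1.
  by apply: sumr_ge0 => i _; apply: sumr_ge0 => j _; rewrite mulr_ge0// addr_ge0.
have m20 : 0 <= m2 by apply: sumr_ge0 => i _; apply: sumr_ge0.
pose n : nat := (Num.truncn ((m1 + m2) / - qform x v)).+1.
have nq : (m1 + m2) < n%:R * - qform x v.
  by rewrite -ltr_pdivrMr ?oppr_gt0// truncnS_gt.
have n1 : 1 <= n%:R :> R by rewrite ler1n.
have := H [ffun i => Num.floor (n%:R * v i)]; apply/negP; rewrite -ltNge.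
set w := fun i => _.
pose t i := n%:R * v i - w i.
have t1 i : `|t i| <= 1.
  have /andP[l u] := floor_itv (n%:R * v i).
  rewrite /t /w ffunE ger0_norm ?subr_ge0// lerBlDr addrC; apply: ltW.
  by rewrite -intrD1.
have wE i : w i = n%:R * v i - t i by rewrite /t; ring.
apply: (@le_lt_trans _ _ (n%:R ^+ 2 * qform x v + n%:R * m1 + m2)); last by nra.
rewrite /qform /m1 /m2 !mulr_sumr -!big_split; apply: ler_sum => i _ /=.
rewrite !mulr_sumr -!big_split; apply: ler_sum => j _ /=.
rewrite !wE; set X := x _.
have e1 : - (t i * X * v j) <= `|X| * `|v j|.
  rewrite (le_trans (ler_norm _))// normrN !normrM ler_wpM2r//.
  by rewrite ler_piMl.
have e2 : - (v i * X * t j) <= `|X| * `|v i|.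
  rewrite (le_trans (ler_norm _))// normrN !normrM -mulrA mulrC -mulrA ler_wpM2l//.
  by rewrite ler_piMl.
have e3 : t i * X * t j <= `|X|.
  rewrite (le_trans (ler_norm _))// !normrM -mulrA mulrC -mulrA ler_piMr//.
  by rewrite mulr_ile1.
by nra.
Qed.

Lemma cmeas_qform v : cmeas (qform^~ v).
Proof.
move=> dZ Z phi mphi; apply: measurable_sum => i; apply: measurable_sum => j.
by apply: measurable_funM => //; exact: measurable_funM.
Qed.

Lemma sum_delta (F : 'I_d -> R) (i : 'I_d) : \sum_(k < d) (k == i)%:R * F k = F i.
Proof.
rewrite (bigD1 i)//= eqxx mul1r big1 ?addr0// => k /negbTE ->.
by rewrite mul0r.
Qed.

Lemma qform_delta2 x i j (s : R) :
  qform x (fun k => (k == i)%:R + s * (k == j)%:R) =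
  x (sidx i i) + 2 * s * x (sidx i j) + s ^+ 2 * x (sidx j j).
Proof.
rewrite /qform.
transitivity (\sum_(k < d) ((k == i)%:R * (x (sidx k i) + s * x (sidx k j))
   + s * ((k == j)%:R * (x (sidx k i) + s * x (sidx k j))))).
  apply: eq_bigr => k _.
  transitivity (((k == i)%:R + s * (k == j)%:R) *
    \sum_(l < d) ((l == i)%:R * x (sidx k l) + s * ((l == j)%:R * x (sidx k l)))).
    by rewrite mulr_sumr; apply: eq_bigr => l _; ring.
  by rewrite big_split /= -mulr_sumr !sum_delta; ring.
by rewrite big_split /= -mulr_sumr !sum_delta (sidxC j i); ring.
Qed.

Lemma psd_diag_ge0 x i : C x -> 0 <= x (sidx i i).
Proof.
rewrite in_psdE => /(_ (fun k => (k == i)%:R + 0 * (k == i)%:R)).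
by rewrite qform_delta2; congr (_ <= _); ring.
Qed.

(** The form at $e_i + e_j$ and at $e_i - e_j$ bounds the entry from both sides. Diagonal entries
    thus control all coordinates of an order interval. *)
Lemma psd_offdiag x i j : C x -> `|x (sidx i j)| <= x (sidx i i) + x (sidx j j).
Proof.
move=> Cx; have xi := psd_diag_ge0 _ i Cx; have xj := psd_diag_ge0 _ j Cx.
move: Cx; rewrite in_psdE => Cx.
have := Cx (fun k => (k == i)%:R + 1 * (k == j)%:R).
have := Cx (fun k => (k == i)%:R + (-1) * (k == j)%:R).
by rewrite !qform_delta2 ler_norml => h1 h2; apply/andP; split; lra.
Qed.

Definition smx x : 'M[R]_d := \matrix_(i, j) x (sidx i j).
Definition of_smx (M : 'M[R]_d) : V := fun q => M (val q).1 (val q).2.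

Lemma of_smxK M : M^T = M -> smx (of_smx M) = M.
Proof.
move=> Ms; apply/matrixP => i j; rewrite mxE /of_smx /=.
by case: leqP => //= _; rewrite -[in LHS]Ms mxE.
Qed.

Lemma smxK x : of_smx (smx x) = x.
Proof. by apply/funext => q; rewrite /of_smx mxE sidxK. Qed.

Lemma smx_sym x : (smx x)^T = smx x.
Proof. by apply/matrixP => i j; rewrite !mxE sidxC. Qed.

Lemma smxD x y : smx (x + y) = smx x + smx y.
Proof. by apply/matrixP => i j; rewrite !mxE. Qed.

Lemma of_smxD M N : of_smx (M + N) = of_smx M + of_smx N.
Proof. by apply/funext => q; rewrite /of_smx mxE. Qed.

Lemma qform_mx x (v : 'cV[R]_d) : (v^T *m smx x *m v) 0 0 = qform x (v^~ 0).
Proof.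
rewrite mxE /qform exchange_big; apply: eq_bigr => j _.
by rewrite mxE mulr_suml; apply: eq_bigr => i _; rewrite !mxE.
Qed.

Lemma in_psd_mx x : C x <-> forall v : 'cV[R]_d, 0 <= (v^T *m smx x *m v) 0 0.
Proof.
rewrite in_psdE; split=> [H v|H v]; first by rewrite qform_mx.
have := H (\col_i v i); rewrite qform_mx; congr (_ <= qform _ _).
by apply/funext => i; rewrite mxE.
Qed.

Definition congr_mx (A : 'M[R]_d) x : V := of_smx (A *m smx x *m A^T).

Lemma smx_congr A x : smx (congr_mx A x) = A *m smx x *m A^T.
Proof. by rewrite of_smxK// !trmx_mul trmxK smx_sym mulmxA. Qed.

Lemma congr_mxM A B x : congr_mx A (congr_mx B x) = congr_mx (A *m B) x.
Proof. by rewrite {1}/congr_mx smx_congr /congr_mx trmx_mul !mulmxA. Qed.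

Lemma congr_mx1 x : congr_mx 1%:M x = x.
Proof. by rewrite /congr_mx trmx1 mulmx1 mul1mx smxK. Qed.

Lemma congr_mx_psd A x : C x -> C (congr_mx A x).
Proof.
rewrite !in_psd_mx => H v; rewrite smx_congr.
by have := H (A^T *m v); rewrite trmx_mul trmxK !mulmxA.
Qed.

(** An interior [r] is positive definite; congruence by a Cholesky factor of [r] carries the
    identity matrix to [r] and preserves semidefiniteness in both directions. *)
Lemma psd_cone_ax : (0 < d)%N -> cone_ax C (xi0 R PSD d).
Proof.
move=> d_gt0; have d0 : 0 < d%:R :> R by rewrite ltr0n.
have eE i j : xi0 R PSD d (sidx i j) = (i == j)%:R.
  rewrite /xi0 /=; case: leqP => _ /=; first by case: eqVneq.
  by rewrite eq_sym; case: eqVneq.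
have qe v : qform (xi0 R PSD d) v = \sum_(i < d) v i ^+ 2.
  rewrite /qform; apply: eq_bigr => i _.
  transitivity (\sum_(j < d) (j == i)%:R * (v i * v j)); last by rewrite sum_delta.
  by apply: eq_bigr => j _; rewrite eE eq_sym; ring.
split.
- rewrite in_psdE => v; rewrite (_ : 0 = scl 0 (0 : V)) ?qformZ ?mul0r//.
  by apply/funext => q; rewrite /scl mul0r.
- by move=> x y; rewrite !in_psdE => Cx Cy v; rewrite qformD addr_ge0.
- by move=> a x a0; rewrite !in_psdE => Cx v; rewrite qformZ mulr_ge0.
- move=> dZ Z phi mphi.
  rewrite (_ : (fun z => _) = fun z => `[< forall t : {ffun 'I_d -> int},
      0 <= qform (phi z) (fun i => (t i)%:~R) >]).
    apply: asbool_measurable_countable => t; apply: measurable_fun_ler => //.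
    exact: cmeas_qform.
  by apply/funext => z; apply: asbool_equiv_eq; exact: in_psd_int.
- exists d%:R => // u u1; rewrite in_psdE => v; rewrite qformD qformZ qe.
  suff : - qform u v <= d%:R * \sum_(i < d) v i ^+ 2 by lra.
  (* Since the entries of [u] are at most 1 in modulus, each term is bounded by $|v_i v_j| \le
     (v_i^2 + v_j^2) / 2$. *)
  apply: (@le_trans _ _ (\sum_(i < d) \sum_(j < d) (v i ^+ 2 / 2 + v j ^+ 2 / 2))).
    rewrite /qform -sumrN; apply: ler_sum => i _; rewrite -sumrN; apply: ler_sum => j _.
    have /ler_normlP[ul uu] := u1 (sidx i j); set U := u _ in ul uu *.
    have := sqr_ge0 (v i + v j); have := sqr_ge0 (v i - v j).
    by nra.
  set S := \sum_(i < d) v i ^+ 2.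
  rewrite [leLHS](_ : _ = d%:R * S)//.
  transitivity (\sum_(i < d) (d%:R * (v i ^+ 2 / 2) + S / 2)).
    apply: eq_bigr => i _; rewrite big_split /= sumr_const card_ord -[_ *+ d]mulr_natl.
    by rewrite -mulr_suml.
  rewrite big_split /= -mulr_sumr -mulr_suml sumr_const card_ord -[_ *+ d]mulr_natl -/S.
  by field.
- move=> r; exists (\sum_(i < d) (r (sidx i i) + r (sidx i i))) => x Cx Crx q.
  rewrite -(sidxK q); set i := (val q).1; set j := (val q).2.
  have rx k : 0 <= x (sidx k k) <= r (sidx k k).
    rewrite psd_diag_ge0//=.
    have : 0 <= r (sidx k k) - x (sidx k k) by exact: (psd_diag_ge0 _ k Crx).
    by rewrite subr_ge0.
  apply: le_trans (psd_offdiag _ i j Cx) _; rewrite big_split /=.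
  have le_sum m : x (sidx m m) <= \sum_(l < d) r (sidx l l).
    have /andP[_ h] := rx m; apply: le_trans h _; rewrite (bigD1 m)//= lerDl sumr_ge0// => l _.
    by have /andP[h1 h2] := rx l; exact: le_trans h1 h2.
  exact: lerD.
- move=> r c c0; rewrite in_psdE => Cr.
  have [v v0|A Au rA] := @cholesky R d (smx r) (smx_sym r).
    rewrite qform_mx; have := Cr (v^~ 0); rewrite qformD qformN qformZ qe.
    suff : 0 < \sum_(i < d) v i 0 ^+ 2 by move=> h; have := mulr_gt0 c0 h; lra.
    rewrite lt_neqAle sumr_ge0 ?andbT; last by move=> i _; rewrite sqr_ge0.
    apply: contra v0; rewrite eq_sym psumr_eq0; last by move=> i _; rewrite sqr_ge0.
    move=> /allP H; apply/eqP/matrixP => i j; rewrite ord1 mxE; apply/eqP.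
    by rewrite -sqrf_eq0; apply: H; rewrite mem_index_enum.
  exists (congr_mx A), (congr_mx (invmx A)); split.
  + by move=> x y; rewrite /congr_mx smxD mulmxDr mulmxDl of_smxD.
  + by move=> x; rewrite congr_mxM mulmxV// congr_mx1.
  + move=> q dZ Z phi mphi; rewrite /congr_mx /of_smx.
    under eq_fun do rewrite !mxE; apply: measurable_sum => i.
    apply: measurable_funM => //; under eq_fun do rewrite !mxE.
    apply: measurable_sum => j; apply: measurable_funM => //; under eq_fun do rewrite !mxE; exact: mphi.
  + move=> x; split; last exact: congr_mx_psd.
    by move=> /(congr_mx_psd (invmx A)); rewrite congr_mxM mulVmx// congr_mx1.
  + rewrite /congr_mx (_ : smx _ = 1%:M) ?mulmx1 -?rA ?smxK//.
    by apply/matrixP => i j; rewrite !mxE eE.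
Qed.
End PSDCone.

Lemma inord_absz (u : int) (N : nat) :
  `|u| <= N%:Z -> u = ((@inord N.*2 (absz (u + N%:Z))) : nat)%:Z - N%:Z.
Proof. by rewrite ler_norml => /andP[h1 h2]; rewrite inordK; lia. Qed.

(** * The cones, volumes and characteristics of the statement in terms of the abstract cone *)

Section Link.
Context {R : realType} {k : cone_kind} {d : nat}.
Implicit Types (a b r : pt R k d) (z : lat k d).

Lemma cone_kind_ax : (0 < d)%N -> cone_ax (@in_cone R k d) (xi0 R k d).
Proof.
move=> d0; case: k; [exact: orthant_cone_ax|exact: lorentz_cone_ax|exact: psd_cone_ax].
Qed.

Lemma cleE a b : cle a b <-> in_cone (b - a).
Proof.
case: k a b => a b; rewrite /in_cone /cle /zero_pt /=.
- by split=> H j; have := H j; rewrite !fctE ?subr_ge0.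
- by rewrite !fctE subr0; under [in X in _ <-> X]eq_bigr do rewrite subr0.
- split=> H v; have := H v; congr (_ <= _);
    by apply: eq_bigr => i _; apply: eq_bigr => j _; rewrite !fctE ?subr0.
Qed.

Lemma iboxE r z : ibox r z <-> in_cone (lat_pt z : pt R k d) /\ in_cone (r - lat_pt z).
Proof.
rewrite /ibox /ival /= (cleE (lpt R z) r); split=> [[_ [H1 H2]]|[H1 H2]]; first by [].
split; last by [].
move: H1; rewrite /inI; clear; case: k z => z //=.
- by move=> H j; have := H j; rewrite /lat_pt /zero_pt ler0z.
- by move=> /in_lorentzE[]; rewrite /lat_pt ler0z.
Qed.

Lemma volE r : Defs.vol r = cvol in_cone r.
Proof.
rewrite /Defs.vol /cvol /cvole /amb_int /amb; congr (fine (iint _ _ _)).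
apply/funext => x; rewrite /civ indicE; congr ((nat_of_bool _)%:R%:E).
apply/idP/andP; rewrite inE /ival /= (cleE x).
  by move=> [? ?]; split; exact/asboolP.
by move=> [/asboolP ? /asboolP ?].
Qed.

Lemma gammaE n : gamma R k d n.+1 = gam in_cone (xi0 R k d) n.
Proof.
rewrite /gamma /gam volE /powint; congr (_ * fine _).
rewrite /amb_int /amb; congr (iint _ _ _).
apply/funext => x; rewrite /= volE /civ indicE; congr ((nat_of_bool _)%:R * _)%:E.
apply/idP/andP; rewrite inE /ival /= (cleE x).
  by move=> [? ?]; split; exact/asboolP.
by move=> [/asboolP ? /asboolP ?].
Qed.

Lemma finite_ibox r : (0 < d)%N -> finite_set (ibox (k := k) r).
Proof.
move=> d0; have [B BP] := cone_bnd _ _ (cone_kind_ax d0) r.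
pose N := (Num.truncn `|B|).+1.
pose h (f : {ffun Defs.coord k d -> 'I_(N.*2.+1)}) : lat k d := [ffun j => (f j)%:Z - N%:Z].
apply: (@sub_finite_set _ _ (range h)); last exact: finite_image.
move=> z /iboxE[z1 z2] /=.
have zB j : `|z j| <= N%:Z.
  have : `|(z j)%:~R : R| <= N%:R.
    apply: le_trans (BP _ z1 z2 j) _; apply: le_trans (ler_norm _) _.
    by apply: ltW; exact: truncnS_gt.
  by rewrite -intr_norm -[N%:R]/(N%:Z%:~R) ler_int.
clearbody N; exists [ffun j => inord (absz (z j + N%:Z))] => //.
by apply/ffunP => j; rewrite /h !ffunE; apply: esym; exact: inord_absz.
Qed.
End Link.

(** * Counting labelled forests *)

(** [FPair f1 f2] is a pair enclosing [f1] and followed by [f2]; [FDot f] is a singleton followed by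
    [f] at the same level. *)
Inductive forest := FNil | FDot of forest | FPair of forest & forest.

(* Letters: [Some true] opens a pair, [Some false] closes one, [None] is a singleton. *)
Fixpoint fword (f : forest) : seq (option bool) :=
  match f with
  | FNil => [::]
  | FDot f' => None :: fword f'
  | FPair f1 f2 => Some true :: fword f1 ++ Some false :: fword f2
  end.

Fixpoint fpairs (f : forest) : nat :=
  match f with
  | FNil => 0
  | FDot f' => fpairs f'
  | FPair f1 f2 => (fpairs f1 + fpairs f2).+1
  end.

(** Only the top level is inspected: singletons inside a pair are allowed, so this is the condition
    that all singletons are inner. *)
Fixpoint fnodot (f : forest) : bool :=
  match f with
  | FNil => true
  | FDot _ => false
  | FPair _ f2 => fnodot f2
  end.

(** Here [g n] plays the role of $\gamma_{n+1}$: a pair enclosing [n] others is the outer block of a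
    component with [n + 1] pairs. *)
Fixpoint gcoef {R : pzRingType} (g : nat -> R) (f : forest) : R :=
  match f with
  | FNil => 1
  | FDot f' => gcoef g f'
  | FPair f1 f2 => g (fpairs f1) * gcoef g f1 * gcoef g f2
  end.

Section Runs.
Context {L : eqType}.
Variables (rel : option L -> L -> bool) (B : seq L).

(* [st] lists the labels of the pairs currently open, innermost first. *)
Fixpoint runs (w : seq (option bool)) (st : seq L) : nat :=
  match w, st with
  | [::], [::] => 1
  | Some true :: w', _ => \sum_(y <- B | rel (ohead st) y) runs w' (y :: st)
  | Some false :: w', _ :: st' => runs w' st'
  | None :: w', _ :: _ => runs w' st
  | _, _ => 0
  end.

Fixpoint fcount (f : forest) (o : option L) : nat :=
  match f with
  | FNil => 1
  | FDot f' => if o is Some _ then fcount f' o else 0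
  | FPair f1 f2 => (\sum_(y <- B | rel o y) fcount f1 (Some y)) * fcount f2 o
  end.

(** Reading a forest consults only the top of the stack and leaves the stack as it was, so the count
    factors. *)
Lemma runs_fword f w st : runs (fword f ++ w) st = (fcount f (ohead st) * runs w st)%N.
Proof.
elim: f w st => [|f IH|f1 IH1 f2 IH2] w st /=; first by rewrite mul1n.
  by case: st => //= y st; rewrite IH.
by rewrite -mulnA -IH2 big_distrl /=; apply: eq_bigr => y _; rewrite -catA IH1.
Qed.
End Runs.

Lemma le_fcount {L : eqType} (rel rel' : option L -> L -> bool) (B : seq L) f o :
  (forall o y, rel o y -> rel' o y) -> (fcount rel B f o <= fcount rel' B f o)%N.
Proof.
move=> rr; elim: f o => [|f IH|f1 IH1 f2 IH2] o //=; first by case: o.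
apply: leq_mul => //; rewrite big_mkcond [leqRHS]big_mkcond /=.
apply: leq_sum => y _; case: ifPn => // /rr ->; exact: IH1.
Qed.

Section Asymptotics.
Context {R : realType} {k : cone_kind} {d : nat}.
Hypothesis d0 : (0 < d)%N.
Local Notation C := (@in_cone R k d).
Local Notation e := (xi0 R k d).
Local Notation V := (pt R k d).
Local Notation vol := (cvol C).
Local Notation T := (Defs.coord k d).
Let CA := @cone_kind_ax R k d d0.

Definition weak_rel (o : option (lat k d)) (y : lat k d) : bool :=
  if o is Some x then `[< cle (lpt R x) (lpt R y) >] else true.

Definition strict_rel (o : option (lat k d)) (y : lat k d) : bool :=
  if o is Some x then `[< clt (R := R) x y >] else true.

Definition ibox_seq (r : V) : seq (lat k d) := fset_set (ibox (k := k) r).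

Lemma mem_ibox_seq r y : (y \in ibox_seq r) = `[< C (lat_pt y) /\ C (r - lat_pt y) >].
Proof.
rewrite /ibox_seq in_fset_set; last exact: finite_ibox.
by apply/idP/asboolP; rewrite inE iboxE.
Qed.

Definition obase (o : option (lat k d)) : V := if o is Some x then lat_pt x else 0.
Definition obox (r : V) (o : option (lat k d)) : bool :=
  if o is Some x then x \in ibox_seq r else true.

Local Notation fcoef := (gcoef (gam C e)).

Lemma fcoef_ge0 f : 0 <= fcoef f.
Proof. by elim: f => //= f1 h1 f2 h2; apply: mulr_ge0 => //; apply: mulr_ge0 => //; exact: gam_ge0. Qed.

Let Ce : C e := cone_e _ _ CA.
Let Cscl l : 0 <= l -> C (scl l e). Proof. by move=> l0; exact: (coneZ _ _ CA). Qed.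

Lemma coord_inhabited : exists j : T, true.
Proof.
clear -d0; case: k => /=.
- by exists (Ordinal d0).
- by exists None.
- by exists (sidx (Ordinal d0) (Ordinal d0)).
Qed.

(** Otherwise [C], with [e] in its interior, would be the whole space, and its order intervals would
    be unbounded. *)
Lemma cone_pointed K : 0 < K -> ~ C (- scl K e).
Proof.
move=> K0 CK; have CN : C (- e).
  by rewrite -(coneZE _ _ CA K)//; congr C: CK; apply/funext => i; rewrite /scl !fctE mulrN.
have [K1 K10 KP] := cone_unit _ _ CA.
have allC (x : V) : C x.
  pose m := \sum_j `|x j| + 1.
  have m0 : 0 < m by rewrite ltr_pwDr// sumr_ge0.
  rewrite -(coneZE _ _ CA m^-1) ?invr_gt0//.
  have -> : scl m^-1 x = (scl K1 e + scl m^-1 x) + scl K1 (- e).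
    by apply/funext => i; rewrite /scl !fctE; ring.
  apply: (coneD _ _ CA); last by apply: (coneZ _ _ CA) => //; exact: ltW.
  apply: KP => j; rewrite /scl normrM ger0_norm ?invr_ge0 ?(ltW m0)//.
  rewrite mulrC ler_pdivrMr// mul1r /m (bigD1 j)//= -addrA lerDl addr_ge0//.
  by rewrite sumr_ge0.
have [j _] := coord_inhabited.
have [b bP] := cone_bnd _ _ CA 0.
have := bP (fun=> `|b| + 1) (allC _) (allC _) j.
by rewrite ger0_norm ?addr_ge0//; have := ler_norm b; lra.
Qed.

Let le_volX (n : nat) (x y : V) : C (y - x) -> vol x ^+ n <= vol y ^+ n.
Proof. by move=> xy; rewrite lerXn2r ?nnegrE ?cvol_ge0//; exact: (le_cvol _ _ CA). Qed.

(* The shift by [scl l e] absorbs every boundary effect: bounds of this shape,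
   with a larger [l], are reproduced by the recursion defining [fcount]. *)
Lemma fcount_upper f : exists2 l : R, 0 <= l & forall r o, obox r o ->
  (fcount weak_rel (ibox_seq r) f o)%:R <= fcoef f * vol (r - obase o + scl l e) ^+ fpairs f.
Proof.
have [K K0 KP] := cone_unit _ _ CA.
elim: f => [|f [l l0 IH]|f1 [l1 l10 IH1] f2 [l2 l20 IH2]] /=.
- by exists 0 => // r o _; rewrite expr0 mulr1.
- exists l => // -r [x|] ro; first exact: IH.
  by rewrite mulr_ge0 ?fcoef_ge0// exprn_ge0// cvol_ge0.
exists (l1 + l2 + (K + K)); first by rewrite !addr_ge0// ltW.
move=> r o ro; rewrite natrM -addSn exprD.
have -> : forall a b c x y : R, a * b * c * (x * y) = (b * (a * x)) * (c * y) by move=> *; ring.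
set S := r - obase o.
apply: ler_pM => //; last first.
  apply: le_trans (IH2 _ _ ro) _; rewrite ler_wpM2l ?fcoef_ge0//; apply: le_volX.
  have -> : S + scl (l1 + l2 + (K + K)) e - (r - obase o + scl l2 e) = scl (l1 + (K + K)) e.
    by rewrite /S; apply/funext => i; rewrite /scl !fctE; ring.
  by apply: Cscl; rewrite !addr_ge0// ltW.
pose s := [seq y <- ibox_seq r | weak_rel o y].
rewrite natr_sum -big_filter -/s.
have sP y : y \in s -> C (lat_pt y - obase o) /\ C (r - lat_pt y).
  rewrite mem_filter => /andP[oy]; rewrite mem_ibox_seq => /asboolP[y1 y2]; split=> //.
  case: (o) oy => [x|_] /=; last by rewrite subr0.
  by move=> /asboolP; rewrite cleE.
apply: (@le_trans _ _ (\sum_(y <- s) fcoef f1 * vol (r - lat_pt y + scl l1 e) ^+ fpairs f1)).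
  rewrite big_seq [leRHS]big_seq; apply: ler_sum => y ys; apply: IH1.
  by move: ys; rewrite mem_filter => /andP[].
rewrite -mulr_sumr ler_wpM2l ?fcoef_ge0//.
apply: le_trans (riemann_upper _ _ CA K K0 KP _ _ r (obase o) _ _ _ sP) _.
- exact: Cscl.
- by rewrite filter_uniq// fset_uniq.
rewrite ler_wpM2l ?gam_ge0//; apply: le_volX.
have -> : S + scl (l1 + l2 + (K + K)) e - (r - obase o + scl l1 e + scl (K + K) e) = scl l2 e.
  by rewrite /S; apply/funext => i; rewrite /scl !fctE; ring.
exact: Cscl.
Qed.

(** Counterpart of [fcount_upper] for the strict count. The disjunction says that every singleton
    has a pair around it, since [fcount] vanishes on a dot with no open pair. The last premise keeps
    the shrunken interval inside the cone, where [riemann_lower] operates. *)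
Lemma fcount_lower f : exists2 l : R, 0 <= l & forall r o, obox r o -> fnodot f || isSome o ->
  C (r - obase o - scl l e) ->
  fcoef f * vol (r - obase o - scl l e) ^+ fpairs f <= (fcount strict_rel (ibox_seq r) f o)%:R.
Proof.
have [K K0 KP] := cone_unit _ _ CA.
elim: f => [|f [l l0 IH]|f1 [l1 l10 IH1] f2 [l2 l20 IH2]] /=.
- by exists 0 => // r o _ _ _; rewrite expr0 mulr1.
- by exists l => // -r [x|]//= ro _; exact: (IH r (Some x) ro (orbT _)).
exists (l1 + l2 + 4 * K); first by rewrite !addr_ge0// mulr_ge0// ltW.
move=> r o ro dot; rewrite natrM -addSn exprD => CS.
have -> : forall a b c x y : R, a * b * c * (x * y) = (b * (a * x)) * (c * y) by move=> *; ring.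
set S := _ - scl _ e in CS *.
have S1 : C (r - obase o - scl l1 e - scl (4 * K) e - S).
  have -> : r - obase o - scl l1 e - scl (4 * K) e - S = scl l2 e.
    by rewrite /S; apply/funext => i; rewrite /scl !fctE; ring.
  exact: Cscl.
have S2 : C (r - obase o - scl l2 e - S).
  have -> : r - obase o - scl l2 e - S = scl (l1 + 4 * K) e.
    by rewrite /S; apply/funext => i; rewrite /scl !fctE; ring.
  by apply: Cscl; rewrite addr_ge0// mulr_ge0// ltW.
have CT x : C (x - S) -> C x.
  by move=> xS; rewrite -(subrK S x); exact: (coneD _ _ CA).
have v0 n (x : V) : 0 <= vol x ^+ n by rewrite exprn_ge0// cvol_ge0.
apply: ler_pM.
- by apply: mulr_ge0; [exact: fcoef_ge0|apply: mulr_ge0; [exact: gam_ge0|exact: v0]].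
- by apply: mulr_ge0; [exact: fcoef_ge0|exact: v0].
- pose s := [seq y <- ibox_seq r | strict_rel o y].
  have Co : C (obase o).
    case: (o) ro => [x|_] /=; last exact: (cone0 _ _ CA).
    by rewrite mem_ibox_seq => /asboolP[].
  rewrite natr_sum -big_filter -/s.
  apply: (@le_trans _ _ (fcoef f1 * \sum_(y <- s | `[< C (r - scl l1 e - lat_pt y) >])
      vol (r - lat_pt y - scl l1 e) ^+ fpairs f1)).
    rewrite ler_wpM2l ?fcoef_ge0//.
    apply: le_trans; last apply: (riemann_lower _ _ CA K K0 KP _ _ _ (obase o)).
    + by rewrite ler_wpM2l ?gam_ge0//; apply: le_volX; exact: S1.
    + by rewrite filter_uniq// fset_uniq.
    + move=> y yo ry; rewrite mem_filter mem_ibox_seq; apply/andP; split.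
        case: (o) yo => [x|//] /= yx; apply/asboolP; split.
          rewrite cleE -[lpt R y - _](subrK (scl K e)); apply: (coneD _ _ CA) => //.
          by apply: Cscl; exact: ltW.
        (* The gap left by [riemann_lower] gives strictness: equal labels would put [- scl K e] in
           the cone. *)
        move=> xy; move: yx; rewrite xy subrr sub0r; exact: cone_pointed.
      apply/asboolP; split.
        have -> : lat_pt y = (lat_pt y - obase o - scl K e) + (obase o + scl K e).
          by apply/funext => i; rewrite !fctE; ring.
        by do 2! apply: (coneD _ _ CA) => //; apply: Cscl; exact: ltW.
      have -> : r - lat_pt y = (r - scl l1 e - lat_pt y) + scl l1 e.
        by apply/funext => i; rewrite !fctE; ring.
      by apply: (coneD _ _ CA) => //; exact: Cscl.
    + exact: CT S1.
  rewrite mulr_sumr big_mkcond big_seq [leRHS]big_seq; apply: ler_sum => y ys.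
  case: asboolP => // Cy; have := IH1 r (Some y).
  have E : r - lat_pt y - scl l1 e = r - scl l1 e - lat_pt y by rewrite addrAC.
  rewrite /= orbT E; apply => //.
  by move: ys; rewrite mem_filter => /andP[].
- apply: le_trans (IH2 r o ro dot (CT _ S2)).
  by rewrite ler_wpM2l ?fcoef_ge0//; exact: le_volX.
Qed.

Lemma bernoulli_ge (t : R) n : 0 <= t <= 1 -> 1 - n%:R * t <= (1 - t) ^+ n.
Proof.
move=> /andP[t0 t1]; elim: n => [|n IH]; first by rewrite mul0r subr0 expr0.
rewrite exprS -natr1; apply: le_trans (ler_wpM2l _ IH); last by rewrite subr_ge0.
have : 0 <= n%:R :> R by []. move: (n%:R) => m m0; nra.
Qed.

(** Once [r] dominates a large multiple of [e], the shifts of both bounds lie below [scl de r], and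
    homogeneity replaces them by the factors $(1 \pm \delta)^{n b}$, with $\delta$ for [de]. *)
Lemma cone_lim_fcount f (N : V -> nat) : fnodot f ->
  (forall r, C r -> (fcount strict_rel (ibox_seq r) f None <= N r <=
                    fcount weak_rel (ibox_seq r) f None)%N) ->
  cone_limR (fun r : V => (N r)%:R / Defs.vol r ^+ fpairs f) (fcoef f).
Proof.
move=> dot NP eps eps0.
have [l1 l10 U] := fcount_upper f; have [l2 l20 D] := fcount_lower f.
pose l := l1 + l2; have l0 : 0 <= l by rewrite addr_ge0.
set c := fcoef f; have c0 : 0 <= c by exact: fcoef_ge0.
pose n := #|T|; set b := fpairs f.
(* This choice yields both $c / (1 - t) < c + \epsilon$ and $c (1 - t) > c - \epsilon$. *)
pose t := eps / (eps + c + 1).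
have t0 : 0 < t by rewrite divr_gt0//; lra.
have tE : t * (eps + c + 1) = eps by rewrite /t mulfVK//; lra.
have t1 : t < 1 by rewrite ltr_pdivrMr; lra.
pose de := t / (n * b).+1%:R.
have de0 : 0 < de by rewrite divr_gt0.
have det : (n * b)%:R * de < t.
  rewrite /de mulrCA gtr_pMr// ltr_pdivrMr// mul1r ltr_nat//.
have de1 : de < 1.
  by rewrite ltr_pdivrMr// mul1r (lt_le_trans t1)// ler1n.
(* The added 1 makes [r] interior, hence of positive volume, even if [l] is zero. *)
exists (scl (l / de + 1) e); split.
  by apply: Cscl; rewrite addr_ge0// divr_ge0// ltW.
move=> r Cr; rewrite cleE => re.
have rl l' : 0 <= l' -> l' <= l -> C (scl de r - scl l' e).
  move=> l'0 l'l; have /(coneZ _ _ CA de _ (ltW de0)) h := re.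
  have -> : scl de r - scl l' e = scl de (r - scl (l / de + 1) e) + scl (l - l' + de) e.
    by apply/funext => i; rewrite /scl !fctE; field; rewrite gt_eqF.
  apply: (coneD _ _ CA) => //; apply: Cscl; rewrite addr_ge0 ?subr_ge0// ltW//.
have v0 : 0 < vol r.
  apply: (cvol_gt0 _ _ CA _ _ _ re); rewrite ltr_wpDl// divr_ge0// ltW//.
rewrite volE; set v := vol r in v0 *.
have vb0 : 0 < v ^+ b by rewrite exprn_gt0.
have NU : (N r)%:R <= c * ((1 + de) ^+ (n * b) * v ^+ b).
  have /andP[_] := NP r Cr; rewrite -(ler_nat R) => /le_trans; apply.
  apply: le_trans (U r None isT) _; rewrite ler_wpM2l// subr0 exprM -exprMn.
  rewrite -(cvol_scl _ _ CA) ?addr_gt0//; apply: le_volX.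
  have -> : scl (1 + de) r - (r + scl l1 e) = scl de r - scl l1 e.
    by apply/funext => i; rewrite /scl !fctE; ring.
  by apply: rl => //; rewrite /l lerDl.
have ND : c * ((1 - de) ^+ (n * b) * v ^+ b) <= (N r)%:R.
  have /andP[h _] := NP r Cr; move: h; rewrite -(ler_nat R); apply: le_trans.
  have rl2 : C (r - obase None - scl l2 e - scl (1 - de) r).
    have -> : r - obase None - scl l2 e - scl (1 - de) r = scl de r - scl l2 e.
      by rewrite subr0; apply/funext => i; rewrite /scl !fctE; ring.
    by apply: rl => //; rewrite /l lerDr.
  apply: le_trans (D r None isT _ _); last first.
  - rewrite -[r - _ - _](subrK (scl (1 - de) r)); apply: (coneD _ _ CA) => //.
    by apply: (coneZ _ _ CA) => //; rewrite subr_ge0 ltW.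
  - by rewrite dot.
  rewrite ler_wpM2l// exprM -exprMn -(cvol_scl _ _ CA) ?subr_gt0//.
  exact: le_volX.
have B1 : 1 - t < (1 - de) ^+ (n * b).
  apply: lt_le_trans (bernoulli_ge _ _ _); last by rewrite !ltW.
  by rewrite ltrD2l ltrN2.
(* From $(1 + \delta)(1 - \delta) \le 1$, the upper factor is at most the inverse of the lower one,
   which Bernoulli's inequality has already bounded. *)
have B2 : (1 + de) ^+ (n * b) * (1 - t) <= 1.
  apply: (@le_trans _ _ ((1 + de) ^+ (n * b) * (1 - de) ^+ (n * b))).
    by rewrite ler_wpM2l// ?ltW// exprn_gt0// addr_gt0.
  rewrite -exprMn exprn_ile1//; nra.
set p := (1 + de) ^+ (n * b) in NU B2 *; set q := (1 - de) ^+ (n * b) in ND B1 *.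
have pp : c * p < c + eps.
  rewrite -(ltr_pM2r (x := 1 - t)); last lra.
  rewrite -mulrA; apply: (@le_lt_trans _ _ c); nra.
have qq : c - eps < c * q by nra.
rewrite ltr_norml; apply/andP; split.
  rewrite ltrBrDr addrC ltr_pdivlMr//.
  by apply: lt_le_trans ND; rewrite mulrA ltr_pM2r.
rewrite ltrBlDr addrC ltr_pdivrMr//.
by apply: le_lt_trans NU _; rewrite mulrA ltr_pM2r.
Qed.
End Asymptotics.

(** * Dyck words and the stack machine *)

(** The height [h] counts open pairs. A singleton letter needs [0 < h], because the conservation
    operator kills $\Omega$ and, on the side of partitions, singletons are inner. *)
Fixpoint motzkin (h : nat) (w : seq (option bool)) : bool :=
  match w with
  | [::] => h == 0%N
  | Some true :: w' => motzkin h.+1 w'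
  | Some false :: w' => (0 < h)%N && motzkin h.-1 w'
  | None :: w' => (0 < h)%N && motzkin h w'
  end.

(** The word is cut at the letter closing the innermost pair that was open before it. *)
Lemma motzkinS_split h w : motzkin h.+1 w ->
  exists f w2, w = fword f ++ Some false :: w2 /\ motzkin h w2.
Proof.
have [n] := ubnP (size w); elim: n w h => // n IH [|[[]|] w] h //= sw.
- move=> /IH[//|f1 [w2 [wE]]]; move: sw; rewrite wE size_cat /= => sw.
  move=> /IH[|f2 [w4 [w2E ok]]]; first by lia.
  by exists (FPair f1 f2), w4; rewrite w2E /= -catA.
- by move=> ok; exists FNil, w.
- by move=> /IH[//|f [w2 [wE ok]]]; exists (FDot f), w2; rewrite wE.
Qed.

Lemma motzkin_forest w : motzkin 0 w -> exists2 f, fnodot f & w = fword f.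
Proof.
have [n] := ubnP (size w); elim: n w => // n IH [|[[]|] w] //= sw.
  by exists FNil.
move=> /motzkinS_split[f1 [w2 [wE ok]]].
have [|f2 d2 w2E] := IH w2 _ ok; first by move: sw; rewrite wE size_cat /=; lia.
by exists (FPair f1 f2) => //=; rewrite wE w2E.
Qed.

Lemma runs_motzkin {L : eqType} (rel : option L -> L -> bool) (B : seq L) w st :
  ~~ motzkin (size st) w -> runs rel B w st = 0%N.
Proof.
elim: w st => [|[[]|] w IH] [|x st] //=.
- by move=> nw; rewrite big1// => y _; exact: IH.
- by move=> nw; rewrite big1// => y _; exact: IH.
- exact: IH.
- by move=> nw; exact: (IH (x :: st)).
Qed.

Lemma count_push_fword f : count_mem (Some true) (fword f) = fpairs f.
Proof. by elim: f => //= f1 h1 f2 h2; rewrite count_cat /= h1 h2; lia. Qed.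

Definition fdyck f := pmap id (fword f).

Lemma fdyck_pair f1 f2 : fdyck (FPair f1 f2) = true :: fdyck f1 ++ false :: fdyck f2.
Proof. by rewrite /fdyck /= pmap_cat. Qed.

Lemma size_fdyck f : size (fdyck f) = (fpairs f).*2.
Proof.
elim: f => // f1 h1 f2 h2.
by rewrite fdyck_pair /= size_cat /= h1 h2 doubleS doubleD !addnS.
Qed.

Lemma count_fdyck f : count id (fdyck f) = count negb (fdyck f).
Proof.
elim: f => // f1 h1 f2 h2.
by rewrite fdyck_pair /= !count_cat /= h1 h2; lia.
Qed.

Lemma take_fdyck f n : (count negb (take n (fdyck f)) <= count id (take n (fdyck f)))%N.
Proof.
elim: f n => // f1 h1 f2 h2 [|n]; first by rewrite take0.
rewrite fdyck_pair /= take_cat; case: ltnP => _; first by have := h1 n; lia.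
have e1 := count_fdyck f1; rewrite !count_cat; case: (n - _)%N => [|m] /=; first by lia.
by have := h2 m; lia.
Qed.

(** Up to the matching closer, each nonempty prefix has a strict surplus of openers: the leading
    [true], on top of the surplus given by [take_fdyck]. *)
Lemma first_return_fdyck f1 f2 :
  first_return (true :: fdyck f1 ++ false :: fdyck f2) = (size (fdyck f1)).+2.
Proof.
set w := true :: _; set n := _.+2; pose a := fun m => (0 < m)%N && (count id (take m w) == count negb (take m w)).
have sw : (n < (size w).+1)%N by rewrite /w /n /= size_cat /=; lia.
have an : a n.
  rewrite /a /w /n /= take_cat ltnNge leqnSn /= subSnn /= take0 !count_cat /= count_fdyck.
  by apply/eqP; lia.
have am m : (m < n)%N -> ~~ a m.
  case: m => [|m] // mn; rewrite /a /w /= take_cat.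
  have := take_fdyck f1 m; case: ltnP => h; first by move=> ?; apply/eqP; lia.
  have -> : (m - size (fdyck f1) = 0)%N by move: mn; rewrite /n; lia.
  by rewrite take_oversize// count_cat /= => ?; apply/eqP; rewrite count_cat /=; lia.
rewrite /first_return -/a; set F := find _ _.
have hasa : has a (iota 0 (size w).+1).
  by apply/hasP; exists n => //; rewrite mem_iota.
have Fs : (F < (size w).+1)%N by move: hasa; rewrite has_find size_iota.
apply/eqP; rewrite eqn_leq; apply/andP; split; rewrite leqNgt; apply/negP => lt.
  by have := before_find 0 lt; rewrite nth_iota// add0n an.
by have := nth_find 0 hasa; rewrite -/F nth_iota// add0n; apply/negP/am.
Qed.

Section Volume.
Context {R : realType} (g : nat -> R).
Hypothesis g1 : g 1%N = 1.
Local Notation coef := (gcoef (fun n => g n.+1)).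

Lemma gcoef_nil f : fdyck f = [::] -> coef f = 1.
Proof. by elim: f => // f1 h1 f2 h2; rewrite fdyck_pair. Qed.

Lemma VwS n b w : let n' := first_return (b :: w) in
  Vw g n.+1 (b :: w) =
  if drop n' (b :: w) is [::] then
    if size (b :: w) == 2%N then 1
    else g (size (b :: w) %/ 2) * Vw g n (behead (take (size (b :: w)).-1 (b :: w)))
  else Vw g n (take n' (b :: w)) * Vw g n (drop n' (b :: w)).
Proof. by []. Qed.

(** [Vw] gives a single block the value 1, whereas [gcoef] gives it [g 1]; the hypothesis [g1]
    reconciles the two. *)
Lemma Vw_fdyck n f : (size (fdyck f) <= n)%N -> Vw g n (fdyck f) = coef f.
Proof.
elim: n f => [|n IH] f sf.
  by rewrite gcoef_nil//; apply/nilP; rewrite /nilp -leqn0.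
(* This inner induction only strips leading dots, which change neither the Dyck word nor the
   coefficient. *)
elim: f sf => // f1 _ f2 _; rewrite fdyck_pair => sf.
have sf' : (size (fdyck f1) + (size (fdyck f2)).+1 <= n)%N by move: sf; rewrite /= size_cat.
rewrite VwS first_return_fdyck /=.
have -> : drop (size (fdyck f1)).+1 (fdyck f1 ++ false :: fdyck f2) = fdyck f2.
  by rewrite drop_cat ltnNge leqnSn /= subSnn /= drop0.
case Ef2 : (fdyck f2) => [|b w2].
  rewrite (gcoef_nil f2)// mulr1 size_cat /=.
  case: eqVneq => [s2|s2].
    have f10 : fdyck f1 = [::] by apply/nilP; rewrite /nilp; apply/eqP; move: s2; lia.
    by rewrite (gcoef_nil f1)// mulr1; have := size_fdyck f1; rewrite f10 /=; case: fpairs.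
  rewrite addn1 /= take_size_cat; last by [].
  rewrite IH; last by lia.
  by congr (g _ * _); rewrite size_fdyck; lia.
rewrite -Ef2 IH; last by lia.
congr (_ * _); have -> : true :: take (size (fdyck f1)).+1 (fdyck f1 ++ false :: fdyck f2) = fdyck (FPair f1 FNil).
  by rewrite fdyck_pair take_cat ltnNge leqnSn /= subSnn /= take0.
rewrite IH; first by rewrite /= mulr1.
rewrite fdyck_pair /= size_cat /=.
by move: sf'; rewrite Ef2 /=; lia.
Qed.

Lemma Vpp_fword f : Vpp g (pmap id (fword f)) = coef f.
Proof. exact: Vw_fdyck. Qed.
End Volume.

Section StackMachine.
Local Close Scope ring_scope.
Variable w : seq (option bool).
Local Notation letter := (nth None w).

(* Positions of the pairs open just before [t], innermost first. *)
Fixpoint stk (t : nat) : seq nat :=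
  if t is t'.+1 then
    match letter t' with
    | Some true => t' :: stk t'
    | Some false => behead (stk t')
    | None => stk t'
    end
  else [::].

(* Smallest position of the block containing [x]. *)
Definition opener_of (x : nat) : nat :=
  if letter x is Some false then head 0 (stk x) else x.

Lemma mem_stk y t : y \in stk t -> y < t /\ letter y = Some true.
Proof.
elim: t => //= t IH; case E: (letter t) => [[]|].
- by rewrite inE => /orP[/eqP->|/IH[? ?]]; split=> //; lia.
- by move=> /mem_behead/IH[? ?]; split=> //; lia.
- by move=> /IH[? ?]; split=> //; lia.
Qed.

Lemma stk_sorted t : sorted gtn (stk t).
Proof.
elim: t => //= t IH; case: (letter t) => [[]|] //; last first.
  by case: (stk t) IH => //= a s; exact: path_sorted.
rewrite /= (path_sortedE (rev_trans ltn_trans)) IH andbT.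
by apply/allP => y /mem_stk[].
Qed.

Lemma stk_uniq t : uniq (stk t).
Proof.
apply: sorted_uniq (stk_sorted t); last by move=> x; rewrite /= ltnn.
exact: rev_trans ltn_trans.
Qed.

Lemma stk_head_max y t : y \in stk t -> y <= head 0 (stk t).
Proof.
have := stk_sorted t; case: (stk t) => //= a s.
rewrite (path_sortedE (rev_trans ltn_trans)) => /andP[/allP h _].
by rewrite inE => /orP[/eqP->//|/h /= /ltnW].
Qed.

(** A position enters the stack only when it is read, so one found at [t'] has been there ever
    since. *)
Lemma stk_persist y t t' : y \in stk t' -> y < t -> t <= t' -> y \in stk t.
Proof.
move=> yt' yt; elim: t' yt' => [|t' IH] //= yt'.
rewrite leq_eqVlt => /orP[/eqP ->//|tt']; apply: IH; last by lia.
case: (letter t') yt' => [[]|] //; last exact: mem_behead.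
by rewrite inE => /orP[/eqP|//]; lia.
Qed.

(** The height in [motzkin] is the size of the stack. As [behead] of the empty stack is empty, [stk]
    never fails, and underflow must be excluded explicitly. *)
Lemma motzkin_stk : motzkin 0 w <->
  (forall t, t < size w -> letter t != Some true -> stk t != [::]) /\ stk (size w) = [::].
Proof.
pose P t := (forall x, t <= x < size w -> letter x != Some true -> stk x != [::]) /\
  stk (size w) = [::].
have H m t : t + m = size w -> motzkin (size (stk t)) (drop t w) <-> P t.
  elim: m t => [|m IH] t tm.
    rewrite addn0 in tm; rewrite tm drop_size /= size_eq0; split=> [/eqP s0|[_ ->//]].
    by split=> // x; lia.
  have tw : t < size w by lia.
  have [H1 H2] := IH t.+1 ltac:(lia).
  have St Q : (letter t != Some true -> stk t != [::]) -> (P t.+1 <-> Q) -> (P t <-> Q).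
    move=> h <-; split=> -[p1 p2]; split=> // x xs; first by apply: p1; lia.
    by have [->//|xt] := eqVneq x t; apply: p1; lia.
  have Sf : letter t != Some true -> stk t == [::] -> ~ P t.
    by move=> lt st [/(_ t)]; rewrite leqnn tw st => /(_ isT lt).
  rewrite (drop_nth None tw) /=; move: H1 H2 => /=.
  case E: (letter t) => [[]|] /= H1 H2.
  - by split=> [/H1|] h; [|apply: H2]; move: h; apply St; rewrite ?E.
  - case s0 : (stk t == [::]).
      split=> [|/Sf]; last by rewrite E s0 => /(_ isT isT).
      by rewrite (eqP s0).
    have -> : 0 < size (stk t) by rewrite lt0n size_eq0 s0.
    rewrite /= -size_behead.
    by split=> [/H1|] h; [|apply: H2]; move: h; apply St; rewrite ?s0.
  - case s0 : (stk t == [::]).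
      split=> [|/Sf]; last by rewrite E s0 => /(_ isT isT).
      by rewrite (eqP s0).
    have -> : 0 < size (stk t) by rewrite lt0n size_eq0 s0.
    by rewrite /=; split=> [/H1|] h; [|apply: H2]; move: h; apply St; rewrite ?s0.
have := H (size w) 0 (add0n _); rewrite drop0 /= => ->.
by split=> -[h1 h2]; split=> // t ?; apply: h1.
Qed.

Hypothesis w_ok : motzkin 0 w.

Lemma stk_neq0 t : t < size w -> letter t != Some true -> stk t != [::].
Proof. by have /motzkin_stk[h _] := w_ok; exact: h. Qed.

Lemma stk_end : stk (size w) = [::].
Proof. by have /motzkin_stk[] := w_ok. Qed.

Lemma head_stk_mem t : t < size w -> letter t != Some true -> head 0 (stk t) \in stk t.
Proof. by move=> tw lt; have := stk_neq0 _ tw lt; case: stk => //= a s _; rewrite mem_head. Qed.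

(** [y] is on the stack just after being read and gone at the end; the only letter that can remove
    it is a closer met with [y] on top. *)
Lemma closer_ex y : y < size w -> letter y = Some true ->
  exists2 c, y < c < size w & letter c = Some false /\ head 0 (stk c) = y.
Proof.
move=> yw ly.
have y1 : y \in stk y.+1 by rewrite /= ly mem_head.
have [c [cy /andP[yc cy']]] : exists c, c < size w /\ (y \in stk c) && (y \notin stk c.+1).
  apply: contrapT => H.
  suff : forall t, y < t <= size w -> y \in stk t.
    by move=> /(_ (size w)); rewrite yw leqnn stk_end => /(_ isT).
  elim=> // t IH /andP[yt tw]; have [<-//|ty] := eqVneq y t.
  have yt' : y \in stk t by apply: IH; lia.
  apply: contrapT => /negP h; apply: H; exists t; split; first by lia.
  by rewrite yt' h.
have [yc' _] := mem_stk _ _ yc.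
exists c; first by rewrite yc'.
move: cy'; rewrite /=; case: (letter c) => [[]|].
- by rewrite inE yc orbT.
- move: yc; case: (stk c) => //= a s; rewrite inE => /orP[/eqP->//|->//].
- by rewrite yc.
Qed.

(** A popped position never returns: were it on top again at the later closer, [stk_persist] would
    place it on the stack right after the earlier one. *)
Lemma closer_uniq c c' : c < size w -> c' < size w ->
  letter c = Some false -> letter c' = Some false -> head 0 (stk c) = head 0 (stk c') -> c = c'.
Proof.
wlog cc' : c c' / c <= c'.
  move=> W cw cw' lc lc' h; case: (leqP c c') => [|/ltnW] cc'; first exact: W.
  by apply/esym; apply: W.
move=> cw cw' lc lc' h; apply/eqP; rewrite eqn_leq cc' leqNgt; apply/negP => cc.
have h1 := head_stk_mem c cw ltac:(by rewrite lc).
have h2 := head_stk_mem c' cw' ltac:(by rewrite lc').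
have [hc _] := mem_stk _ _ h1.
rewrite -h in h2; have := stk_persist _ c.+1 _ h2 ltac:(lia) cc.
rewrite /= lc; have := stk_uniq c; move: h1; case: (stk c) => //= a s _ /andP[+ _].
by move=> /negP.
Qed.
End StackMachine.

(** * Noncrossing partitions as Motzkin words *)

Section Blocks.
Local Close Scope classical_set_scope.
Local Close Scope ring_scope.
Local Close Scope classical_set_scope.
Variable p : nat.
Implicit Types (B : {set 'I_p}) (x y l h : 'I_p) (P : {set {set 'I_p}}).

Lemma bminP B l : l \in B -> (forall i, i \in B -> l <= i) -> bmin B = l.
Proof.
move=> lB lmin; apply/eqP; rewrite eqn_leq; apply/andP; split.
  rewrite /bmin; move: (mem_index_enum l); elim: (index_enum _) => // a s IH.
  rewrite inE big_cons => /orP[/eqP<-|/IH h]; first by rewrite lB geq_minl.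
  by case: ifP => // _; rewrite geq_min h orbT.
rewrite /bmin; apply: (big_ind (fun m => l <= m)) => //.
- exact: ltnW.
- by move=> a b la lb; rewrite leq_min la.
Qed.

Lemma bmaxP B h : h \in B -> (forall i, i \in B -> i <= h) -> bmax B = h.
Proof.
move=> hB hmax; apply/eqP; rewrite eqn_leq; apply/andP; split.
  by apply/bigmax_leqP => i; exact: hmax.
by rewrite /bmax (bigD1 h)//= leq_maxl.
Qed.

Lemma bmin2 l h : l <= h -> bmin [set l; h] = l.
Proof.
move=> lh; apply: bminP; first by rewrite !inE eqxx.
by move=> i; rewrite !inE => /orP[] /eqP ->.
Qed.

Lemma bmax2 l h : l <= h -> bmax [set l; h] = h.
Proof.
move=> lh; apply: bmaxP; first by rewrite !inE eqxx orbT.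
by move=> i; rewrite !inE => /orP[] /eqP ->.
Qed.

(** A singleton is written [[set l; l]], so that both sizes of blocks share one description. *)
Lemma block12 B : (#|B| == 1) || (#|B| == 2) -> exists l h, B = [set l; h] /\ l <= h.
Proof.
move=> /orP[/cards1P[x ->]|/cards2P[x [y [xy ->]]]].
  by exists x, x; rewrite finset.setUid.
case: (leqP x y) => [|/ltnW] h; first by exists x, y.
by exists y, x; rewrite finset.setUC.
Qed.

Lemma card_block l h : l <= h -> #|[set l; h]| = (l < h).+1.
Proof. by move=> lh; rewrite cards2 ltn_neqAle lh andbT. Qed.

Lemma interval_step (a b t : nat) : a != t -> b != t ->
  (a < t) && (t <= b) = (a < t.+1) && (t < b).
Proof. by lia. Qed.

Section NC.
Variable P : {set {set 'I_p}}.
Hypothesis NP : NC12i P.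
Local Notation bl := (finset.pblock P).
Definition lo x := bmin (bl x).
Definition hi x := bmax (bl x).

Let Ppart : finset.partition P [set: 'I_p]%SET.
Proof. by case/andP: NP => /and3P[]. Qed.

Lemma pblock_in x : bl x \in P.
Proof. by rewrite pblock_mem// (cover_partition Ppart) inE. Qed.

Lemma mem_pblockT x : x \in bl x.
Proof. by rewrite mem_pblock (cover_partition Ppart) inE. Qed.

Lemma pblock_eq B x : B \in P -> x \in B -> bl x = B.
Proof. by move=> BP xB; apply: def_pblock => //; case/and3P: Ppart. Qed.

Lemma pblock_lohi x : exists l h, [/\ bl x = [set l; h], l <= h, lo x = l & hi x = h].
Proof.
case/andP: NP => /and3P[_ /forallP/(_ (bl x)) + _] _.
rewrite pblock_in /= => /block12[l [h [E lh]]]; exists l, h.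
by rewrite /lo /hi E bmin2 ?bmax2.
Qed.

Lemma lo_le x : lo x <= x.
Proof.
have [l [h [E lh -> _]]] := pblock_lohi x; have := mem_pblockT x.
by rewrite E !inE => /orP[] /eqP ->.
Qed.

Lemma le_hi x : x <= hi x.
Proof.
have [l [h [E lh _ ->]]] := pblock_lohi x; have := mem_pblockT x.
by rewrite E !inE => /orP[] /eqP ->.
Qed.

Lemma lo_or_hi x : nat_of_ord x = lo x \/ nat_of_ord x = hi x.
Proof.
have [l [h [E lh -> ->]]] := pblock_lohi x; have := mem_pblockT x.
by rewrite E !inE => /orP[] /eqP ->; [left|right].
Qed.

Lemma card_pblock x : #|bl x| = (lo x < hi x).+1.
Proof. by have [l [h [E lh -> ->]]] := pblock_lohi x; rewrite E card_block. Qed.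

Lemma pblock_lo x y : nat_of_ord y = lo x -> bl y = bl x.
Proof.
have [l [h [E lh -> _]]] := pblock_lohi x => /val_inj ->.
by apply: pblock_eq; rewrite ?pblock_in// E !inE eqxx.
Qed.

Lemma pblock_hi x y : nat_of_ord y = hi x -> bl y = bl x.
Proof.
have [l [h [E lh _ ->]]] := pblock_lohi x => /val_inj ->.
by apply: pblock_eq; rewrite ?pblock_in// E !inE eqxx orbT.
Qed.

Lemma lo_lt x : lo x < p.
Proof. by have [l [h [E lh -> _]]] := pblock_lohi x. Qed.

Lemma hi_lt x : hi x < p.
Proof. by have [l [h [E lh _ ->]]] := pblock_lohi x. Qed.

Lemma lo_inj x y : lo x = lo y -> bl x = bl y.
Proof.
move=> xy; rewrite -(pblock_lo x (Ordinal (lo_lt x)))//.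
by apply: pblock_lo; rewrite /= xy.
Qed.

Lemma lo_eqE x y : bl x = bl y -> lo x = lo y.
Proof. by rewrite /lo => ->. Qed.

Lemma hi_eqE x y : bl x = bl y -> hi x = hi y.
Proof. by rewrite /hi => ->. Qed.

Lemma nocross x y : lo x < lo y -> lo y < hi x -> hi y <= hi x.
Proof.
move=> h1 h2; rewrite leqNgt; apply/negP => h3.
case/andP: NP => /and3P[_ _ /forallP/(_ (bl x))] + _; rewrite pblock_in /=.
move=> /forallP/(_ (bl y)); rewrite pblock_in /=.
have -> /= : bl x != bl y by apply/eqP => /lo_eqE; lia.
move=> /negP; apply.
have [l [h [E lh lE hE]]] := pblock_lohi x; have [l' [h' [E' lh' lE' hE']]] := pblock_lohi y.
apply/existsP; exists l; apply/existsP; exists l'; apply/existsP; exists h; apply/existsP; exists h'.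
by rewrite E E' !inE !eqxx !orbT /=; rewrite -lE -lE' -hE -hE' h1 h2 h3.
Qed.

Lemma nested_pblock x y : nested (bl x) (bl y) = (lo x < lo y) && (hi y < hi x).
Proof.
rewrite /nested -/(lo x) -/(lo y) -/(hi x) -/(hi y).
have -> : lo y <= hi y by exact: leq_trans (lo_le y) (le_hi y).
case: eqVneq => [/lo_eqE ->|] //=; first by rewrite ltnn.
Qed.

Lemma inner_single x : lo x = hi x -> exists y, lo y < lo x /\ hi x < hi y.
Proof.
move=> lh; case/andP: NP => _ /forallP/(_ (bl x)); rewrite pblock_in /=.
rewrite card_pblock lh ltnn eqxx /= => /existsP[B /andP[BP]].
(* An empty [B] would have the default value [p] as its minimum, too large to enclose anything. *)
have [i iB|B0] := pickP [pred i | i \in B]; last first.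
  move=> /and4P[_ h _ _]; suff : bmin B = p by have := lo_lt x; rewrite /lo; lia.
  by rewrite /bmin big_pred0.
rewrite -(pblock_eq _ _ BP iB) nested_pblock => /andP[h1 h2]; exists i. by rewrite -{1}lh.
Qed.

Definition pletter x : option bool :=
  if #|bl x| == 2 then Some (nat_of_ord x == bmin (bl x)) else None.

Definition pword : seq (option bool) := [seq pletter x | x <- enum 'I_p].

Lemma size_pword : size pword = p.
Proof. by rewrite size_map size_enum_ord. Qed.

Lemma nth_pword x : nth None pword x = pletter x.
Proof. by rewrite (nth_map x) ?size_enum_ord// nth_ord_enum. Qed.

Lemma pletterE x : pletter x =
  if lo x < hi x then Some (nat_of_ord x == lo x) else None.
Proof. by rewrite /pletter card_pblock; case: ltnP. Qed.

(** The bridge from partitions to words: the stack before [t] holds the openers of the pairs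
    straddling that place. The delicate letter is a closer, where noncrossing must show that the
    position popped is its own partner. *)
Lemma mem_stk_pword t y : t <= p -> ((y : nat) \in stk pword t) =
  [&& lo y == y, lo y < hi y, y < t & t <= hi y].
Proof.
have hilt z t' : hi z = t' -> t' < p by move=> <-; exact: hi_lt.
elim: t y => [|t IH] y tp; first by rewrite ltn0 !andbF.
pose x := Ordinal tp; have xt : nat_of_ord x = t by [].
have := nth_pword x; rewrite pletterE /= => E.
have hit z : lo z = z -> z != x -> hi z = t -> lo x < hi x /\ lo x <> x.
  move=> lz zx hz; have bx : bl x = bl z by exact: pblock_hi.
  have := lo_eqE _ _ bx; have := hi_eqE _ _ bx; have := lo_le x.
  by move: zx; rewrite -val_eqE /= -/x -xt; clearbody x; lia.
have xy : (nat_of_ord y == t) = (y == x) by rewrite -val_eqE.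
move: E; rewrite /=; case: ltnP => lhx -> /=; last first.
  rewrite IH; last by exact: ltnW.
  have [lz|] := eqVneq (lo y) y => //=; have [lhy|] //= := ltnP (lo y) (hi y).
  have yx : y != x by apply: contraTneq lhy => ->; rewrite -leqNgt.
  apply: interval_step; first by rewrite xy.
  by apply/eqP => /(hit y lz yx)[h _]; rewrite ltnNge lhx in h.
case: eqVneq => [xlo|xlo].
  rewrite inE IH; last by exact: ltnW.
  rewrite xy; have [yx|yx] /= := eqVneq y x.
    by subst y; rewrite -xt -xlo eqxx ltnSn {1}xlo lhx /=; rewrite xlo.
  have [lz|] := eqVneq (lo y) y => //=; have [lhy|] //= := ltnP (lo y) (hi y).
  apply: interval_step; first by rewrite xy.
  by apply/eqP => /(hit y lz yx)[_]; rewrite -xlo xt.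
have xhi : t = hi x by case: (lo_or_hi x) => //= ?; lia.
pose y0 := Ordinal (lo_lt x).
have by0 : bl y0 = bl x by exact: pblock_lo.
have lo0 : lo y0 = lo x by exact: lo_eqE.
have hi0 : hi y0 = t by rewrite xhi; exact: hi_eqE.
have y0t : lo x < t by have := lo_le x => /=; lia.
have y0s : lo x \in stk pword t.
  by rewrite -[lo x]/(nat_of_ord y0) IH ?lo0 ?hi0 /= ?eqxx; lia.
(* A later opener on top would belong to a pair opened inside the block of [x] and closed beyond
   [t], crossing that block. *)
have hd : head 0 (stk pword t) = lo x.
  apply/eqP; rewrite eqn_leq stk_head_max// andbT leqNgt; apply/negP => lt.
  have hs : head 0 (stk pword t) \in stk pword t by move: y0s; case: stk => //= a s _; rewrite mem_head.
  have [ht _] := mem_stk _ _ _ hs.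
  have hp : head 0 (stk pword t) < p by lia.
  move: hs; rewrite -[head _ _]/(nat_of_ord (Ordinal hp)) IH; last by lia.
  set z := Ordinal hp in lt ht *; move=> /and4P[/eqP lz _ _ tz].
  have zt : hi z != t.
    apply/eqP => hz; have bxz : bl x = bl z by exact: pblock_hi.
    have := lo_eqE _ _ bxz; rewrite lz => e; move: lt; rewrite e /=; lia.
  have := nocross y0 z; rewrite lo0 hi0 lz => /(_ lt ht); lia.
have : ((y : nat) \in behead (stk pword t)) = ((y : nat) \in stk pword t) && (nat_of_ord y != lo x).
  have := stk_uniq pword t; move: y0s hd; case: (stk pword t) => //= a s _ -> /andP[ns us].
  rewrite inE; case: eqVneq => //= [->|_]; last by rewrite andbT.
  exact/negbTE.
move=> ->; rewrite IH; last by exact: ltnW.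
have [lz|] := eqVneq (lo y) y => //=; have [lhy|] //= := ltnP (lo y) (hi y).
have h1 : hi y = t -> nat_of_ord y = lo x.
  move=> hy; have bxy : bl x = bl y by exact: pblock_hi.
  by rewrite (lo_eqE _ _ bxy).
have h2 : nat_of_ord y = lo x -> hi y = t.
  move=> yx; have -> : y = y0 by exact: val_inj.
  exact: hi0.
have h3 : nat_of_ord y <> t.
  by move=> /eqP; rewrite xy => /eqP yx; move: y0t; rewrite -yx lz yx xt ltnn.
clear -h1 h2 h3; move: (lo x) h1 h2; move: (nat_of_ord y) (hi y) h3; clear => a b h3 c h1 h2.
have [bt|bt] := eqVneq b t.
  by rewrite bt ltnn andbF (h1 bt) eqxx andbF.
have ac : a != c by apply: contra bt => /eqP/h2 ->.
by rewrite ac andbT; apply: interval_step => //; exact/eqP.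
Qed.

Lemma opener_pword x : opener_of pword x = lo x.
Proof.
rewrite /opener_of nth_pword pletterE; case: ltnP => lhx; last first.
  by have := lo_le x; have := le_hi x; lia.
case: eqVneq => // xlo.
pose y0 := Ordinal (lo_lt x).
have xp : x <= p by exact: ltnW.
have y0s : lo x \in stk pword x.
  rewrite -[lo x]/(nat_of_ord y0) mem_stk_pword//.
  have by0 : bl y0 = bl x by exact: pblock_lo.
  rewrite (lo_eqE _ _ by0) (hi_eqE _ _ by0) eqxx lhx le_hi /= andbT.
  by have := lo_le x; lia.
apply/eqP; rewrite eqn_leq stk_head_max// andbT leqNgt; apply/negP => lt.
have hs : head 0 (stk pword x) \in stk pword x by move: y0s; case: stk => //= a s _; rewrite mem_head.
have [ht _] := mem_stk _ _ _ hs.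
have hp : head 0 (stk pword x) < p by lia.
move: hs; rewrite -[head _ _]/(nat_of_ord (Ordinal hp)) mem_stk_pword//.
set z := Ordinal hp in lt ht *; move=> /and4P[/eqP lz _ _ tz].
have xhi : nat_of_ord x = hi x by case: (lo_or_hi x) => //; lia.
have zt : hi z != x.
  apply/eqP => hz; have bxz : bl x = bl z by exact: pblock_hi.
  by have := lo_eqE _ _ bxz; rewrite lz => e; move: lt; rewrite e /=; lia.
have := nocross x z; rewrite -xhi lz => /(_ lt ht); lia.
Qed.

Lemma pword_motzkin : motzkin 0 pword.
Proof.
apply/motzkin_stk; rewrite size_pword; split=> [t tp lt|]; last first.
  case E : (stk pword p) => [|a s] //; have : a \in stk pword p by rewrite E mem_head.
  move=> h; have [ap _] := mem_stk _ _ _ h.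
  by move: h; rewrite -[a]/(nat_of_ord (Ordinal ap)) mem_stk_pword// => /and4P[_ _ _]; rewrite leqNgt hi_lt.
pose x := Ordinal tp; move: lt; rewrite -[t]/(nat_of_ord x) nth_pword pletterE.
have St y : lo y < x -> x <= hi y -> stk pword x != [::].
  move=> yx xy; have : lo y \in stk pword x; last by case: stk.
  have by0 : bl (Ordinal (lo_lt y)) = bl y by exact: pblock_lo.
  rewrite -[lo y]/(nat_of_ord (Ordinal (lo_lt y))) mem_stk_pword; last exact: ltnW.
  by rewrite (lo_eqE _ _ by0) (hi_eqE _ _ by0) eqxx /= -[t]/(nat_of_ord x) yx xy (leq_trans yx xy).
case: ltnP => lhx.
  case: (eqVneq (nat_of_ord x) (lo x)) => // xlo _; apply: (St x); last exact: le_hi.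
  by rewrite ltn_neqAle lo_le eq_sym xlo.
have lx : lo x = hi x by apply/eqP; rewrite eqn_leq lhx (leq_trans (lo_le x) (le_hi x)).
have [y [y1 y2]] := inner_single x lx => _; apply: (St y).
  exact: leq_trans y1 (lo_le x).
exact: leq_trans (le_hi x) (ltnW y2).
Qed.

(** The blocks are the fibres of the map to the block minimum, which [opener_pword] computes from
    the word; so the word determines the partition. *)
Lemma partition_of_pword : P = preim_partition (fun x : 'I_p => opener_of pword x) [set: 'I_p]%SET.
Proof.
rewrite -(equivalence_partition_pblock Ppart) /preim_partition /equivalence_partition.
apply: eq_imset => x; apply/setP => y; rewrite !inE /= !opener_pword.
apply/idP/eqP => [yx|/lo_inj ->]; last exact: mem_pblockT.
by apply: lo_eqE; apply/esym; apply: pblock_eq => //; exact: pblock_in.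
Qed.

Lemma reduced_pword : reduced_word P = pmap id pword.
Proof.
rewrite /reduced_word /pword; elim: (enum 'I_p) => //= x s IH.
by rewrite /pletter; case: ifP => //= _; rewrite IH.
Qed.

Lemma npairs_pword : npairs P = count_mem (Some true) pword.
Proof.
rewrite /pword count_map.
have -> : count (preim pletter (pred1 (Some true))) (enum 'I_p) = #|[set x | pletter x == Some true]|.
  by rewrite enumT cardE /enum_mem size_filter; apply: eq_count => x; rewrite /= inE.
rewrite /npairs -(card_in_imset (f := finset.pblock P)).
  apply: eq_card => B; rewrite inE; apply/andP/imsetP => [[BP B2]|[x]].
    have [x xB] : exists x, x \in B by apply/set0Pn; rewrite -card_gt0 (eqP B2).
    have bx := pblock_eq _ _ BP xB.
    have by0 : bl (Ordinal (lo_lt x)) = bl x by exact: pblock_lo.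
    exists (Ordinal (lo_lt x)); last by rewrite by0.
    by rewrite inE /pletter by0 bx B2 /= /lo bx eqxx.
  by rewrite inE /pletter; case: ifP => // h _ ->; rewrite pblock_in.
move=> x y; rewrite !inE /pletter; case: ifP => // _ /eqP[/eqP xl]; case: ifP => // _ /eqP[/eqP yl] bxy.
by apply: val_inj; rewrite /= xl yl bxy.
Qed.

Lemma nsing_pword : nsing P = count_mem None pword.
Proof.
rewrite /pword count_map.
have -> : count (preim pletter (pred1 None)) (enum 'I_p) = #|[set x | pletter x == None]|.
  by rewrite enumT cardE /enum_mem size_filter; apply: eq_count => x; rewrite /= inE.
rewrite /nsing -(card_in_imset (f := finset.pblock P)).
  apply: eq_card => B; rewrite inE; apply/andP/imsetP => [[BP B1]|[x]].
    have [x xB] : exists x, x \in B by apply/set0Pn; rewrite -card_gt0 (eqP B1).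
    by exists x; rewrite ?inE /pletter (pblock_eq _ _ BP xB)// (eqP B1).
  rewrite inE pletterE; case: ltnP => // h _ ->; rewrite pblock_in card_pblock.
  by rewrite ltnNge h.
move=> x y; rewrite !inE !pletterE; case: ltnP => // hx _; case: ltnP => // hy _ bxy.
have := lo_eqE _ _ bxy; have := lo_le x; have := le_hi x; have := lo_le y; have := le_hi y.
by move=> *; apply: val_inj => /=; lia.
Qed.
End NC.
End Blocks.

(** * From Motzkin words back to noncrossing partitions *)

Section WordPartition.
Local Close Scope ring_scope.
Local Close Scope classical_set_scope.
Variables (p : nat) (w : seq (option bool)).
Hypotheses (sw : size w = p) (w_ok : motzkin 0 w).
Local Notation letter := (nth None w).
Local Notation stk := (stk w).
Local Notation opener := (opener_of w).

Definition wpart : {set {set 'I_p}} :=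
  preim_partition (fun x : 'I_p => opener x) [set: 'I_p]%SET.

Lemma wpart_partition : finset.partition wpart [set: 'I_p]%SET.
Proof. exact: preim_partitionP. Qed.

Let weq : {in [set: 'I_p]%SET & &, equivalence_rel [rel x y : 'I_p | opener x == opener y]}.
Proof. by split=> //= /eqP ->. Qed.

Lemma pblock_wpart (x : 'I_p) : finset.pblock wpart x = [set y : 'I_p | opener x == opener y].
Proof.
apply/setP => y; rewrite inE.
by rewrite (pblock_equivalence_partition weq) ?inE.
Qed.

Lemma in_wpart (B : {set 'I_p}) : B \in wpart -> exists x : 'I_p, B = [set y : 'I_p | opener x == opener y].
Proof.
move=> /imsetP[x _ ->]; exists x; apply/setP => y.
by rewrite !inE.
Qed.

Lemma opener_open x : letter x = Some true -> opener x = x.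
Proof. by rewrite /opener_of => ->. Qed.

Lemma opener_dot x : letter x = None -> opener x = x.
Proof. by rewrite /opener_of => ->. Qed.

Lemma opener_close x : x < p -> letter x = Some false ->
  [/\ opener x = head 0 (stk x), opener x \in stk x, opener x < x & letter (opener x) = Some true].
Proof.
rewrite -sw => xw lx; rewrite /opener_of lx.
have := head_stk_mem _ w_ok x xw; rewrite lx => /(_ isT) h.
by have [h1 h2] := mem_stk _ _ _ h.
Qed.

Lemma wpart_dot (x : 'I_p) : letter x = None -> [set y : 'I_p | opener x == opener y] = [set x].
Proof.
move=> lx; apply/setP => y; rewrite !inE (opener_dot _ lx); apply/eqP/eqP => [xy|->].
  case E : (letter y) => [[]|].
  - by move: xy; rewrite opener_open// => /val_inj ->.
  - by have [_ _ _] := opener_close _ (ltn_ord y) E; rewrite -xy lx.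
  - by move: xy; rewrite opener_dot// => /val_inj ->.
by rewrite opener_dot.
Qed.

Lemma wpart_pair (y c : 'I_p) : y < c -> letter y = Some true -> letter c = Some false ->
  opener c = y -> [set z : 'I_p | opener y == opener z] = [set y; c].
Proof.
move=> yc ly lc oc; apply/setP => z; rewrite !inE opener_open//.
apply/eqP/orP => [yz|[/eqP->|/eqP->]]; last 2 first.
- by rewrite opener_open.
- by rewrite oc.
case E : (letter z) => [[]|].
- by left; move: yz; rewrite opener_open// => /val_inj ->.
- right; have [oz _ _ _] := opener_close _ (ltn_ord z) E.
  apply/eqP/val_inj; apply: (closer_uniq w w_ok); rewrite ?sw; try exact: ltn_ord; try by [].
  rewrite [val z]/= [val c]/=; by rewrite -oz -yz -oc; have [-> _ _ _] := opener_close _ (ltn_ord c) lc.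
- by left; move: yz; rewrite opener_dot// => /val_inj ->.
Qed.

Lemma closer_exI (y : 'I_p) : letter y = Some true ->
  exists c : 'I_p, [/\ y < c, letter c = Some false & opener c = y].
Proof.
move=> ly; have := ltn_ord y; rewrite -{2}sw => yw.
have [c /andP[yc cw] [lc hc]] := closer_ex _ w_ok _ yw ly.
rewrite sw in cw; exists (Ordinal cw); split=> //=.
by have [-> _ _ _] := opener_close _ cw lc.
Qed.

Lemma wpart_block (x : 'I_p) : letter x = None /\ [set y : 'I_p | opener x == opener y] = [set x]
  \/ exists y c : 'I_p, [/\ y < c, letter y = Some true, letter c = Some false, opener c = y &
      [set y : 'I_p | opener x == opener y] = [set y; c] /\ (x = y \/ x = c)].
Proof.
case E : (letter x) => [[]|]; last by left; split=> //; exact: wpart_dot.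
  right; have [c [xc lc oc]] := closer_exI x E; exists x, c; split=> //; split; last by left.
  exact: wpart_pair.
right; have [ox oxs oxx lox] := opener_close _ (ltn_ord x) E.
have yp : opener x < p by exact: ltn_trans (ltn_ord x).
exists (Ordinal yp), x; split=> //; split; last by right.
rewrite -(wpart_pair (Ordinal yp) x)//; apply/setP => z; rewrite !inE /=.
by rewrite (opener_open (opener x)).
Qed.

Lemma wpart_NC : NC12i wpart.
Proof.
have blockP B : B \in wpart -> (exists2 x : 'I_p, letter x = None & B = [set x]) \/
   exists y c : 'I_p, [/\ y < c, letter y = Some true, letter c = Some false, opener c = y & B = [set y; c]].
  move=> /in_wpart[x ->]; case: (wpart_block x) => [[lx ->]|[y [c [h1 h2 h3 h4 [-> _]]]]].
    by left; exists x.
  by right; exists y, c.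
apply/andP; split; first (apply/and3P; split; first exact: wpart_partition).
- apply/forallP => B; apply/implyP => /blockP[[x _ ->]|[y [c [yc _ _ _ ->]]]].
    by rewrite cards1.
  by rewrite card_block ?yc// ltnW.
- apply/forallP => B1; apply/implyP => /blockP B1P; apply/forallP => B2; apply/implyP => /blockP B2P.
  apply/implyP => _; apply/negP => /existsP[a] /existsP[b] /existsP[c] /existsP[e].
  move=> /and5P[ab bc ce a1 /and3P[c1 b2 e2]].
  case: B1P a1 c1 => [[x _ ->]|[y [z [yz ly lz oz ->]]]].
    by rewrite !inE => /eqP ax /eqP cx; move: ab bc; rewrite ax cx => ? ?; lia.
  rewrite !inE => h1 h2; have {h1 h2} [ay cz] : a = y /\ c = z.
    by case/orP: h1 => /eqP ?; case/orP: h2 => /eqP ?; subst => //; lia.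
  subst y z; case: B2P b2 e2 => [[x _ ->]|[y [z [yz' ly' lz' oz' ->]]]].
    by rewrite !inE => /eqP bx /eqP ex; move: bc ce; rewrite bx ex => ? ?; lia.
  rewrite !inE => h1 h2; have {h1 h2} [b_y ez] : b = y /\ e = z.
    by case/orP: h1 => /eqP ?; case/orP: h2 => /eqP ?; subst => //; lia.
  subst y z.
  (* The opener [b] of [e] is still on the stack at [c], whose top is [a]. The top is the latest
     opener, which contradicts [a < b]. *)
  have [oc _ _ _] := opener_close _ (ltn_ord c) lz.
  have [_ be _ _] := opener_close _ (ltn_ord e) lz'.
  rewrite oz' in be; have := stk_persist _ _ c _ be bc (ltnW ce).
  by move=> /stk_head_max; rewrite -oc oz leqNgt ab.
- apply/forallP => B; apply/implyP => /blockP[[x lx ->]|[y [c [yc _ _ _ ->]]]]; last first.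
    by rewrite card_block ?yc// ltnW.
  rewrite cards1 eqxx /=.
  have xw : x < size w by rewrite sw.
  have := head_stk_mem _ w_ok x xw; rewrite lx => /(_ isT) hs.
  have [hx lh] := mem_stk _ _ _ hs; set y := head 0 _ in hs hx lh.
  have yp : y < p by exact: ltn_trans (ltn_ord x).
  have [c [yc lc oc]] := closer_exI (Ordinal yp) lh.
  apply/existsP; exists [set Ordinal yp; c]; rewrite -(wpart_pair _ c)//.
  apply/andP; split; first by rewrite -pblock_wpart pblock_mem// (cover_partition wpart_partition) inE.
  rewrite (wpart_pair _ c)// /nested bmin2 ?bmax2; [|exact: ltnW..].
  have -> : [set x] = [set x; x] by rewrite finset.setUid.
  rewrite bmin2// bmax2// leqnn hx /= andbC; apply/andP; split; last first.
    by apply/eqP => /setP/(_ c); rewrite !inE eqxx orbT => /esym; rewrite orbb => /eqP cx; move: lc; rewrite cx lx.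
  have cx : c != x by apply: contra_eq_neq lx => <-; rewrite lc.
  (* If [c] came before [x], the opener [y], present on the stack at [x], would have survived its
     own closer. *)
  rewrite ltn_neqAle (inj_eq val_inj) eq_sym cx /= leqNgt; apply/negP => cltx.
  have ys : y \in stk c.+1 by apply: (stk_persist _ _ _ _ hs _ cltx); exact: leqW.
  have [occ occs _ _] := opener_close _ (ltn_ord c) lc.
  move: ys; rewrite /= lc; have := stk_uniq w c; have : head 0 (stk c) = y by rewrite -occ oc.
  by move: occs; case: (stk c) => //= a s _ -> /andP[/negP].
Qed.

Lemma pword_wpart : pword p wpart = w.
Proof.
apply: (@eq_from_nth _ None); first by rewrite size_pword sw.
rewrite size_pword => i ip; rewrite (nth_pword _ _ (Ordinal ip)).
rewrite /pletter pblock_wpart.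
have -> : nth None w i = letter (Ordinal ip) by [].
case: (wpart_block (Ordinal ip)) => [[-> ->]|[y [c [yc ly lc oc [-> xyc]]]]].
  by rewrite cards1.
rewrite card_block ?yc ?eqxx ?bmin2; [|exact: ltnW..].
case: xyc => ->; rewrite ?ly ?eqxx// lc.
by case: eqVneq => // cy; move: yc; rewrite cy ltnn.
Qed.
End WordPartition.

Lemma sum_NC12i {R : nmodType} (p : nat) (F : seq (option bool) -> R) :
  (\sum_(P : {set {set 'I_p}} | NC12i P) F (pword p P) =
   \sum_(w : p.-tuple (option bool) | motzkin 0 w) F w)%R.
Proof.
pose h (w : p.-tuple (option bool)) := wpart p w.
pose h' (P : {set {set 'I_p}}) : p.-tuple (option bool) := tcast (size_pword p P) (in_tuple (pword p P)).
have h'E P : h' P = pword p P :> seq _ by rewrite val_tcast.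
rewrite (reindex_onto h h') => [|P NP]; last first.
  by rewrite /h h'E /wpart -partition_of_pword.
apply: eq_big => [w|w /andP[NP /eqP hw]].
  apply/andP/idP => [[NP /eqP hw]|ok].
    by rewrite -hw h'E; exact: pword_motzkin.
  have sw : size w = p by rewrite size_tuple.
  split; first exact: wpart_NC.
  by apply/eqP/val_inj; rewrite /= h'E /h pword_wpart.
by rewrite -[in RHS]hw h'E.
Qed.

(** * Labellings of blocks *)

Section Labels.
Local Close Scope ring_scope.
Context {L : eqType}.
Variables (rel : option L -> L -> bool) (B : seq L) (z0 : L).

(** Every position carries a label, closers and singletons repeating the top of the stack, so that a
    list of labels is a function of the points of the partition. *)
Fixpoint labels (w : seq (option bool)) (st : seq L) : seq (seq L) :=
  match w, st with
  | [::], [::] => [:: [::]]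
  | Some true :: w', _ =>
      [seq y :: l | y <- [seq y <- B | rel (ohead st) y], l <- labels w' (y :: st)]
  | Some false :: w', y :: st' => [seq y :: l | l <- labels w' st']
  | None :: w', y :: _ => [seq y :: l | l <- labels w' st]
  | _, _ => [::]
  end.

Fixpoint labelled (w : seq (option bool)) (l st : seq L) : bool :=
  match w, l, st with
  | [::], [::], [::] => true
  | Some true :: w', y :: l', _ => [&& y \in B, rel (ohead st) y & labelled w' l' (y :: st)]
  | Some false :: w', y :: l', y' :: st' => (y == y') && labelled w' l' st'
  | None :: w', y :: l', y' :: _ => (y == y') && labelled w' l' st
  | _, _, _ => false
  end.

Lemma size_labels w st : size (labels w st) = runs rel B w st.
Proof.
elim: w st => [|[[]|] w IH] [|x st] //=; rewrite ?size_map//.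
- rewrite size_allpairs_dep -big_filter sumnE big_map.
  by apply: eq_bigr => y _; rewrite IH.
- rewrite size_allpairs_dep -big_filter sumnE big_map.
  by apply: eq_bigr => y _; rewrite IH.
Qed.

Lemma mem_labels w l st : (l \in labels w st) = labelled w l st.
Proof.
have H (y : L) l' s : (l' \in [seq y :: l | l <- s]) = if l' is y' :: l'' then (y' == y) && (l'' \in s) else false.
  apply/mapP/idP => [[l1 ls ->]|]; first by rewrite eqxx.
  by case: l' => //= y' l'' /andP[/eqP -> ls]; exists l''.
have H2 (f : L -> seq (seq L)) s l' : (l' \in [seq y :: l | y <- s, l <- f y]) =
    if l' is y' :: l'' then (y' \in s) && (l'' \in f y') else false.
  apply/allpairsPdep/idP => [[y [l1 [ys ls ->]]]|]; first by rewrite ys.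
  by case: l' => //= y' l'' /andP[ys ls]; exists y', l''.
elim: w l st => [|[[]|] w IH] [|y l] [|x st] //=.
- by rewrite H2.
- by rewrite H2.
- by rewrite H2 mem_filter IH -andbA andbCA.
- by rewrite H2 mem_filter IH -andbA andbCA.
- by rewrite H.
- by rewrite H IH.
- by rewrite H.
- by rewrite H IH.
Qed.

Lemma labels_uniq w st : uniq B -> uniq (labels w st).
Proof.
move=> uB; have H (y : L) (s : seq (seq L)) : uniq s -> uniq [seq y :: l | l <- s].
  by move=> us; rewrite map_inj_uniq// => ? ? [].
have H2 (f : L -> seq (seq L)) s : uniq s -> (forall y, uniq (f y)) ->
    uniq [seq y :: l | y <- s, l <- f y].
  by move=> us uf; apply: allpairs_uniq_dep => // -[y l] [y' l'] _ _ /= [-> ->].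
elim: w st => [|[[]|] w IH] [|x st] //=; try exact: H; apply: H2 => //; exact: filter_uniq.
Qed.

(** The condition at one position, read off [stk w x]: it trades the recursion for a statement about
    each point, comparable with the conditions on blocks. *)
Definition label_ok (w : seq (option bool)) (l : seq L) (x : nat) : bool :=
  let st := map (nth z0 l) (stk w x) in
  if nth None w x is Some true then (nth z0 l x \in B) && rel (ohead st) (nth z0 l x)
  else nth z0 l x == head z0 st.

Lemma labelledE w l : motzkin 0 w ->
  reflect (size l = size w /\ forall x, x < size w -> label_ok w l x) (labelled w l [::]).
Proof.
move=> ok.
have szl w' l' st : labelled w' l' st -> size l' = size w'.
  elim: w' l' st => [|[[]|] w' IH] [|y l'] [|x st] //=.
  - by move=> /and3P[_ _ /IH ->].
  - by move=> /and3P[_ _ /IH ->].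
  - by move=> /andP[_ /IH ->].
  - by move=> /andP[_ /IH ->].
suff H m t : t + m = size w -> size l = size w ->
    labelled (drop t w) (drop t l) (map (nth z0 l) (stk w t)) <->
    (forall x, t <= x < size w -> label_ok w l x).
  apply: (iffP idP) => [lab|[sl lab]].
    have sl := szl _ _ _ lab; split=> // x xw.
    have [h _] := H (size w) 0 (add0n _) sl; apply: h; last by rewrite xw.
    by rewrite !drop0.
  have [_ h] := H (size w) 0 (add0n _) sl; move: h; rewrite !drop0; apply.
  by move=> x /andP[_]; exact: lab.
elim: m t => [|m IH] t tm sl.
  rewrite addn0 in tm; rewrite tm drop_size -sl drop_size sl (stk_end _ ok) /=.
  by split=> // _ x; rewrite ltnNge andbN.
have tw : t < size w by rewrite -tm addnS ltnS leq_addr.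
have St : (forall x, t <= x < size w -> label_ok w l x) <->
    label_ok w l t /\ (forall x, t.+1 <= x < size w -> label_ok w l x).
  split=> [h|[h1 h2] x /andP[tx xw]].
    by split=> [|x /andP[tx xw]]; apply: h; rewrite ?leqnn ?tw// (ltnW tx).
  have [->//|xt] := eqVneq x t; apply: h2; rewrite xw andbT ltn_neqAle tx andbT eq_sym//.
have {}IH := IH t.+1 _ sl; rewrite St -IH; last by rewrite addSnnS.
rewrite (drop_nth None tw) (drop_nth z0); last by rewrite sl.
have := stk_neq0 _ ok t tw; rewrite /label_ok /=; case E : (nth None w t) => [[]|] /= ne.
- by rewrite andbA; split=> [/andP[]|[-> ->]].
- case: (stk w t) (ne isT) => //= a s _.
  by split=> [/andP[]|[-> ->]].
- case: (stk w t) (ne isT) => //= a s _.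
  by split=> [/andP[]|[-> ->]].
Qed.
End Labels.

Lemma card_fset_setE {T : choiceType} (A : set T) (s : seq T) : uniq s ->
  (forall x, x \in s <-> A x) -> #|` fset_set A|%fset = size s.
Proof.
move=> us sA; rewrite (_ : A = [set` s]); last first.
  by apply/seteqP; split=> x; rewrite /= -sA.
have fs : finite_set [set` s] by exact: finite_seq.
rewrite (_ : fset_set _ = [fset x in s]%fset) ?card_fseq ?undup_id//.
by apply/fsetP => x; rewrite in_fset_set//; apply/idP/idP; rewrite !inE.
Qed.

(** * Labellings of blocks as labelled runs of the stack machine *)

Section CardBMO.
Context {R : realType} {k : cone_kind} {d : nat}.
Hypothesis d0 : (0 < d)%N.
Variables (p : nat) (P : {set {set 'I_p}}).
Hypothesis NP : NC12i P.
Variable r : pt R k d.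
Local Notation w := (pword p P).
Local Notation bl := (finset.pblock P).
Local Notation lo := (lo p P).
Local Notation hi := (hi p P).
Local Notation z0 := (0 : lat k d).
Local Notation B := (ibox_seq r).
Local Notation wrel := (@weak_rel R k d).
Local Notation lok l := (label_ok wrel B z0 w l).
Local Notation stk := (stk w).
Local Notation L := (lat k d).

Let ok : motzkin 0 w. Proof. exact: pword_motzkin. Qed.
Let CA := @cone_kind_ax R k d d0.

Lemma cle_trans (a b c : pt R k d) : cle a b -> cle b c -> cle a c.
Proof. by rewrite !cleE; exact: (cone_trans _ _ CA). Qed.

Lemma mem_boxE y : (y \in B) = `[< ibox r y >].
Proof. by rewrite (mem_ibox_seq d0); apply: asbool_equiv_eq; rewrite iboxE. Qed.

Definition pblk (x : 'I_p) : blk p P := exist _ (bl x) (pblock_in p P NP x).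

Lemma pblk_eq x y : bl x = bl y -> pblk x = pblk y.
Proof. by move=> xy; apply: val_inj. Qed.

Lemma blk_pblk (b : blk p P) : exists2 x : 'I_p, b = pblk x & lo x = x :> nat.
Proof.
have [x xb] : exists x, x \in val b.
  have := valP b; case/andP: NP => /and3P[/and3P[_ _ P0] _ _] _ bP.
  by apply/set0Pn; apply: contraNneq P0 => <-.
have bx : bl x = val b by apply: pblock_eq xb; [exact: NP|exact: valP b].
pose y := Ordinal (lo_lt p P NP x).
have by_ : bl y = bl x by exact: pblock_lo.
exists y; first by apply: val_inj; rewrite /= by_ bx.
exact: lo_eqE.
Qed.

Definition block_labels (F : {ffun blk p P -> L}) : seq L := [seq F (pblk x) | x <- enum 'I_p].

Definition label_fun (l : seq L) : {ffun blk p P -> L} := [ffun b => nth z0 l (bmin (val b))].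

Lemma size_block_labels F : size (block_labels F) = p.
Proof. by rewrite size_map size_enum_ord. Qed.

Lemma nth_block_labels F (x : 'I_p) : nth z0 (block_labels F) x = F (pblk x).
Proof. by rewrite (nth_map x) ?size_enum_ord// nth_ord_enum. Qed.

Lemma block_labelsK F : label_fun (block_labels F) = F.
Proof.
apply/ffunP => b; rewrite ffunE; have [x -> lx] := blk_pblk b.
by rewrite [bmin _]lx nth_block_labels.
Qed.

Lemma stk_ord y (x : 'I_p) : y \in stk x -> exists2 z : 'I_p, y = z :> nat &
  [/\ lo z = z :> nat, (lo z < hi z)%N, (z < x)%N & (x <= hi z)%N].
Proof.
move=> h; have [yx _] := mem_stk _ _ _ h.
have yp : (y < p)%N by exact: ltn_trans yx (ltn_ord x).
exists (Ordinal yp) => //; move: h; rewrite -[y]/(nat_of_ord (Ordinal yp)).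
by rewrite mem_stk_pword ?(ltnW (ltn_ord x))// => /and4P[/eqP].
Qed.

Lemma stk_memI (z x : 'I_p) : lo z = z :> nat -> (z < x)%N -> (x <= hi z)%N -> (z : nat) \in stk x.
Proof.
move=> lz zx xz; rewrite mem_stk_pword ?(ltnW (ltn_ord x))// lz eqxx zx xz /= andbT.
exact: leq_trans zx xz.
Qed.

Lemma stk_head_ord (x : 'I_p) : stk x != [::] -> exists2 z : 'I_p, head 0%N (stk x) = z &
  [/\ (z : nat) \in stk x, lo z = z :> nat, (lo z < hi z)%N, (z < x)%N & (x <= hi z)%N].
Proof.
move=> ne; have h : head 0%N (stk x) \in stk x by case: stk ne => //= a s _; rewrite mem_head.
by have [z hz [? ? ? ?]] := stk_ord _ _ h; exists z => //; split=> //; rewrite -hz.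
Qed.

Lemma map_head (l : seq L) s : s != [::] -> head z0 (map (nth z0 l) s) = nth z0 l (head 0%N s).
Proof. by case: s. Qed.

Lemma map_ohead (l : seq L) s : ohead (map (nth z0 l) s) =
  if s is [::] then None else Some (nth z0 l (head 0%N s)).
Proof. by case: s. Qed.

Lemma BMO_label_ok F : BMO P r F -> forall x : 'I_p, lok (block_labels F) x.
Proof.
move=> [F1 [F2 F3]] x; rewrite /label_ok nth_pword; have := pletterE p P NP x.
have xw : (x < size w)%N by rewrite size_pword.
have lox := lo_le p P NP x; have hix := le_hi p P NP x.
case: ltnP => lhx E; rewrite E.
  case: eqVneq E => [xl|xl] E.
    rewrite nth_block_labels mem_boxE (asboolT (F1 _)) /= map_ohead.
    case Es : (stk x) => [//|a s]; rewrite -Es.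
    have ne : stk x != [::] by rewrite Es.
    have [z -> [zs lz lhz zx xz]] := stk_head_ord x ne; rewrite nth_block_labels.
    apply/asboolP; apply: F2; first by rewrite /= card_pblock// lhx.
    have hzx : hi z != x.
      apply/eqP => hzx; have := lo_eqE _ _ _ _ (pblock_hi p P NP z x (esym hzx)).
      by rewrite -xl lz => xz'; move: zx; rewrite -xz' ltnn.
    have xz' : (x < hi z)%N by rewrite ltn_neqAle eq_sym hzx.
    rewrite /= nested_pblock// lz -xl zx /=.
    have hh : hi x != hi z.
      apply/eqP => e; have := lo_eqE _ _ _ _ (pblock_hi p P NP z (Ordinal (hi_lt p P NP x)) e).
      rewrite (lo_eqE _ _ _ _ (pblock_hi p P NP x (Ordinal (hi_lt p P NP x)) erefl)) lz -xl => xz''.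
      by move: zx; rewrite -xz'' ltnn.
    by rewrite ltn_neqAle hh; apply: nocross => //; rewrite ?lz -?xl.
  have ne : stk x != [::] by apply: (stk_neq0 _ ok) => //; rewrite nth_pword E.
  have := opener_pword p P NP x; rewrite /opener_of nth_pword E map_head// => ->.
  rewrite -[lo x]/(nat_of_ord (Ordinal (lo_lt p P NP x))) !nth_block_labels.
  by apply/eqP; congr (F _); apply/esym/pblk_eq/pblock_lo.
have ne : stk x != [::] by apply: (stk_neq0 _ ok) => //; rewrite nth_pword E.
rewrite map_head//; have [z hz [zs lz lhz zx xz]] := stk_head_ord x ne; rewrite hz.
rewrite !nth_block_labels; apply/eqP/esym; apply: F3.
  by rewrite /= card_pblock// ltnNge lhx.
have lx : lo x = x :> nat by apply/eqP; rewrite eqn_leq lox (leq_trans hix lhx).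
have hx : hi x = x :> nat by apply/eqP; rewrite eqn_leq hix (leq_trans lhx lox).
have hzx : hi z != x.
  apply/eqP => hzx; have := lo_eqE _ _ _ _ (pblock_hi p P NP z x (esym hzx)).
  by rewrite lx lz => xz'; move: zx; rewrite xz' ltnn.
rewrite /direct_succ /= nested_pblock// lx hx lz zx /=.
rewrite ltn_neqAle eq_sym hzx xz /=.
(* A block strictly in between would have its opener on the stack above the top [z]. *)
apply/existsP => -[b /and3P[bP n1 n2]].
have [y bE ly] := blk_pblk (exist _ b bP); move: bE => [bE].
move: n1 n2; rewrite bE !nested_pblock// lx hx lz => /andP[n1 _] /andP[n2 n3].
have ys : (y : nat) \in stk x.
  by apply: stk_memI => //; [rewrite -ly|exact: ltnW].
by have := stk_head_max _ _ _ ys; rewrite hz leqNgt -ly n1.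
Qed.

Lemma label_ok_lo l (x : 'I_p) : (forall x : 'I_p, lok l x) ->
  nth z0 l x = nth z0 l (lo x).
Proof.
move=> lx; have := lx x; rewrite /label_ok nth_pword; have := pletterE p P NP x.
have xw : (x < size w)%N by rewrite size_pword.
have lox := lo_le p P NP x; have hix := le_hi p P NP x.
case: ltnP => lhx E; rewrite E; last first.
  by move=> _; congr nth; apply/eqP; rewrite eqn_leq lox (leq_trans hix lhx).
case: eqVneq E => [xl|xl] E; first by rewrite -xl.
have ne : stk x != [::] by apply: (stk_neq0 _ ok) => //; rewrite nth_pword E.
by have := opener_pword p P NP x; rewrite /opener_of nth_pword E map_head// => -> /eqP.
Qed.

Lemma pletter_open (x : 'I_p) : lo x = x :> nat -> (lo x < hi x)%N -> nth None w x = Some true.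
Proof. by move=> lx lhx; rewrite nth_pword pletterE// lhx lx eqxx. Qed.

(** The machine compares a label only with the one directly around it, [BMO] with all those around
    it; transitivity down the stack closes the difference. *)
Lemma label_ok_mono l (x y : 'I_p) : (forall x : 'I_p, lok l x) ->
  lo x = x :> nat -> (lo x < hi x)%N -> (y : nat) \in stk x ->
  cle (lpt R (nth z0 l y)) (lpt R (nth z0 l x)).
Proof.
move=> lok; have [n] := ubnP (nat_of_ord x).
elim: n x => // n IH x xn lx lhx ys.
have ne : stk x != [::] by apply: contraTneq ys => ->.
have [z hz [zs lz lhz zx xz]] := stk_head_ord x ne.
have zx_le : cle (lpt R (nth z0 l z)) (lpt R (nth z0 l x)).
  have := lok x; rewrite /label_ok pletter_open// map_ohead hz => /andP[_].
  by case: (stk x) ne => // a s _ /asboolP.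
have [yz|yz] := eqVneq (y : nat) z; first by rewrite yz.
apply: cle_trans zx_le; apply: IH => //; first exact: leq_trans zx _.
apply: (stk_persist _ _ _ _ ys _ (ltnW zx)).
by rewrite ltn_neqAle yz -hz stk_head_max.
Qed.

Lemma label_ok_BMO l : (forall x : 'I_p, lok l x) -> BMO P r (label_fun l).
Proof.
move=> lok; have open_box (z : 'I_p) : lo z = z :> nat -> (lo z < hi z)%N -> ibox r (nth z0 l z).
  move=> lz lhz; have := lok z; rewrite /label_ok pletter_open// => /andP[+ _].
  by rewrite mem_boxE => /asboolP.
have stk_x (x y : 'I_p) : (lo y < lo x)%N -> (hi x < hi y)%N -> lo x = x :> nat -> lo y = y :> nat ->
    (y : nat) \in stk x.
  move=> h1 h2 lx ly; apply: stk_memI => //; first by rewrite -ly -lx.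
  by apply: ltnW; apply: leq_ltn_trans h2; exact: le_hi.
split=> [b|]; last split=> b1 b2.
- have [x -> lx] := blk_pblk b; rewrite ffunE /= [bmin _]lx.
  have [lhx|lhx] := ltnP (lo x) (hi x); first exact: open_box.
  have E : nth None w x = None by rewrite nth_pword pletterE// ltnNge lhx.
  have xw : (x < size w)%N by rewrite size_pword.
  have ne : stk x != [::] by apply: (stk_neq0 _ ok) => //; rewrite E.
  have := lok x; rewrite /label_ok E map_head// => /eqP ->.
  by have [z -> [zs lz lhz zx xz]] := stk_head_ord x ne; exact: open_box.
- have [x -> lx] := blk_pblk b2; have [y -> ly] := blk_pblk b1.
  rewrite /= card_pblock// nested_pblock// => lhx /andP[n1 n2].
  rewrite !ffunE /= [bmin (bl y)]ly [bmin (bl x)]lx.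
  have {}lhx : (lo x < hi x)%N by move: lhx; case: ltnP.
  by apply: label_ok_mono => //; exact: stk_x.
- have [x -> lx] := blk_pblk b2; have [y -> ly] := blk_pblk b1.
  rewrite /= card_pblock// /direct_succ nested_pblock// => lhx /andP[/andP[n1 n2]] /existsP nob.
  rewrite !ffunE /= [bmin (bl y)]ly [bmin (bl x)]lx.
  have {}lhx : (hi x <= lo x)%N by move: lhx; case: ltnP.
  have E : nth None w x = None by rewrite nth_pword pletterE// ltnNge lhx.
  have xw : (x < size w)%N by rewrite size_pword.
  have ne : stk x != [::] by apply: (stk_neq0 _ ok) => //; rewrite E.
  have ys := stk_x x y n1 n2 lx ly.
  have := lok x; rewrite /label_ok E map_head// => /eqP ->.
  have [z hz [zs lz lhz zx xz]] := stk_head_ord x ne; rewrite hz.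
  (* Were the top [z] different from [y], its block would separate the two blocks, against direct
     succession. *)
  have [->//|yz] := eqVneq (y : nat) z; exfalso; apply: nob; exists (bl z).
  have ltyz : (y < z)%N by rewrite ltn_neqAle yz -hz stk_head_max.
  have hix := le_hi p P NP x.
  have xhy : (x < hi y)%N by exact: leq_ltn_trans hix n2.
  rewrite pblock_in// !nested_pblock// ly lz lx ltyz zx /=.
  have hxx : hi x = x :> nat by apply/eqP; rewrite eqn_leq hix -{1}lx lhx.
  have hzx : hi z != x.
    apply/eqP => hzx; have := lo_eqE _ _ _ _ (pblock_hi p P NP z x (esym hzx)).
    by rewrite lx lz => xz'; move: zx; rewrite xz' ltnn.
  have hzy : hi z != hi y.
    apply/eqP => e; have := lo_eqE _ _ _ _ (pblock_hi p P NP y (Ordinal (hi_lt p P NP z)) e).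
    rewrite (lo_eqE _ _ _ _ (pblock_hi p P NP z (Ordinal (hi_lt p P NP z)) erefl)) lz ly => zy.
    by move: ltyz; rewrite zy ltnn.
  rewrite hxx (ltn_neqAle x) eq_sym hzx xz andbT ltn_neqAle hzy.
  rewrite andbT. apply: nocross => //; rewrite ?ly ?lz //; exact: ltn_trans xhy.
Qed.

(** [label_fun] reads a list only at block minima; it is injective on valid lists because, by
    [label_ok_lo], the remaining entries repeat those. *)
Lemma card_BMOE : card_BMO P r = runs wrel B w [::].
Proof.
rewrite -size_labels /card_BMO.
have okE l : l \in labels wrel B w [::] <-> size l = p /\ forall x : 'I_p, lok l x.
  rewrite mem_labels; split=> [/(labelledE wrel B z0 w l ok)[sl h]|[sl h]].
    by rewrite sl size_pword; split=> // x; apply: h; rewrite size_pword.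
  apply/(labelledE wrel B z0 w l ok); rewrite sl size_pword; split=> // x xp.
  exact: (h (Ordinal xp)).
have inj : {in labels wrel B w [::] &, injective label_fun}.
  move=> l l' /okE[sl hl] /okE[sl' hl'] /ffunP e; apply: (@eq_from_nth _ z0); first by rewrite sl.
  rewrite sl => i ip; rewrite (label_ok_lo l (Ordinal ip))// (label_ok_lo l' (Ordinal ip))//.
  by have := e (pblk (Ordinal ip)); rewrite !ffunE.
rewrite (@card_fset_setE _ _ (map label_fun (labels wrel B w [::]))) ?size_map//.
  by rewrite map_inj_in_uniq// labels_uniq// fset_uniq.
move=> F; split=> [/mapP[l /okE[_ hl] ->]|bF]; first exact: label_ok_BMO.
apply/mapP; exists (block_labels F); last by rewrite block_labelsK.
by apply/okE; split; [exact: size_block_labels|exact: BMO_label_ok].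
Qed.
End CardBMO.

(** * Moments on the Fock space *)

Section FockMoment.
Context {R : realType} {k : cone_kind} {d : nat}.
Hypothesis d0 : (0 < d)%N.
Local Notation L := (lat k d).
Variable c : L -> nat -> R[i].
Hypothesis c_unit : forall xi : L, inI R xi ->
  series (fun m => cabs (c xi m) ^+ 2) @ \oo --> (1 : R).
Variables (r : pt R k d) (lam : R).
Local Notation B := (ibox_seq r).
Local Notation srel := (@strict_rel R k d).
Let a : R := (Num.sqrt (Defs.vol r))^-1.
Local Open Scope complex_scope.

(* Coefficient of [S^n Omega] along the tensor product of the [g_xi], [xi] in [st]. *)
Fixpoint amplitude (n : nat) (st : seq L) : R :=
  if n is n'.+1 then
    a * (match st with
         | y :: st' => ((y \in B) && srel (ohead st') y)%:R * amplitude n' st'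
         | [::] => 0
         end + \sum_(x <- B) amplitude n' (x :: st)) +
    lam * match st with
          | y :: _ => (y \in B)%:R * amplitude n' st
          | [::] => 0
          end
  else (nilp st)%:R.

Lemma csum_unit (s : nat -> R) (z : R[i]) : series s @ \oo --> (1 : R) ->
  csum R (fun m => (s m)%:C * z) = z.
Proof.
case: z => x y s1; rewrite /csum.
have H (t : R) : limn (series (fun m => s m * t)) = t.
  have -> : series (fun m => s m * t) = (fun n => series s n * t).
    by apply/funext => n; rewrite /series /= mulr_suml.
  apply/cvg_lim => //; rewrite -[X in _ --> X]mul1r; apply: cvgMl => //.
congr Complex; rewrite -[RHS]H; congr (limn (series _)); apply/funext => m /=; by rewrite mul0r ?subr0 ?addr0.
Qed.

Lemma conj_mul_cabs (z : R[i]) : z^* * z = (cabs z ^+ 2)%:C.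
Proof.
case: z => x y; rewrite /cabs sqr_sqrtr ?addr_ge0 ?sqr_ge0//.
by apply/eqP; rewrite eq_complex /=; apply/andP; split; apply/eqP; ring.
Qed.

(** The infinite sums in the operators only ever meet multiples of [c xi], and the unit norm of
    $g_\xi$ evaluates them. *)
Lemma csum_pairing xi (z : R[i]) (u : nat -> R[i]) : inI R xi ->
  (forall m, u m = z * c xi m) -> csum R (fun m => (c xi m)^* * u m) = z.
Proof.
move=> /c_unit h uE; rewrite -[RHS](csum_unit _ z h); congr csum; apply/funext => m.
by rewrite uE mulrCA conj_mul_cabs mulrC.
Qed.

Lemma sum_pred1 {V : nmodType} (F : L -> V) y :
  \sum_(x <- B) (if x == y then F x else 0) = if y \in B then F y else 0.
Proof.
have uB : uniq B by exact: fset_uniq.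
case: ifPn => yB; last first.
  by rewrite big1_seq// => x /andP[_ xB]; case: eqVneq => // xy; rewrite -xy xB in yB.
rewrite (bigD1_seq y)//= eqxx big1 ?addr0// => x /negbTE -> //.
Qed.

Definition coefs (s : seq (L * nat)) : R[i] := \prod_(q <- s) c q.1 q.2.

Lemma box_inI y : y \in B -> inI R y.
Proof. by rewrite (mem_ibox_seq d0) => /asboolP; rewrite -iboxE => -[]. Qed.

(** The iterates stay in the span of $\Omega$ and the tensors of the $g_\xi$, so the basis indices
    enter only through [coefs] and the dynamics reduces to sequences of labels. *)
Lemma iter_SopE n s :
  iter n (Sop R k d c r lam) (@Omega R k d) s = (amplitude n (map fst s))%:C * coefs s.
Proof.
elim: n s => [|n IH] s.
  by case: s => [|q s] /=; rewrite /coefs ?big_nil ?mulr1 ?mul0r.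
rewrite iterS {1}/Sop !fsbig_finite; [|exact: finite_ibox..].
rewrite -[enum_fset _]/B big_split /=.
have minusE st : \sum_(x <- B) Aminus R k d c x (iter n (Sop R k d c r lam) (@Omega R k d)) st =
    (\sum_(x <- B) amplitude n (x :: map fst st))%:C * coefs st.
  rewrite rmorph_sum mulr_suml big_seq [RHS]big_seq; apply: eq_bigr => x xB.
  apply: csum_pairing; first exact: box_inI.
  by move=> m; rewrite IH /coefs big_cons /= mulrCA mulrC.
rewrite minusE; case: s => [|[y m] s].
  rewrite (_ : \sum_(x <- B) Aplus R k d c x _ [::] = 0); last exact: big1.
  rewrite mulr0 addr0 add0r.
  by rewrite /= mulr0 addr0 add0r -/a rmorphM mulrA.
have plusE : \sum_(x <- B) Aplus R k d c x (iter n (Sop R k d c r lam) (@Omega R k d)) ((y, m) :: s) =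
    (((y \in B) && srel (ohead (map fst s)) y)%:R * amplitude n (map fst s))%:C * coefs ((y, m) :: s).
  rewrite (eq_bigr (fun x => if x == y then
      (if srel (ohead (map fst s)) x then c x m * iter n (Sop R k d c r lam) (@Omega R k d) s else 0) else 0)); last first.
    move=> x _ /=; case: asboolP => [[-> h]|h].
      by rewrite eqxx ifT//; move: h; case: (s) => // -[z mz] s' /= h; exact/asboolP.
    case: eqVneq => // xy; case: ifPn => // h'; exfalso; apply: h; split=> //.
    by move: h'; case: (s) => // -[z mz] s' /= /asboolP.
  rewrite sum_pred1; case: (y \in B) => /=; last by rewrite mul0r mul0r.
  case: ifPn => _; last by rewrite mul0r mul0r.
  by rewrite mul1r IH /coefs big_cons /= mulrCA.
have consE : \sum_(x <- B) Acons R k d c x (iter n (Sop R k d c r lam) (@Omega R k d)) ((y, m) :: s) =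
    ((y \in B)%:R * amplitude n (y :: map fst s))%:C * coefs ((y, m) :: s).
  rewrite (eq_bigr (fun x => if x == y then c x m *
     csum R (fun j => (c x j)^* * iter n (Sop R k d c r lam) (@Omega R k d) ((x, j) :: s)) else 0)); last first.
    by move=> x _ /=; case: asboolP => [->|/eqP]; [rewrite eqxx|rewrite eq_sym => /negbTE ->].
  rewrite sum_pred1; case: ifPn => yB; last by rewrite mul0r mul0r.
  rewrite mul1r (csum_pairing _ ((amplitude n (y :: map fst s))%:C * coefs s)).
  - by rewrite /coefs big_cons /= mulrCA.
  - exact: box_inI.
  - by move=> j; rewrite IH /coefs big_cons /= mulrCA mulrC.
rewrite plusE consE -/a /=.
by rewrite !(rmorphD, rmorphM) /=; ring.
Qed.

Lemma momentE n : moment c r lam n = (amplitude n [::])%:C.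
Proof. by rewrite /moment iter_SopE /coefs big_nil mulr1. Qed.

Fixpoint chain (st : seq L) : bool :=
  if st is y :: st' then [&& y \in B, srel (ohead st') y & chain st'] else true.

(** Cuts the sum over all labels of the box in [amplitude] down to the sum over related labels in
    [runs]. *)
Lemma amplitude_chain n st : ~~ chain st -> amplitude n st = 0.
Proof.
elim: n st => [|n IH] [|y st] //= nc.
have -> : \sum_(x <- B) amplitude n [:: x, y & st] = 0.
  by apply: big1 => x _; apply: IH; rewrite /=; apply: contra nc => /and3P[].
have -> : ((y \in B) && srel (ohead st) y)%:R * amplitude n st = 0.
  case E : ((y \in B) && srel (ohead st) y); last by rewrite mul0r.
  by move: nc; rewrite andbA E /= => /IH ->; rewrite mulr0.
have -> : amplitude n (y :: st) = 0 by exact: IH.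
by rewrite mulr0 addr0 !mulr0 addr0.
Qed.

Definition lweight (x : option bool) : R := if x is None then lam else a.

Lemma sum_tupleS {V : nmodType} {X : finType} n (F : seq X -> V) :
  \sum_(w : n.+1.-tuple X) F w = \sum_(x : X) \sum_(w : n.-tuple X) F (x :: w).
Proof.
rewrite pair_big /= (reindex (fun q : X * n.-tuple X => [tuple of q.1 :: q.2])) //.
exists (fun t => (thead t, [tuple of behead t])) => [[x t] _|t _] /=.
  by congr pair; exact: val_inj.
by rewrite [RHS]tuple_eta; apply: val_inj.
Qed.

Lemma sum_option_bool {V : nmodType} (F : option bool -> V) :
  \sum_x F x = F (Some true) + (F (Some false) + F None).
Proof.
rewrite (bigD1 (Some true))//= (bigD1 (Some false))//= (bigD1 None)//= big1 ?addr0//.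
by move=> [[]|].
Qed.

(* The last factor applied is read first: an annihilator opens a pair, which the
   matching creator closes. *)
Lemma amplitudeE n st : chain st -> amplitude n st =
  \sum_(w : n.-tuple (option bool)) (\prod_(x <- w) lweight x) * (runs srel B w st)%:R.
Proof.
elim: n st => [|n IH] st ch.
  rewrite (big_pred1 [tuple]); last by move=> t; apply/esym/eqP; exact: tuple0.
  by rewrite big_nil mul1r; case: (st).
rewrite (sum_tupleS n (fun s => (\prod_(x <- s) lweight x) * (runs srel B s st)%:R)).
rewrite sum_option_bool.
have wE x : \sum_(w : n.-tuple (option bool)) (\prod_(x <- x :: w) lweight x) * (runs srel B (x :: w) st)%:R =
    lweight x * \sum_(w : n.-tuple (option bool)) (\prod_(x <- w) lweight x) * (runs srel B (x :: w) st)%:R.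
  by rewrite mulr_sumr; apply: eq_bigr => w _; rewrite big_cons mulrA.
rewrite !wE {wE} /= mulrDr -addrA [LHS]addrCA; congr (_ * _ + (_ * _ + _ * _)).
- under [RHS]eq_bigr do rewrite natr_sum mulr_sumr.
  rewrite exchange_big /= [RHS]big_mkcond big_seq [RHS]big_seq; apply: eq_bigr => x xB.
  case: ifPn => xs; last by apply: amplitude_chain; rewrite /= (negbTE xs) andbF.
  by apply: IH; rewrite /= xB xs ch.
- case: st ch => [|y st] /=; first by rewrite big1// => w _; case: (tval w) => *; rewrite mulr0.
  by move=> /and3P[-> -> ch]; rewrite mul1r IH.
- case: st ch => [|y st] /= ch; first by rewrite big1// => w _; case: (tval w) => *; rewrite mulr0.
  by rewrite IH//; case/and3P: ch => ->; rewrite mul1r.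
Qed.

Lemma lweight_fword f : \prod_(x <- fword f) lweight x =
  lam ^+ count_mem None (fword f) / Defs.vol r ^+ fpairs f.
Proof.
have v0 : 0 <= Defs.vol r by rewrite volE cvol_ge0.
have a2 : a * a = (Defs.vol r)^-1 by rewrite -invfM -expr2 sqr_sqrtr.
elim: f => [|f IH|f1 IH1 f2 IH2] /=; first by rewrite big_nil expr0 divr1.
  by rewrite big_cons IH /= exprS mulrA.
rewrite big_cons big_cat big_cons IH1 IH2 /= count_cat /= !exprD exprS exprD.
rewrite !invfM.
transitivity ((a * a) * (lam ^+ count_mem None (fword f1) * lam ^+ count_mem None (fword f2)) *
   ((Defs.vol r ^+ fpairs f1)^-1 * (Defs.vol r ^+ fpairs f2)^-1)); first by ring.
by rewrite a2; ring.
Qed.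

Lemma amplitude_sum n : amplitude n [::] =
  \sum_(w : n.-tuple (option bool) | motzkin 0 w)
     lam ^+ count_mem None w * ((runs srel B w [::])%:R / Defs.vol r ^+ count_mem (Some true) w).
Proof.
rewrite amplitudeE// [RHS]big_mkcond; apply: eq_bigr => w _; case: ifPn => mw; last first.
  by rewrite runs_motzkin// mulr0.
have [f _ ->] := motzkin_forest _ mw.
by rewrite lweight_fword count_push_fword mulrA mulrAC.
Qed.
End FockMoment.

Section ConeLimits.
Context {R : realType} {k : cone_kind} {d : nat}.
Hypothesis d0 : (0 < d)%N.
Implicit Types f g : pt R k d -> R.
Let CA := @cone_kind_ax R k d d0.

Lemma eq_cone_limR f g l : (forall r, in_cone r -> f r = g r) -> cone_limR f l -> cone_limR g l.
Proof.
move=> fg fl e /fl[m [mC mP]]; exists m; split=> // r rC mr.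
by rewrite -fg//; exact: mP.
Qed.

Lemma cone_limRZ f l b : cone_limR f l -> cone_limR (fun r => b * f r) (b * l).
Proof.
move=> fl e e0; have b0 : 0 < `|b| + 1 by rewrite ltr_pwDr.
have [m [mC mP]] := fl (e / (`|b| + 1)) (divr_gt0 e0 b0); exists m; split=> // r rC mr.
rewrite -mulrBr normrM; have := mP r rC mr; rewrite ltr_pdivlMr//; apply: le_lt_trans.
by rewrite mulrC ler_wpM2l// lerDl.
Qed.

Lemma cone_limRD f g l l' : cone_limR f l -> cone_limR g l' ->
  cone_limR (fun r => f r + g r) (l + l').
Proof.
move=> fl gl e e0; have e2 : 0 < e / 2 by rewrite divr_gt0.
have [m [mC mP]] := fl _ e2; have [m' [mC' mP']] := gl _ e2.
(* The sum of two elements of the cone dominates both. *)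
exists (m + m'); split; first exact: (coneD _ _ CA).
move=> r rC mr.
have h1 : cle m r.
  move: mr; rewrite !cleE => mr; apply: (cone_trans _ _ CA) mr.
  by rewrite addrC addKr.
have h2 : cle m' r.
  move: mr; rewrite !cleE => mr; apply: (cone_trans _ _ CA) mr.
  by rewrite addrK.
rewrite opprD addrACA (splitr e); apply: le_lt_trans (ler_normD _ _) _.
by apply: ltrD; [exact: mP|exact: mP'].
Qed.

Lemma cone_limR_sum (I : Type) (s : seq I) (P : pred I) (F : I -> pt R k d -> R) (l : I -> R) :
  (forall i, P i -> cone_limR (F i) (l i)) ->
  cone_limR (fun r => \sum_(i <- s | P i) F i r) (\sum_(i <- s | P i) l i).
Proof.
move=> Fl; elim: s => [|i s IH].
  move=> e e0; exists 0; split; first exact: (cone0 _ _ CA).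
  by move=> r _ _; rewrite !big_nil subr0 normr0.
rewrite big_cons; case: ifPn => Pi.
  by apply: eq_cone_limR (cone_limRD _ _ _ _ (Fl i Pi) IH) => r _; rewrite big_cons Pi.
by apply: eq_cone_limR IH => r _; rewrite big_cons (negbTE Pi).
Qed.
End ConeLimits.

Section WordLimits.
Context {R : realType} {k : cone_kind} {d : nat}.
Hypothesis d0 : (0 < d)%N.

Lemma Vpp_gamma f :
  Vpp (gamma R k d) (pmap id (fword f)) = gcoef (gam in_cone (xi0 R k d)) f.
Proof.
rewrite Vpp_fword; last by rewrite gammaE (gam0 _ _ (cone_kind_ax d0)).
by congr gcoef; apply/funext => n; rewrite gammaE.
Qed.

(** Stated for any [N] between the two counts: it serves the weak count, which is [card_BMO], and
    the strict one, which comes from the moments. *)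
Lemma cone_lim_runs w (N : pt R k d -> nat) : motzkin 0 w ->
  (forall r, in_cone r -> (runs (@strict_rel R k d) (ibox_seq r) w [::] <= N r <=
                          runs (@weak_rel R k d) (ibox_seq r) w [::])%N) ->
  cone_limR (fun r => (N r)%:R / Defs.vol r ^+ count_mem (Some true) w)
            (Vpp (gamma R k d) (pmap id w)).
Proof.
move=> /motzkin_forest[f fdot ->] NP; rewrite Vpp_gamma count_push_fword.
apply: cone_lim_fcount => // r /NP.
by rewrite -[fword f]cats0 !runs_fword /= !muln1.
Qed.

Lemma le_runs w (r : pt R k d) : motzkin 0 w ->
  (runs (@strict_rel R k d) (ibox_seq r) w [::] <= runs (@weak_rel R k d) (ibox_seq r) w [::])%N.
Proof.
move=> /motzkin_forest[f _ ->]; rewrite -[fword f]cats0 !runs_fword /= !muln1.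
by apply: le_fcount => -[x|] // y /asboolP[? _]; exact/asboolP.
Qed.
End WordLimits.

Theorem theorem3p2 (R : realType) (k : cone_kind) (d : nat) (hd : (0 < d)%N)
  (c : lat k d -> nat -> R[i])
  (c_perp : forall xi : lat k d, inI R xi -> c xi 0%N = 0)
  (c_unit : forall xi : lat k d, inI R xi ->
     series (fun m => cabs (c xi m) ^+ 2) @ \oo --> (1 : R))
  (lam : R) (hlam : 0 <= lam) (p : nat) (hp : (2 <= p)%N) :
  (forall P : {set {set 'I_p}}, NC12i P ->
     cone_limR (fun rho : pt R k d =>
                  (card_BMO P rho)%:R / vol rho ^+ npairs P)
               (Vpp (gamma R k d) (reduced_word P)))
  /\
  cone_limC (fun rho : pt R k d => moment c rho lam p)
            ((\sum_(P : {set {set 'I_p}} | NC12i P)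
                lam ^+ nsing P * Vpp (gamma R k d) (reduced_word P))%:C)%C.
Proof.
split=> [P NP|].
  have ok := pword_motzkin p P NP.
  rewrite npairs_pword// reduced_pword.
  apply: cone_lim_runs => // r _.
  by rewrite (card_BMOE hd)// leqnn le_runs.
set l := \sum_(P | _) _.
suff H : cone_limR (fun r : pt R k d => amplitude r lam p [::]) l.
  move=> e /H[m [mC mP]]; exists m; split=> // r rC mr.
  (* The moments are real, so the modulus of the difference is a real absolute value. *)
  rewrite (momentE hd c c_unit) -rmorphB /= /cabs expr0n addr0 sqrtr_sqr.
  exact: mP.
have -> : l = \sum_(w : p.-tuple (option bool) | motzkin 0 w)
    lam ^+ count_mem None w * Vpp (gamma R k d) (pmap id w).
  rewrite -(sum_NC12i p (fun w => lam ^+ count_mem None w * Vpp (gamma R k d) (pmap id w))).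
  by apply: eq_bigr => P NP; rewrite nsing_pword// reduced_pword.
apply: (eq_cone_limR (fun r => \sum_(w : p.-tuple (option bool) | motzkin 0 w) lam ^+ count_mem None w *
    ((runs (@strict_rel R k d) (ibox_seq r) w [::])%:R / Defs.vol r ^+ count_mem (Some true) w))).
  by move=> r _; rewrite amplitude_sum.
apply: (cone_limR_sum hd) => w ok; apply: cone_limRZ; apply: cone_lim_runs => // r _.
by rewrite leqnn le_runs.
Qed.
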